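(* Let $G = \{G_i\}_{i \in I}$ be a profinite group, and let $f: X \to Y$ be a local weak equivalence between presheaves of Kan complexes on the site $G\text{-}\mathbf{Set}_{df}$. Suppose that $X$ and $Y$ have only finitely many non-trivial presheaves of homotopy groups (i.e. they are sectionwise $n$-types for some $n$). Then the induced map of simplicial sets $$f_{\ast}: \varinjlim_{i}\ \mathbf{hom}(EG_{i} \times_{G_{i}} G_{i},X) \to \varinjlim_{i}\ \mathbf{hom}(EG_{i} \times_{G_{i}} G_{i},Y)$$ is a weak equivalence.
   Context: A profinite group is a functor $G: I \to \mathbf{Grp}$, $i \mapsto G_i$, where $I$ is a small left filtered category (non-empty; any two objects have a common lower bound; any two parallel morphisms $i \rightrightarrows j$ have a weak equalizer), all $G_i$ are finite, and all transition homomorphisms $G_i \to G_j$ are surjective. $G\text{-}\mathbf{Set}_{df}$ is the category of finite discrete $G$-sets: finite sets $F$ with an action of $\varprojlim_i G_i$ which factors through some $G_i$, with equivariant maps. It is a site whose coverings are the (jointly) surjective families of equivariant maps. $G_i$ is a finite discrete $G$-set by left multiplication. A simplicial presheaf is a presheaf of simplicial sets on the site; a presheaf of Kan complexes is one with every $X(U)$ a Kan complex. A map $X \to Y$ of simplicial presheaves is a local weak equivalence if $\varinjlim_i X(G_i) \to \varinjlim_i Y(G_i)$ is a weak equivalence of simplicial sets (the stalk functor is $\pi^{\ast}F = \varinjlim_i F(G_i)$). The group $G_i$ acts by $G$-set automorphisms (right translations) on the $G$-set $G_i$, hence on the sheaf $\hom(\ ,G_i)$ it represents, also denoted $G_i$.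 $EG_i \times_{G_i} G_i$ is the Borel construction for this action: the simplicial presheaf whose sections at $U$ are the nerve of the translation groupoid of $G_i$ acting on $\hom(U,G_i)$; its $n$-simplices are $\bigsqcup_{G_i^{\times n}} \hom(\ ,G_i)$. Transition maps $G_j \to G_i$ induce maps $EG_j \times_{G_j} G_j \to EG_i \times_{G_i} G_i$, and the colimit is the resulting filtered colimit. The function complex $\mathbf{hom}(U,X)$ is the simplicial set whose $n$-simplices are the simplicial presheaf maps $U \times \Delta^n \to X$. A presheaf of Kan complexes $X$ is a sectionwise $n$-type (has only finitely many non-trivial presheaves of homotopy groups) if the canonical map $X \to \mathbf{P}_nX$ to its $n$th Moore-Postnikov section (formed sectionwise) is a weak equivalence in each section; equivalently $\pi_k(X(U),x)$ is trivial for all $U$, all vertices $x \in X(U)$ and all $k>n$. *)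

(* Defs.v *)
From HB Require Import structures.
From mathcomp Require Import all_boot fingroup.
From mathcomp Require Import boolp.
From Stdlib Require Import Relation_Operators Operators_Properties.

Set Implicit Arguments.
Unset Strict Implicit.
Unset Printing Implicit Defensive.

Record category := Category {
  ob :> Type;
  hom : ob -> ob -> Type;
  idm : forall a, hom a a;
  cmp : forall a b c, hom b c -> hom a b -> hom a c;
  cmp1m : forall a b (f : hom a b), cmp (idm b) f = f;
  cmpm1 : forall a b (f : hom a b), cmp f (idm a) = f;
  cmpA : forall a b c d (h : hom c d) (g : hom b c) (f : hom a b),
    cmp h (cmp g f) = cmp (cmp h g) f
}.
Arguments idm {_} a.

Record left_filtered (I : category) : Prop := LeftFiltered {
  lf_inhabited : inhabited I;
  lf_bound : forall i j : I, exists k, inhabited (hom k i) /\ inhabited (hom k j);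
  lf_equalizer : forall (i j : I) (f g : hom i j),
    exists k (h : hom k i), cmp f h = cmp g h
}.

Record functor (C D : category) := Functor {
  fob :> C -> D;
  fmor : forall a b, hom a b -> hom (fob a) (fob b);
  fmor1 : forall a, fmor (idm a) = idm (fob a);
  fmorM : forall a b c (g : hom b c) (f : hom a b),
    fmor (cmp g f) = cmp (fmor g) (fmor f)
}.

Definition fcomp (C D E : category) (G : functor D E) (F : functor C D) :
  functor C E.
Proof.
exists (fun a => G (F a)) (fun a b u => fmor G (fmor F u)).
- by move=> a; rewrite !fmor1.
- by move=> a b c g f; rewrite !fmorM.
Defined.

Record psh (C : category) := Psh {
  sec :> C -> Type;
  res : forall a b, hom a b -> sec b -> sec a;
  res1 : forall a (x : sec a), res (idm a) x = x;
  resM : forall a b c (v : hom b c) (u : hom a b) (x : sec c),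
    res (cmp v u) x = res u (res v x)
}.

Record pmap (C : category) (X Y : psh C) := Pmap {
  papp :> forall a, X a -> Y a;
  pnat : forall a b (u : hom a b) (x : X b), papp (res u x) = res u (papp x)
}.

Lemma pmap_ext (C : category) (X Y : psh C) (f g : pmap X Y) :
  (forall a (x : X a), f a x = g a x) -> f = g.
Proof.
case: f g => [f fP] [g gP] /= fg.
have E : f = g by apply: functional_extensionality_dep => a; apply/funext/fg.
by subst g; congr Pmap; apply: Prop_irrelevance.
Qed.

Definition pid (C : category) (X : psh C) : pmap X X.
Proof. by exists (fun a x => x). Defined.

Definition pcomp (C : category) (X Y Z : psh C) (g : pmap Y Z) (f : pmap X Y) :
  pmap X Z.
Proof. by exists (fun a x => g a (f a x)) => a b u x; rewrite !pnat. Defined.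

Definition prod_psh (C : category) (X Y : psh C) : psh C.
Proof.
exists (fun a => (X a * Y a)%type) (fun a b u x => (res u x.1, res u x.2)).
- by move=> a [x y] /=; rewrite !res1.
- by move=> a b c v u [x y] /=; rewrite !resM.
Defined.

Definition prod_pmap (C : category) (X X' Y Y' : psh C)
  (f : pmap X X') (g : pmap Y Y') : pmap (prod_psh X Y) (prod_psh X' Y').
Proof.
exists (fun a (x : prod_psh X Y a) => (f a x.1, g a x.2) : prod_psh X' Y' a).
by move=> a b u [x y] /=; rewrite !pnat.
Defined.

Definition sub_psh (C : category) (X : psh C) (P : forall a, X a -> Prop)
  (hP : forall a b (u : hom a b) (x : X b), P b x -> P a (res u x)) : psh C.
Proof.
exists (fun a => {x : X a | P a x})
       (fun a b u x => exist (P a) (res u (sval x)) (hP _ _ u _ (svalP x))).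
- by move=> a [x px] /=; apply/eq_exist; rewrite res1.
- by move=> a b c v u [x px] /=; apply/eq_exist; rewrite resM.
Defined.

Definition sub_incl (C : category) (X : psh C) (P : forall a, X a -> Prop)
  (hP : forall a b (u : hom a b) (x : X b), P b x -> P a (res u x)) :
  pmap (sub_psh hP) X.
Proof. by exists (fun a (x : sub_psh hP a) => sval x). Defined.

(* In simplex_cat the natural number n stands for the ordinal {0, ..., n}. *)

Record mono (m n : nat) := Mono {
  mfun :> 'I_m.+1 -> 'I_n.+1;
  monoP : forall a b : 'I_m.+1, a <= b -> mfun a <= mfun b
}.

Lemma mono_ext m n (f g : mono m n) : f =1 g -> f = g.
Proof.
case: f g => [f fP] [g gP] /= /funext E; subst g.
by congr Mono; apply: Prop_irrelevance.
Qed.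

Definition mono_id n : mono n n := @Mono n n id (fun a b ab => ab).

Definition mono_comp l m n (g : mono m n) (f : mono l m) : mono l n :=
  @Mono l n (fun a => g (f a)) (fun a b ab => monoP g (monoP f ab)).

Definition mono_cst m n (i : 'I_n.+1) : mono m n :=
  @Mono m n (fun=> i) (fun _ _ _ => leqnn i).

Definition simplex_cat : category.
Proof.
by exists nat mono mono_id mono_comp => *; apply: mono_ext.
Defined.

Notation sset := (psh simplex_cat).

Definition Delta (n : nat) : sset.
Proof.
by exists (fun m => mono m n) (fun a b u t => mono_comp t u) => *;
  apply: mono_ext.
Defined.

Definition Delta_map (m n : nat) (u : mono m n) : pmap (Delta m) (Delta n).
Proof.
by exists (fun k (t : Delta m k) => mono_comp u t : Delta n k).
Defined.

(* t is a simplex of the face of Delta^n opposite to a vertex j other than k *)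
Definition in_horn n (k : 'I_n.+1) m (t : Delta n m) : Prop :=
  exists2 j : 'I_n.+1, j != k & forall a, t a != j.

Definition in_boundary n m (t : Delta n m) : Prop :=
  exists j : 'I_n.+1, forall a, t a != j.

Lemma in_horn_res n (k : 'I_n.+1) a b (u : @hom simplex_cat a b) (t : Delta n b) :
  in_horn k t -> in_horn k (res u t).
Proof. by move=> [j jk tj]; exists j => // x; apply: tj. Qed.

Definition horn n (k : 'I_n.+1) : sset := sub_psh (@in_horn_res n k).
Definition horn_incl n (k : 'I_n.+1) : pmap (horn k) (Delta n) := sub_incl _.

Definition kan (X : sset) : Prop :=
  forall n (k : 'I_n.+2) (a : pmap (horn k) X),
  exists b : pmap (Delta n.+1) X, pcomp b (horn_incl k) = a.

Definition has_lift (A B X Y : sset) (i : pmap A B) (p : pmap X Y) : Prop :=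
  forall (a : pmap A X) (b : pmap B Y), pcomp p a = pcomp b i ->
  exists c : pmap B X, pcomp c i = a /\ pcomp p c = b.

Definition kan_fibration (X Y : sset) (p : pmap X Y) : Prop :=
  forall n (k : 'I_n.+2), has_lift (horn_incl k) p.

(* The saturation of the set of horn inclusions consists of the maps with the
   left lifting property with respect to all Kan fibrations. *)
Definition anodyne (A B : sset) (i : pmap A B) : Prop :=
  forall (X Y : sset) (p : pmap X Y), kan_fibration p -> has_lift i p.

(* The quotient of T by the equivalence relation generated by R, as the type of
   equivalence classes *)

Section Quotient.
Variables (T : Type) (R : T -> T -> Prop).

Definition quot := {C : T -> Prop | exists x, C = clos_refl_sym_trans T R x}.

Definition cls (x : T) : quot :=
  exist _ (clos_refl_sym_trans T R x) (ex_intro _ x erefl).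

Definition repr (c : quot) : T := sval (cid (svalP c)).

Lemma reprK (c : quot) : cls (repr c) = c.
Proof. by case: c => C hC; apply: eq_exist; rewrite /repr; case: cid => x /= ->. Qed.

Lemma cls_eqP x y : cls x = cls y <-> clos_refl_sym_trans T R x y.
Proof.
split=> [[->]|xy]; first exact: rst_refl.
apply: eq_exist; apply/funext => z; apply: propext; split=> h.
  by apply: rst_trans h; apply: rst_sym.
exact: rst_trans h.
Qed.
End Quotient.

Definition quot_map (T U : Type) (R : T -> T -> Prop) (S : U -> U -> Prop)
  (f : T -> U) (c : quot R) : quot S := cls S (f (repr c)).

Lemma quot_mapE (T U : Type) (R : T -> T -> Prop) (S : U -> U -> Prop)
  (f : T -> U) (fRS : forall x y, R x y -> S (f x) (f y)) (x : T) :
  quot_map S f (cls R x) = cls S (f x).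
Proof.
have H a b : clos_refl_sym_trans T R a b -> clos_refl_sym_trans U S (f a) (f b).
  elim=> {a b} [a b ab|a|a b _ ab|a b c _ ab _ bc].
  - by apply: rst_step; apply: fRS.
  - exact: rst_refl.
  - exact: rst_sym.
  - exact: rst_trans bc.
by apply/cls_eqP/H/cls_eqP; rewrite reprK.
Qed.

(* Homotopy groups: pi X x n is the set of homotopy classes rel boundary of maps
   from Delta^n to X sending the boundary to x.  They are the homotopy groups of
   X when X is a Kan complex.  The group laws (for 0 < n) are not needed: the map
   induced by a simplicial map is a homomorphism for them, so it is an
   isomorphism of groups if and only if it is bijective. *)

Definition vcst (X : sset) (x : X 0) m : X m :=
  res (mono_cst m ord0 : @hom simplex_cat m 0) x.

Record sphere (X : sset) (x : X 0) (n : nat) := Sphere {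
  sph :> pmap (Delta n) X;
  sphP : forall m (t : Delta n m), in_boundary t -> sph m t = vcst x m
}.

Definition sphere_homotopic (X : sset) (x : X 0) n (a b : sphere x n) : Prop :=
  exists h : pmap (prod_psh (Delta n) (Delta 1)) X,
  [/\ forall m (t : Delta n m), h m (t, mono_cst m ord0) = a m t,
      forall m (t : Delta n m), h m (t, mono_cst m ord_max) = b m t
    & forall m (t : Delta n m) (s : Delta 1 m),
        in_boundary t -> h m (t, s) = vcst x m].

Definition pi (X : sset) (x : X 0) (n : nat) : Type :=
  quot (@sphere_homotopic X x n).

Definition sphere_map (X Y : sset) (f : pmap X Y) (x : X 0) n (a : sphere x n) :
  sphere (f 0 x) n.
Proof.
exists (pcomp f a) => m t tb /=.
by rewrite (sphP a tb) /vcst pnat.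
Defined.

Definition pi_map (X Y : sset) (f : pmap X Y) (x : X 0) n :
  pi x n -> pi (f 0 x) n := quot_map _ (sphere_map f (n := n)).

Lemma pi_mapE (X Y : sset) (f : pmap X Y) (x : X 0) n (a : sphere x n) :
  pi_map f (cls _ a) = cls _ (sphere_map f a).
Proof.
apply: quot_mapE => b c [h [h0 h1 hb]]; exists (pcomp f h); split=> m t.
- by rewrite /= h0.
- by rewrite /= h1.
- by move=> s tb; rewrite /= hb // /vcst pnat.
Qed.

Definition edge_related (X : sset) (x y : X 0) : Prop :=
  exists e : X 1, res (mono_cst 0 ord0 : @hom simplex_cat 0 1) e = x /\
                  res (mono_cst 0 ord_max : @hom simplex_cat 0 1) e = y.

Definition pi0 (X : sset) : Type := quot (@edge_related X).

Definition pi0_map (X Y : sset) (f : pmap X Y) : pi0 X -> pi0 Y :=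
  quot_map _ (f 0).

Lemma pi0_mapE (X Y : sset) (f : pmap X Y) (x : X 0) :
  pi0_map f (cls _ x) = cls _ (f 0 x).
Proof.
by apply: quot_mapE => a b [e [<- <-]]; exists (f 1 e); rewrite !pnat.
Qed.

Definition pi_iso (X Y : sset) (f : pmap X Y) : Prop :=
  bijective (pi0_map f) /\
  forall (x : X 0) n, 0 < n -> bijective (@pi_map X Y f x n).

(* The homotopy groups of the realization of an arbitrary simplicial set are the
   simplicial homotopy groups of any Kan complex which it maps to by an anodyne
   extension.  When X and Y are Kan complexes one may take i and j to be
   identities, so that the condition amounts to pi_iso f. *)
Definition weak_equivalence (X Y : sset) (f : pmap X Y) : Prop :=
  exists (X' Y' : sset) (i : pmap X X') (j : pmap Y Y') (f' : pmap X' Y'),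
  [/\ kan X' /\ kan Y', anodyne i /\ anodyne j,
      pcomp f' i = pcomp j f & pi_iso f'].

Record spsh (C : category) := Spsh {
  ssec :> C -> sset;
  sres : forall U V, hom U V -> pmap (ssec V) (ssec U);
  sres1 : forall U n (x : ssec U n), sres (idm U) n x = x;
  sresM : forall U V W (v : hom V W) (u : hom U V) n (x : ssec W n),
    sres (cmp v u) n x = sres u n (sres v n x)
}.

Record spmap (C : category) (X Y : spsh C) := Spmap {
  sapp :> forall U, pmap (X U) (Y U);
  snat : forall U V (u : hom U V) n (x : X V n),
    sapp U n (sres X u n x) = sres Y u n (sapp V n x)
}.

Lemma spmap_ext (C : category) (X Y : spsh C) (f g : spmap X Y) :
  (forall U n (x : X U n), f U n x = g U n x) -> f = g.
Proof.
case: f g => [f fP] [g gP] /= fg.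
have E : f = g.
  by apply: functional_extensionality_dep => U; apply: pmap_ext => n x; apply: fg.
by subst g; congr Spmap; apply: Prop_irrelevance.
Qed.

Definition spcomp (C : category) (X Y Z : spsh C) (g : spmap Y Z)
  (f : spmap X Y) : spmap X Z.
Proof.
by exists (fun U => pcomp (g U) (f U)) => U V u n x /=; rewrite !snat.
Defined.

Definition spid (C : category) (X : spsh C) : spmap X X.
Proof. by exists (fun U => pid (X U)). Defined.

Definition sprod (C : category) (Z : spsh C) (K : sset) : spsh C.
Proof.
exists (fun U => prod_psh (Z U) K) (fun U V u => prod_pmap (sres Z u) (pid K)).
- by move=> U n [x y] /=; rewrite sres1.
- by move=> U V W v u n [x y] /=; rewrite sresM.
Defined.

Definition sprod_map (C : category) (Z Z' : spsh C) (K K' : sset)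
  (f : spmap Z Z') (g : pmap K K') : spmap (sprod Z K) (sprod Z' K').
Proof.
exists (fun U => prod_pmap (f U) g : pmap (sprod Z K U) (sprod Z' K' U)).
by move=> U V u n [x y] /=; rewrite snat.
Defined.

Definition function_complex (C : category) (Z X : spsh C) : sset.
Proof.
exists (fun n => spmap (sprod Z (Delta n)) X)
       (fun m n u h => spcomp h (sprod_map (spid Z) (Delta_map u))).
- by move=> n h; apply: spmap_ext => U k [x t]; congr (h U k (_, _)); apply: mono_ext.
- by move=> a b c v u h; apply: spmap_ext => U k [x t]; congr (h U k (_, _));
    apply: mono_ext.
Defined.

Definition function_complex_pre (C : category) (Z Z' X : spsh C)
  (g : spmap Z Z') : pmap (function_complex Z' X) (function_complex Z X).
Proof.
exists (fun n (h : function_complex Z' X n) =>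
  spcomp h (sprod_map g (pid (Delta n))) : function_complex Z X n).
by move=> a b u h; apply: spmap_ext.
Defined.

Definition function_complex_post (C : category) (Z X Y : spsh C)
  (f : spmap X Y) : pmap (function_complex Z X) (function_complex Z Y).
Proof.
exists (fun n (h : function_complex Z X n) => spcomp f h : function_complex Z Y n).
by move=> a b u h; apply: spmap_ext.
Defined.

(* The colimit over the opposite of I, formed in each simplicial degree *)

Section Colimit.
Variables (I : category) (D : spsh I).

Definition colim_step n (x y : {i : I & D i n}) : Prop :=
  exists u : hom (tag x) (tag y), tagged x = sres D u n (tagged y).

Definition colim_res_rep m n (u : @hom simplex_cat m n) (x : {i : I & D i n}) :
  {i : I & D i m} := Tagged (fun i => D i m) (res u (tagged x)).

Lemma colim_res_rep_step m n (u : @hom simplex_cat m n) x y :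
  colim_step x y -> colim_step (colim_res_rep u x) (colim_res_rep u y).
Proof. by case: x y => [i x] [j y] [w /= ->]; exists w; rewrite /= pnat. Qed.

Definition colim : sset.
Proof.
exists (fun n => quot (@colim_step n))
       (fun m n u => quot_map (@colim_step m) (colim_res_rep u)).
- move=> n x; rewrite -[x]reprK quot_mapE; last exact: colim_res_rep_step.
  by case: (repr x) => i y; rewrite /colim_res_rep /= res1.
- move=> a b c v u x; rewrite -[x]reprK.
  rewrite !quot_mapE; try exact: colim_res_rep_step.
  by case: (repr x) => i y; rewrite /colim_res_rep /= resM.
Defined.

Definition colim_in (i : I) : pmap (D i) colim.
Proof.
exists (fun n (x : D i n) => cls _ (Tagged (fun i => D i n) x) : colim n).
by move=> a b u x /=; rewrite quot_mapE //; apply: colim_res_rep_step.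
Defined.
End Colimit.

Section ColimitMap.
Variables (I : category) (D E : spsh I) (f : spmap D E).

Definition colim_map_rep n (x : {i : I & D i n}) : {i : I & E i n} :=
  Tagged (fun i => E i n) (f (tag x) n (tagged x)).

Lemma colim_map_rep_step n x y :
  colim_step x y -> colim_step (@colim_map_rep n x) (colim_map_rep y).
Proof. by case: x y => [i x] [j y] [w /= ->]; exists w; rewrite /= snat. Qed.

Definition colim_map : pmap (colim D) (colim E).
Proof.
exists (fun n (x : colim D n) =>
  quot_map (@colim_step _ E n) (@colim_map_rep n) x : colim E n).
move=> a b u x; rewrite -[x]reprK /=.
rewrite !quot_mapE; try exact: colim_res_rep_step;
  try exact: colim_map_rep_step.
by case: (repr x) => i y; rewrite /colim_map_rep /colim_res_rep /= pnat.
Defined.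

Lemma colim_mapE i n (x : D i n) :
  colim_map n (colim_in D i n x) = colim_in E i n (f i n x).
Proof. by rewrite /= quot_mapE //; apply: colim_map_rep_step. Qed.
End ColimitMap.

Local Open Scope group_scope.

Lemma sval_inj (T : Type) (P : T -> Prop) (s t : {x | P x}) :
  sval s = sval t -> s = t.
Proof. by case: s t => [s ps] [t pt] /=; apply: eq_exist. Qed.

Record left_action (H : Type) (e : H) (m : H -> H -> H) (S : Type) := LeftAction {
  lact :> H -> S -> S;
  lact1 : forall x, lact e x = x;
  lactM : forall g h x, lact (m g h) x = lact g (lact h x)
}.

Notation group_action H S := (@left_action H 1 *%g S).

Definition tgrpd (H : groupType) (S : Type) (A : group_action H S) : category.
Proof.
exists S (fun x y => {g : H | A g x = y})
  (fun x => exist _ 1 (lact1 A x))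
  (fun x y z g h => exist (fun k => A k x = z) (sval g * sval h)
    (etrans (lactM A (sval g) (sval h) x)
            (etrans (congr1 (A (sval g)) (svalP h)) (svalP g)))).
- by move=> x y [g gP]; apply: sval_inj; rewrite /= mul1g.
- by move=> x y [g gP]; apply: sval_inj; rewrite /= mulg1.
- by move=> x y z w g h k; apply: sval_inj; rewrite /= mulgA.
Defined.

Lemma tgrpd_functor_ext (C : category) (H : groupType) (S : Type)
  (A : group_action H S) (F F' : functor C (tgrpd A)) :
  (forall a, F a = F' a :> S) ->
  (forall a b (u : hom a b), sval (fmor F u) = sval (fmor F' u)) -> F = F'.
Proof.
case: F F' => [F Fm F1 FM] [F' Fm' F1' FM'] /= /funext E; subst F' => Em.
have E : Fm = Fm'.
  apply: functional_extensionality_dep => a.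
  apply: functional_extensionality_dep => b; apply/funext => u.
  by apply: sval_inj; apply: Em.
by subst Fm'; congr Functor; apply: Prop_irrelevance.
Qed.

Definition tgrpd_map (H K : groupType) (S T : Type)
  (A : group_action H S) (B : group_action K T)
  (p : {multiplicative H -> K}) (f : S -> T)
  (fP : forall h x, f (A h x) = B (p h) (f x)) : functor (tgrpd A) (tgrpd B).
Proof.
exists (f : tgrpd A -> tgrpd B)
  (fun x y g => exist (fun k => B k (f x) = f y) (p (sval g))
     (etrans (esym (fP (sval g) x)) (congr1 f (svalP g)))).
- move=> x; apply: sval_inj => /=.
  by apply: (@mulgI _ (p 1)); rewrite -gmulfM !mulg1.
- by move=> x y z g h; apply: sval_inj; rewrite /= gmulfM.
Defined.

Definition ord_cat (n : nat) : category.
Proof.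
exists 'I_n.+1 (fun a b => a <= b) (fun a => leqnn a)
  (fun a b c bc ab => leq_trans ab bc) => *; exact: bool_irrelevance.
Defined.

Definition mono_functor m n (u : mono m n) : functor (ord_cat m) (ord_cat n).
Proof.
exists (mfun u : ord_cat m -> ord_cat n) (fun a b ab => monoP u ab) => *;
  exact: bool_irrelevance.
Defined.

Lemma functor_congr (C D : category) (F : C -> D)
  (Fm : forall a b, hom a b -> hom (F a) (F b)) p1 p2 q1 q2 :
  @Functor C D F Fm p1 p2 = @Functor C D F Fm q1 q2.
Proof. by congr Functor; apply: Prop_irrelevance. Qed.

Definition nerve (C : category) : sset.
Proof.
exists (fun n => functor (ord_cat n) C) (fun m n u F => fcomp F (mono_functor u)).
- by move=> n [F Fm F1 FM]; apply: functor_congr.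
- by move=> a b c v u F; apply: functor_congr.
Defined.

Definition nerve_map (C D : category) (F : functor C D) :
  pmap (nerve C) (nerve D).
Proof.
exists (fun n (s : nerve C n) => fcomp F s : nerve D n).
by move=> a b u s; apply: functor_congr.
Defined.

Record profinite (I : category) := Profinite {
  pgrp :> I -> finGroupType;
  ptr : forall i j, hom i j -> {multiplicative pgrp i -> pgrp j};
  ptr1 : forall i x, ptr (idm i) x = x;
  ptrM : forall i j k (v : hom j k) (u : hom i j) x,
    ptr (cmp v u) x = ptr v (ptr u x);
  ptr_surj : forall i j (u : hom i j) y, exists x, ptr u x = y;
  pfiltered : left_filtered I
}.

Section ProfiniteLimit.
Variables (I : category) (G : profinite I).

Record plim := Plim {
  pt :> forall i, G i;
  ptP : forall i j (u : hom i j), ptr G u (pt i) = pt j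
}.

Lemma plim_ext (g h : plim) : (forall i, g i = h i) -> g = h.
Proof.
case: g h => [g gP] [h hP] /= gh.
have E : g = h by apply: functional_extensionality_dep.
subst h.
by congr Plim; apply: Prop_irrelevance.
Qed.

Lemma ptr_one i j (u : hom i j) : ptr G u 1 = 1.
Proof. by apply: (@mulgI _ (ptr G u 1)); rewrite -gmulfM !mulg1. Qed.

Lemma ptr_inv i j (u : hom i j) x : ptr G u x^-1 = (ptr G u x)^-1.
Proof.
by apply: (@mulgI _ (ptr G u x)); rewrite -gmulfM !mulgV ptr_one.
Qed.

(* Only the monoid structure of the limit group is recorded: inverses play no
   role in the definition of an action. *)

Definition plim_one : plim := Plim (ptr_one).
Definition plim_mul (g h : plim) : plim.
Proof. by exists (fun i => g i * h i) => i j u; rewrite gmulfM !ptP. Defined.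

Record gset := Gset {
  gcar :> finType;
  gact : @left_action plim plim_one plim_mul gcar;
  gdiscrete : exists i (a : group_action (G i) gcar),
    forall (g : plim) x, gact g x = a (g i) x
}.

Record gmap (E F : gset) := Gmap {
  gfun :> E -> F;
  gfunP : forall (g : plim) x, gfun (gact E g x) = gact F g (gfun x)
}.

Lemma gmap_ext (E F : gset) (f h : gmap E F) : f =1 h -> f = h.
Proof.
case: f h => [f fP] [h hP] /= /funext E'; subst h.
by congr Gmap; apply: Prop_irrelevance.
Qed.

Definition gmap_id (E : gset) : gmap E E.
Proof. by exists id. Defined.

Definition gmap_comp (E F K : gset) (h : gmap F K) (f : gmap E F) : gmap E K.
Proof. by exists (fun x => h (f x)) => g x; rewrite !gfunP. Defined.

Definition gset_cat : category.
Proof. by exists gset gmap gmap_id gmap_comp => *; apply: gmap_ext. Defined.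

Definition lmul_action (H : groupType) : group_action H H.
Proof.
exists (fun g x => g * x) => [x|g h x]; first exact: mul1g.
by rewrite mulgA.
Defined.

Definition gset_grp_act (i : I) : @left_action plim plim_one plim_mul (G i).
Proof.
exists (fun (g : plim) x => g i * x) => [x|g h x]; first exact: mul1g.
by rewrite mulgA.
Defined.

Definition gset_grp (i : I) : gset_cat.
Proof.
exists (G i) (gset_grp_act i).
by exists i, (lmul_action (G i)).
Defined.

Definition gset_tr i j (u : hom i j) : hom (gset_grp i) (gset_grp j).
Proof.
exists (ptr G u : gset_grp i -> gset_grp j) => g x /=.
by rewrite gmulfM ptP.
Defined.

Definition stalk_diagram (X : spsh gset_cat) : spsh I.
Proof.
exists (fun i => X (gset_grp i)) (fun i j u => sres X (gset_tr u)).
- move=> i n x; rewrite -[RHS]sres1; congr (sres X _ n x).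
  by apply: gmap_ext => y; apply: ptr1.
- move=> i j k v u n x; rewrite -sresM; congr (sres X _ n x).
  by apply: gmap_ext => y; apply: ptrM.
Defined.

Definition stalk_diagram_map (X Y : spsh gset_cat) (f : spmap X Y) :
  spmap (stalk_diagram X) (stalk_diagram Y).
Proof.
exists (fun i => f (gset_grp i) : pmap (stalk_diagram X i) (stalk_diagram Y i)).
by move=> i j u n x /=; rewrite snat.
Defined.

(* The stalk of a presheaf F is the colimit of the sets F(G_i). *)
Definition local_weak_equivalence (X Y : spsh gset_cat) (f : spmap X Y) : Prop :=
  weak_equivalence (colim_map (stalk_diagram_map f)).

(* Right translations: the left action g.x = x g^-1 of G_i on the G-set G_i *)
Definition rtrans i (g : G i) : @hom gset_cat (gset_grp i) (gset_grp i).
Proof.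
exists (fun x : G i => (x * g^-1 : G i) : gset_grp i) => h x /=.
by rewrite mulgA.
Defined.

Definition rtrans_action (U : gset_cat) (i : I) :
  group_action (G i) (hom U (gset_grp i)).
Proof.
exists (fun g s => cmp (rtrans g) s).
- by move=> s; apply: gmap_ext => x /=; rewrite invg1 mulg1.
- by move=> g h s; apply: gmap_ext => x /=; rewrite invMg mulgA.
Defined.

Lemma rtrans_action_res U V i (u : hom U V) (g : G i) (s : hom V (gset_grp i)) :
  cmp (rtrans_action V i g s) u = rtrans_action U i g (cmp s u).
Proof. by apply: gmap_ext. Qed.

Lemma rtrans_action_tr U i j (u : hom i j) (g : G i) (s : hom U (gset_grp i)) :
  cmp (gset_tr u) (rtrans_action U i g s) =
  rtrans_action U j (ptr G u g) (cmp (gset_tr u) s).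
Proof. by apply: gmap_ext => x /=; rewrite gmulfM ptr_inv. Qed.

(* EG_i x_{G_i} G_i *)
Definition borel (i : I) : spsh gset_cat.
Proof.
exists (fun U => nerve (tgrpd (rtrans_action U i)))
  (fun U V u => nerve_map (@tgrpd_map _ _ _ _ _ _ idfun
                             (fun s => cmp s u) (rtrans_action_res u))).
- by move=> U n F; apply: tgrpd_functor_ext => //= a; apply: gmap_ext.
- by move=> U V W v u n F; apply: tgrpd_functor_ext => //= a; apply: gmap_ext.
Defined.

Definition borel_tr i j (u : hom i j) : spmap (borel i) (borel j).
Proof.
exists (fun U => nerve_map (@tgrpd_map _ _ _ _ _ _ (ptr G u)
                  (fun s => cmp (gset_tr u) s) (@rtrans_action_tr U i j u))
                 : pmap (borel i U) (borel j U)).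
by move=> U V w n F; apply: tgrpd_functor_ext => //= a; apply: gmap_ext.
Defined.

Definition borel_hom (X : spsh gset_cat) : spsh I.
Proof.
exists (fun i => function_complex (borel i) X)
  (fun i j u => function_complex_pre X (borel_tr u)).
- move=> i n h; apply: spmap_ext => U k [F t] /=; congr (h U k (_, _)).
  by apply: tgrpd_functor_ext => [a|a b ab] /=; [apply: gmap_ext => x|]; apply: ptr1.
- move=> i j k v u n h; apply: spmap_ext => U l [F t] /=; congr (h U l (_, _)).
  by apply: tgrpd_functor_ext => [a|a b ab] /=; [apply: gmap_ext => x|]; apply: ptrM.
Defined.

Definition borel_hom_map (X Y : spsh gset_cat) (f : spmap X Y) :
  spmap (borel_hom X) (borel_hom Y).
Proof.
exists (fun i => function_complex_post (borel i) f
                 : pmap (borel_hom X i) (borel_hom Y i)).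
by move=> i j u n h; apply: spmap_ext.
Defined.

End ProfiniteLimit.

Local Close Scope group_scope.

Definition presheaf_of_kan (C : category) (X : spsh C) : Prop :=
  forall U, kan (X U).

Definition sectionwise_type (C : category) (n : nat) (X : spsh C) : Prop :=
  forall (U : C) (x : X U 0) k, n < k -> forall a b : pi x k, a = b.

(* Main.v *)
From mathcomp Require Import all_boot fingroup.
From mathcomp Require Import boolp zify.
From Stdlib Require Import Relation_Operators.
Require Import Defs.

Set Implicit Arguments.
Unset Strict Implicit.
Unset Printing Implicit Defensive.

(** For a stage [i] write [X_i] for the Kan complex [X(G_i)], with its action of
    the finite group [G_i]. The Borel construction is in each degree a finite
    coproduct of copies of the presheaf represented by [G_i], hence a map out of
    it, or out of its product with a simplex, is built one cell at a time: each
    generating cell of dimension [k] poses a lifting problem for the boundary of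
    [Delta k] in [X_i] and [Y_i], and the values on the other cells follow by
    freeness ([cell_step], [cell_lifting]). The map [f] is not a fibration; it is
    replaced by its mapping path object [mpath], for which lifting means lifting
    up to a homotopy ([path_lifting]).

    Two facts solve these problems. On the one hand, the colimits of the [X_i] and
    of the [Y_i] are Kan complexes and the map between them induces bijections on
    homotopy groups; so every problem can be solved in the colimit
    ([strict_lifting_succ], [path_lifting_strict]) and, the simplices and prisms
    being finite, at some later stage ([local_path_lifting]). There are finitely
    many generating cells of dimension [k], and the cells of a later stage lie
    over those of an earlier one; hence all problems of dimension [k] are solved
    together at the price of one change of stage ([stage_step]). On the other hand,
    if [X] and [Y] are sectionwise [n]-types, problems of large dimension are
    solvable in each section, without any change of stage
    ([sectionwise_path_lifting]). So finitely many changes of stage are enough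
    ([late_lift]).

    Consequently every square from the boundary of a simplex to the simplex, with
    values in the colimits of the function complexes, has a lift up to homotopy
    ([hom_diagram_strict_lifting]). These colimits are Kan complexes
    ([function_complex_kan], [colim_kan]), and the lifting property implies that
    the map between them is bijective on homotopy groups
    ([strict_lifting_pi_iso]).

    All constructions in Kan complexes rest on one theorem,
    [homotopy_extension], which in turn follows from the filling of prisms by
    horns ([prism_filling]) and from the lifting theorem [cell_lifting]. *)

(** * Simplices and monotone maps *)

(** Restriction along a monotone map, seen as a morphism of [simplex_cat]. *)
Notation pull w := (res (w : @hom simplex_cat _ _)).

Lemma res_comp (X : sset) l m n (v : mono m n) (u : mono l m) (x : X n) :
  pull u (pull v x) =
  pull (mono_comp v u) x.
Proof. by rewrite -resM. Qed.

Lemma res_id (X : sset) n (u : mono n n) (x : X n) :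
  (forall a, u a = a) -> pull u x = x.
Proof.
move=> h; rewrite -[RHS]res1; congr (res _ x).
exact: mono_ext.
Qed.

Definition yon (X : sset) n (x : X n) : pmap (Delta n) X.
Proof.
exists (fun m (t : Delta n m) => pull t x) => a b u t.
by rewrite /= -resM.
Defined.

Lemma yon_id (X : sset) n (x : X n) : yon x n (mono_id n) = x.
Proof. exact: res_id. Qed.

Lemma yon_eta (X : sset) n (g : pmap (Delta n) X) : g = yon (g n (mono_id n)).
Proof.
apply: pmap_ext => m t /=; rewrite -pnat; congr (g m _).
exact: mono_ext.
Qed.

Lemma in_boundary_res n a b (u : @hom simplex_cat a b) (t : Delta n b) :
  in_boundary t -> in_boundary (res u t).
Proof. by move=> [j tj]; exists j => x; apply: tj. Qed.

Definition bd n : sset := sub_psh (@in_boundary_res n).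
Definition bd_incl n : pmap (bd n) (Delta n) := sub_incl _.

Lemma mono_surjP m n (t : mono m n) :
  ~ in_boundary (t : Delta n m) <-> forall j, exists a, t a = j.
Proof.
split=> [h j|h [j tj]]; last by have [a] := h j; move/eqP; apply/negP/tj.
apply: contrapT => hj; apply: h; exists j => a; apply/eqP => e.
by apply: hj; exists a.
Qed.

(** Every element of the source lies in the image of a section, so that a
    surjection is determined by its sections. *)
Lemma mono_section m n (t : mono m n) (a : 'I_m.+1) :
  ~ in_boundary (t : Delta n m) ->
  exists d : mono n m, (forall j, t (d j) = j) /\ d (t a) = a.
Proof.
move=> /mono_surjP h.
pose d0 j := sval (cid (h j)).
have d0K j : t (d0 j) = j by rewrite /d0; case: cid.
pose d j := if j == t a then a else d0 j.
have dK j : t (d j) = j by rewrite /d; case: eqP.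
have dm (j k : 'I_n.+1) : j <= k -> d j <= d k.
  move=> jk; case: (leqP (d j) (d k)) => // kj.
  have := monoP t (ltnW kj); rewrite !dK => kj'.
  have /val_inj e : val j = val k by apply/eqP; rewrite eqn_leq jk.
  by move: kj; rewrite e ltnn.
exists (Mono dm); split=> //=.
by rewrite /d eqxx.
Qed.

Lemma mono_surj_id n (t : mono n n) :
  ~ in_boundary (t : Delta n n) -> forall a, t a = a.
Proof.
move=> /mono_surjP h.
have inj : injective t.
  apply/injectiveP/dinjectiveP.
  have /card_uniqP u : #|codom t| = size (codom t).
    rewrite size_codom; apply: eq_card => j; rewrite !inE.
    by have [a <-] := h j; apply: codom_f.
  by apply/dinjectiveP.
have lt (a b : 'I_n.+1) : a < b -> t a < t b.
  move=> ab; rewrite ltn_neqAle (monoP t (ltnW ab)) andbT.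
  by apply/eqP => e; move: ab; rewrite (inj _ _ (val_inj e)) ltnn.
have ge : forall k (a : 'I_n.+1), val a = k -> a <= t a.
  elim=> [|k IH] a ak; first by rewrite ak.
  have kn : k < n.+1 by rewrite ltnW // -ak ltn_ord.
  have := IH (Ordinal kn) erefl => /= le1.
  by rewrite ak; apply: leq_ltn_trans le1 _; apply: lt; rewrite /= ak.
have le : forall k (a : 'I_n.+1), n - a = k -> t a <= a.
  elim=> [|k IH] a ak.
    have : n <= a by rewrite -subn_eq0 ak.
    by apply: leq_trans; rewrite -ltnS ltn_ord.
  have an : a.+1 < n.+1 by rewrite ltnS -subn_gt0 ak.
  have := IH (Ordinal an); rewrite /= subnS ak => /(_ erefl) le1.
  by rewrite -ltnS; apply: leq_trans le1; apply: lt.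
by move=> a; apply: val_inj; apply/eqP; rewrite eqn_leq (le _ a erefl) (ge _ a erefl).
Qed.

(** Hence a partial map which is defined in all dimensions below [n] is defined
    on the boundary of every [n]-simplex. *)
Lemma boundary_factor m n (t : mono m n) :
  in_boundary (t : Delta n m) ->
  exists n' (d : mono n' n) (t' : mono m n'), n' < n /\ t = mono_comp d t'.
Proof.
move=> [j tj].
case: n t j tj => [|n] t j tj.
  by move: (tj ord0); rewrite [t _]ord1 [j]ord1.
exists n.
have dm (a b : 'I_n.+1) : a <= b -> lift j a <= lift j b.
  by move=> ab; rewrite /= leq_bump2.
have bm (a : 'I_m.+1) : unbump j (t a) < n.+1.
  have := tj a; case: (unliftP j (t a)) => [k ->|->]; last by rewrite eqxx.
  by rewrite /= bumpK ltn_ord.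
have sm (a b : 'I_m.+1) : a <= b -> Ordinal (bm a) <= Ordinal (bm b).
  by move=> ab; rewrite /= /unbump; have := monoP t ab; move: (tj a) (tj b);
     rewrite -!val_eqE /= /unbump; case: ltngtP; case: ltngtP => //=; lia.
exists (Mono dm), (Mono sm); split=> //.
apply: mono_ext => a; apply: val_inj => /=.
by rewrite unbumpK // inE; apply: tj.
Qed.

(** * Partial maps of simplicial presheaves *)

Lemma sres_res (C : category) (B : spsh C) U V (u : hom U V) m n (w : mono m n) (x : B V n) :
  sres B u m (pull w x) =
  pull w (sres B u n x).
Proof. exact: pnat. Qed.

Section PGraph.
Variables (C : category) (B P : spsh C).

(** Partial maps are given by their graphs: gluing is then a union, and no
    subobject has to be formed. *)
Record pgraph := PGraph {
  gr :> forall U m, B U m -> P U m -> Prop;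
  gr_sres : forall U V (u : hom U V) m (x : B V m) p,
    gr x p -> gr (sres B u m x) (sres P u m p);
  gr_res : forall U m n (w : mono m n) (x : B U n) p,
    gr x p -> gr (pull w x) (pull w p);
  gr_fun : forall U m (x : B U m) p p', gr x p -> gr x p' -> p = p'
}.

Definition gdom (g : pgraph) U m (x : B U m) := exists p, g U m x p.

Definition gsub (g g' : pgraph) := forall U m (x : B U m) p, g U m x p -> g' U m x p.

(** A generator on which a saturated partial map is undefined stays out of the
    domain after every restriction, so that it can be given a value freely. *)
Definition gsat (g : pgraph) := forall U V (u : hom U V) m (x : B V m),
  gdom g (sres B u m x) -> gdom g x.

Lemma gdom_res (g : pgraph) U m n (w : mono m n) (x : B U n) :
  gdom g x -> gdom g (pull w x).
Proof. by move=> [p gp]; exists (pull w p); apply: gr_res. Qed.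

Lemma gdom_sres (g : pgraph) U V (u : hom U V) m (x : B V m) :
  gdom g x -> gdom g (sres B u m x).
Proof. by move=> [p gp]; exists (sres P u m p); apply: gr_sres. Qed.

Lemma gsub_dom (g g' : pgraph) : gsub g g' ->
  forall U m (x : B U m), gdom g x -> gdom g' x.
Proof. by move=> s U m x [p gp]; exists p; apply: s. Qed.

Lemma pgraph_total (g : pgraph) : (forall U m (x : B U m), gdom g x) ->
  exists h : spmap B P, forall U m (x : B U m), g U m x (h U m x).
Proof.
move=> tot.
pose h U m x := sval (cid (tot U m x)).
have hP U m x : g U m x (h U m x) by rewrite /h; case: cid.
have hn U a b (u : @hom simplex_cat a b) x : h U a (res u x) = res u (h U b x).
  by apply: (gr_fun (hP _ _ _)); apply: (gr_res u); apply: hP.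
have hs U V (u : hom U V) m x : h U m (sres B u m x) = sres P u m (h V m x).
  by apply: (gr_fun (hP _ _ _)); apply: gr_sres; apply: hP.
by exists (Spmap (sapp := fun U => Pmap (hn U)) hs).
Qed.

(** The union of [g] and of all restrictions of the pairs [(x0 j, c j)] is still
    functional: the first hypothesis compares the new part with [g], the second
    one compares it with itself where [g] is undefined. *)
Lemma pgraph_attach (g : pgraph) V n (J : Type) (x0 : J -> B V n) (c : J -> P V n) :
  (forall j W (w : hom W V) m (t : mono m n),
     gdom g (pull t (sres B w n (x0 j))) ->
     g W m (pull t (sres B w n (x0 j)))
           (pull t (sres P w n (c j)))) ->
  (forall j j' W (w w' : hom W V) m (t t' : mono m n),
     ~ gdom g (pull t (sres B w n (x0 j))) ->
     pull t (sres B w n (x0 j)) =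
     pull t' (sres B w' n (x0 j')) ->
     pull t (sres P w n (c j)) =
     pull t' (sres P w' n (c j'))) ->
  exists g' : pgraph, [/\ gsub g g', forall j, g' V n (x0 j) (c j) &
    forall U m (x : B U m) p, g' U m x p -> g U m x p \/
      exists j (w : hom U V) (t : mono m n),
        x = pull t (sres B w n (x0 j)) /\
        p = pull t (sres P w n (c j))].
Proof.
move=> h1 h2.
pose r U m (x : B U m) p := g U m x p \/
      exists j (w : hom U V) (t : mono m n),
        x = pull t (sres B w n (x0 j)) /\
        p = pull t (sres P w n (c j)).
have r1 U W (u : hom U W) m (x : B W m) p : r W m x p -> r U m (sres B u m x) (sres P u m p).
  case=> [gp|[j [w [t [-> ->]]]]]; first by left; apply: gr_sres.
  by right; exists j, (cmp w u), t; rewrite !sres_res !sresM.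
have r2 U k m (w : mono k m) (x : B U m) p : r U m x p ->
    r U k (pull w x) (pull w p).
  case=> [gp|[j [v [t [-> ->]]]]]; first by left; apply: gr_res.
  by right; exists j, v, (mono_comp t w); rewrite !res_comp.
have r3 U m (x : B U m) p p' : r U m x p -> r U m x p' -> p = p'.
  case=> [gp|[j [w [t [xE ->]]]]] [gp'|[j' [w' [t' [xE' ->]]]]].
  - exact: gr_fun gp gp'.
  - rewrite xE' in gp; apply: (gr_fun gp); apply: h1; by exists p.
  - rewrite xE in gp'; apply/esym/(gr_fun gp'); apply: h1; by exists p'.
  - have [d|nd] := pselect (gdom g x); last first.
      by apply: h2; rewrite -?xE -?xE'.
    have g1 := h1 j U w m t; have g2 := h1 j' U w' m t'.
    rewrite -xE in g1; rewrite -xE' in g2.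
    exact: gr_fun (g1 d) (g2 d).
exists (PGraph r1 r2 r3); split=> //.
- by move=> U m x p gp; left.
- by move=> j; right; exists j, (idm V), (mono_id n); rewrite !sres1 !res_id.
Qed.

End PGraph.

Definition gover (C : category) (B P Y : spsh C) (q : spmap P Y) (b : spmap B Y)
  (g : pgraph B P) := forall U m (x : B U m) p, g U m x p -> q U m p = b U m x.

Definition gcov (C : category) (B P : spsh C) (g : pgraph B P) k :=
  forall U m (x : B U m), m < k -> gdom g x.

(** * Lifting against free simplicial presheaves, cell by cell *)

(** In each degree [B] is a coproduct of copies of the presheaf represented by
    [V0]; the last condition makes the latching objects free as well, so that
    [B] is built by attaching cells of the form [V0 x Delta k]. *)
Record generated (C : category) (B : spsh C) (V0 : C)
  (gen : forall k, B V0 k -> Prop) : Prop := Generated {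
  gen_ex : forall U k (x : B U k), exists (v : hom U V0) (x0 : B V0 k),
    gen k x0 /\ x = sres B v k x0;
  gen_inj : forall k (x0 x1 : B V0 k), gen k x0 -> gen k x1 ->
    forall W (w w' : hom W V0), sres B w k x0 = sres B w' k x1 -> w = w' /\ x0 = x1;
  gen_deg : forall m n (t : mono m n) (x0 : B V0 n),
    ~ in_boundary (t : Delta n m) -> gen n x0 ->
    gen m (pull t x0)
}.

Section CellLifting.
Variables (C : category) (B P Y : spsh C) (q : spmap P Y) (b : spmap B Y).
Variables (V0 : C) (gen : forall k, B V0 k -> Prop).
Hypothesis fB : generated gen.

Lemma cov_boundary (g : pgraph B P) k : gcov g k -> forall U (x : B U k) m (t : mono m k),
  in_boundary (t : Delta k m) -> gdom g (pull t x).
Proof.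
move=> cov U x m t /boundary_factor [n' [d [t' [n'k ->]]]].
by rewrite -res_comp; apply/gdom_res/cov.
Qed.

(** All missing generators of dimension [k] are attached at once. An operator
    which is not surjective takes a generator to its boundary, where [g] is
    defined. If it is surjective, the resulting simplex determines the
    generator and the restriction by freeness, and the operator because a
    surjection is determined by its sections; so the values do not conflict.
    This takes the place of the Eilenberg-Zilber lemma. *)
Lemma cell_step (g : pgraph B P) k : gover q b g -> gsat g -> gcov g k ->
  (forall x0 : B V0 k, gen x0 -> ~ gdom g x0 ->
     exists c : P V0 k, q V0 k c = b V0 k x0 /\
       forall m (t : mono m k), in_boundary (t : Delta k m) ->
         g V0 m (pull t x0) (pull t c)) ->
  exists g' : pgraph B P, [/\ gsub g g', gover q b g', gsat g' & gcov g' k.+1].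
Proof.
move=> og satg cov hyp.
pose J := {x0 : B V0 k | gen x0 /\ ~ gdom g x0}.
pose c (j : J) := sval (cid (hyp _ (svalP j).1 (svalP j).2)).
have cq (j : J) : q V0 k (c j) = b V0 k (sval j) by rewrite /c; case: cid => ? [].
have cb (j : J) m (t : mono m k) : in_boundary (t : Delta k m) ->
    g V0 m (pull t (sval j)) (pull t (c j)).
  by rewrite /c; case: cid => ? [? h]; apply: h.
have nd (j : J) W (w : hom W V0) m (t : mono m k) : ~ in_boundary (t : Delta k m) ->
    ~ gdom g (pull t (sres B w k (sval j))).
  move=> nt /[dup] dt; have [d [dK _]] := mono_section ord0 nt.
  move/(gdom_res d); rewrite res_comp res_id // => /satg.
  exact: (svalP j).2.
have [j W w m t||g' [gg' xc h]] := @pgraph_attach _ B P g V0 k J sval c.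
- have [/cb ct _|nt /nd//] := pselect (in_boundary (t : Delta k m)).
  by rewrite -!sres_res; apply: gr_sres.
- move=> j j' W w w' m t t' ndt e.
  have nt : ~ in_boundary (t : Delta k m).
    by move=> tb; apply: ndt; apply: cov_boundary.
  have nt' : ~ in_boundary (t' : Delta k m).
    by move=> tb; apply: ndt; rewrite e; apply: cov_boundary.
  have g1 := gen_deg fB nt (svalP j).1; have g2 := gen_deg fB nt' (svalP j').1.
  rewrite -!sres_res in e.
  have [-> {}e] := gen_inj fB g1 g2 e.
  have sect (d : mono k m) : (forall i, t (d i) = i) -> (sval j = sval j') /\ forall i, t' (d i) = i.
    move=> dK; move/(congr1 (pull d)): e.
    rewrite !res_comp (res_id _ (u := mono_comp t d)) // => e.
    have td : forall i, mono_comp t' d i = i.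
      apply: mono_surj_id => tb; apply: (svalP j).2; rewrite e; exact: cov_boundary.
    by split=> //; rewrite e res_id.
  have tt' : t = t'.
    apply: mono_ext => a; have [d [dK da]] := mono_section a nt.
    by have [_ /(_ (t a))] := sect d dK; rewrite da.
  have [d [dK _]] := mono_section ord0 nt.
  have [jj _] := sect d dK.
  by rewrite -tt' (sval_inj jj).
exists g'; split=> //.
- move=> U m x p /h [/og//|[j [w [t [-> ->]]]]].
  by rewrite pnat snat cq -!pnat snat.
- move=> U V u m y [p /h [gp|[j [w [t [e _]]]]]].
    by apply: (gsub_dom gg'); apply: (satg _ _ u); exists p.
  have [tb|nt] := pselect (in_boundary (t : Delta k m)).
    by apply: (gsub_dom gg'); apply: (satg _ _ u); rewrite e; apply: cov_boundary.
  have [v [y0 [gy yE]]] := gen_ex fB y.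
  have g1 := gen_deg fB nt (svalP j).1.
  move: e; rewrite yE -sresM -sres_res => /(gen_inj fB gy g1) [_ ->].
  by rewrite sres_res; apply/gdom_res/gdom_sres; exists (c j).
- move=> U m x; rewrite ltnS leq_eqVlt => /orP[/eqP e|mk]; last first.
    by apply: (gsub_dom gg'); apply: cov.
  subst m; have [v [x0 [gx ->]]] := gen_ex fB x; apply: gdom_sres.
  have [d|d] := pselect (gdom g x0); first exact: gsub_dom gg' _ _ _ d.
  by exists (c (exist _ x0 (conj gx d))); apply: (xc (exist _ x0 (conj gx d))).
Qed.

Lemma boundary_map (g : pgraph B P) k (x0 : B V0 k) :
  (forall m (t : mono m k), in_boundary (t : Delta k m) ->
     gdom g (pull t x0)) ->
  exists a : pmap (bd k) (P V0), forall m (t : bd k m),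
    g V0 m (pull (sval t) x0) (a m t).
Proof.
move=> h.
pose a m (t : bd k m) := sval (cid (h m (sval t) (svalP t))).
have aP m (t : bd k m) : g V0 m (pull (sval t) x0) (a m t).
  by rewrite /a; case: cid.
have an m n (u : @hom simplex_cat m n) (t : bd k n) : a m (res u t) = res u (a n t).
  apply: (gr_fun (aP _ _)); rewrite /= -(res_comp (sval t) u).
  by apply: (gr_res (u : mono m n)); apply: aP.
by exists (Pmap an) => m t; apply: aP.
Qed.

(** Cells are attached in order of increasing dimension. When the lift is already
    known below dimension [N], only lifting problems of dimension at least [N]
    have to be solved. *)
Theorem cell_lifting (g : pgraph B P) N : gover q b g -> gsat g -> gcov g N ->
  (forall k (x0 : B V0 k) (a : pmap (bd k) (P V0)), N <= k ->
     (forall m t, q V0 m (a m t) =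
        pull (sval t) (b V0 k x0)) ->
     exists c : P V0 k, q V0 k c = b V0 k x0 /\
       forall m (t : bd k m), pull (sval t) c = a m t) ->
  exists h : spmap B P, (forall U m (x : B U m) p, g U m x p -> h U m x = p) /\
    (forall U m (x : B U m), q U m (h U m x) = b U m x).
Proof.
move=> og satg cov hyp.
pose T k := {g' : pgraph B P | [/\ gsub g g', gover q b g', gsat g' & gcov g' (N + k)]}.
have step k (s : T k) : exists s' : T k.+1, gsub (sval s) (sval s').
  case: s => g1 [gg1 og1 satg1 cov1] /=.
  have [x0 gx0 _|g' [g1g' og' satg' cov']] := cell_step og1 satg1 cov1.
    have [a aP] := boundary_map (@cov_boundary _ _ cov1 V0 x0).
    have [|c [cq cb]] := hyp (N + k) x0 a (leq_addr _ _).
      by move=> m t; rewrite (og1 _ _ _ _ (aP _ _)) pnat.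
    exists c; split=> // m t tb.
    by rewrite (cb m (exist _ t tb)); apply: (aP m (exist _ t tb)).
  have h : [/\ gsub g g', gover q b g', gsat g' & gcov g' (N + k.+1)].
    split=> //; last by rewrite addnS.
    by move=> U m x p h; apply/g1g'/gg1.
  by exists (exist _ g' h).
have h0 : [/\ gsub g g, gover q b g, gsat g & gcov g (N + 0)].
  by split=> //; rewrite addn0.
pose s := fix s k : T k := if k is k'.+1 then sval (cid (step k' (s k'))) else exist _ g h0.
have ss k l : k <= l -> gsub (sval (s k)) (sval (s l)).
  elim: l => [|l IH]; first by rewrite leqn0 => /eqP ->.
  rewrite leq_eqVlt ltnS => /orP[/eqP ->//|/IH kl] U m x p /kl h /=.
  by case: cid => s' /= h'; apply: h'.
pose r U m x p := exists k, sval (s k) U m x p.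
have r1 U W (u : hom U W) m (x : B W m) p : r W m x p -> r U m (sres B u m x) (sres P u m p).
  by case=> k gp; exists k; apply: gr_sres.
have r2 U k m (w : mono k m) (x : B U m) p : r U m x p ->
    r U k (pull w x) (pull w p).
  by case=> l gp; exists l; apply: gr_res.
have r3 U m (x : B U m) p p' : r U m x p -> r U m x p' -> p = p'.
  move=> [k gp] [l gp']; apply: (gr_fun (p0 := sval (s (maxn k l)))).
    by apply: ss gp; rewrite leq_maxl.
  by apply: ss gp'; rewrite leq_maxr.
have [|h hP] := @pgraph_total _ _ _ (PGraph r1 r2 r3).
  move=> U m x; case: (svalP (s m.+1)) => _ _ _ /(_ U m x).
  by case=> [|p gp]; [rewrite ltn_addl|exists p; exists m.+1].
exists h; split=> [U m x p gp|U m x].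
  by apply: (gr_fun (hP _ _ _)); exists 0.
by have [k gp] := hP U m x; case: (svalP (s k)) => _ og' _ _; apply: og'.
Qed.

End CellLifting.

(** * Paths in a simplicial set *)

(** Simplicial sets are the simplicial presheaves on the one-point category; the
    lifting theorem is applied to them in this form. *)
Definition unit_cat : category.
Proof.
by exists unit (fun _ _ => unit) (fun _ => tt) (fun _ _ _ _ _ => tt) => // ? ? [].
Defined.

Definition cst_spsh (K : sset) : spsh unit_cat.
Proof. by exists (fun _ => K) (fun _ _ _ => pid K). Defined.

Definition dend (e : bool) : 'I_2 := if e then ord_max else ord0.
Definition Dend (e : bool) m : mono m 1 := mono_cst m (dend e).

Lemma Dend_res e l m (w : mono l m) : mono_comp (Dend e m) w = Dend e l.
Proof. exact: mono_ext. Qed.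

Definition path (Y : sset) : sset.
Proof.
exists (fun n => pmap (prod_psh (Delta n) (Delta 1)) Y)
       (fun m n u p => pcomp p (prod_pmap (Delta_map u) (pid (Delta 1)))).
- by move=> n p; apply: pmap_ext => m [t s] /=; congr (p m (_, _)); apply: mono_ext.
- by move=> a b c v u p; apply: pmap_ext => m [t s] /=; congr (p m (_, _)); apply: mono_ext.
Defined.

Definition path_at (Y : sset) n (p : path Y n) (s : mono n 1) : Y n :=
  (p : pmap (prod_psh (Delta n) (Delta 1)) Y) n (mono_id n, s).

Lemma path_app (Y : sset) n (p : path Y n) m (t : mono m n) (s : mono m 1) :
  (p : pmap (prod_psh (Delta n) (Delta 1)) Y) m (t, s) =
  path_at (pull t p) s.
Proof. by rewrite /path_at /=; congr (papp p _); congr pair; apply: mono_ext. Qed.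

Lemma path_at_res (Y : sset) n (p : path Y n) m (u : mono m n) (s : mono n 1) :
  pull u (path_at p s) =
  path_at (pull u p) (mono_comp s u).
Proof.
rewrite /path_at -[LHS]pnat /=; congr (papp p _); congr pair; exact: mono_ext.
Qed.

Lemma path_ext (Y : sset) n (p p' : path Y n) :
  (forall m (t : mono m n) (s : mono m 1),
     path_at (pull t p) s =
     path_at (pull t p') s) -> p = p'.
Proof. by move=> h; apply: pmap_ext => m [t s]; rewrite !path_app. Qed.

Definition path_ev (Y : sset) (e : bool) : pmap (path Y) Y.
Proof.
exists (fun n (p : path Y n) => path_at p (Dend e n)) => a b u p.
by rewrite path_at_res Dend_res.
Defined.

(** * Filling prisms *)

Section Prism.
Variables (X : sset) (kX : kan X) (e : bool) (k : nat).
Variables (a : pmap (bd k) (path X)) (b : X k).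
Hypothesis ab : forall m (t : bd k m),
  path_ev X e m (a m t) = pull (sval t) b.

Let B := prod_psh (Delta k) (Delta 1).
Let PG := pgraph (cst_spsh B) (cst_spsh X).

Lemma prism_graph : exists g : PG,
  (forall m (t : bd k m) s, g tt m (sval t, s) (path_at (a m t) s)) /\
  (forall m (t : mono m k), g tt m (t, Dend e m) (pull t b)) /\
  (forall m t s, gdom g (U := tt) (m := m) (t, s) <->
     in_boundary (t : Delta k m) \/ s = Dend e m).
Proof.
pose r (U : unit_cat) m (x : B m) (v : X m) :=
  (exists pf : in_boundary (x.1 : Delta k m),
     v = path_at (a m (exist _ (x.1 : Delta k m) pf)) x.2) \/
  (x.2 = Dend e m /\ v = pull (x.1) b).
have r1 U V (u : hom U V) m (x : B m) p : r V m x p -> r U m x p by [].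
have r2 U l m (w : mono l m) (x : B m) p : r U m x p ->
    r U l (pull w x) (pull w p).
  case=> [[pf ->]|[xe ->]].
    left; exists (in_boundary_res (w : @hom simplex_cat l m) pf).
    rewrite path_at_res; congr path_at; rewrite -[LHS]pnat.
    by congr (a l _); apply: sval_inj.
  by right; split; rewrite /= ?xe ?Dend_res // res_comp.
have r3 U m (x : B m) p p' : r U m x p -> r U m x p' -> p = p'.
  case=> [[pf ->]|[xe ->]] [[pf' ->]|[xe' ->]] //.
  - by congr (path_at (a m _) _); apply: sval_inj.
  - by rewrite xe' -(ab (exist _ (x.1 : Delta k m) pf)).
  - by rewrite xe -(ab (exist _ (x.1 : Delta k m) pf')).
exists (PGraph (B := cst_spsh B) (P := cst_spsh X) r1 r2 r3); split; last split.
- by move=> m [t pf] s; left; exists pf.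
- by move=> m t; right.
move=> m t s; split.
  by case=> v [[pf _]|[se _]]; [left; exact: pf|right; exact: se].
case=> [pf|->].
  by exists (path_at (a m (exist _ (t : Delta k m) pf)) s); left; exists pf.
by exists (pull t b); right.
Qed.

Lemma shuffle_fst_subproof j (jk : j <= k) (i : 'I_k.+2) :
  (if i <= j then i : nat else i.-1) < k.+1.
Proof. by case: i => i /= hi; case: (leqP i j) => h; lia. Qed.

(** The two components of the shuffle (0,0), ..., (j,0), (j,1), ..., (k,1); these
    shuffles are the maximal simplices of the prism. *)
Definition shuffle_fst j (jk : j <= k) : mono k.+1 k.
Proof.
exists (fun i => Ordinal (shuffle_fst_subproof jk i)) => x y /=.
by case: (leqP x j); case: (leqP y j); lia.
Defined.

Definition shuffle_snd (j : nat) : mono k.+1 1.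
Proof.
exists (fun i => dend (j < i)%N) => x y xy.
by rewrite /dend; case: (ltnP j x); case: (ltnP j y) => //=; lia.
Defined.

(** The chain with components [t] and [s] is contained in the shuffle which jumps
    at [l]. *)
Definition below_shuffle m (t : mono m k) (s : mono m 1) l :=
  forall x, (s x = ord0 -> t x <= l) /\ (s x = ord_max -> l <= t x).

(* The shuffles are filled in the order 0, ..., k if the prism is given at its
   end 1, and in the opposite order if it is given at its end 0: each of them then
   meets what precedes it in a horn. [D i] is the part which is filled after [i]
   steps, [cur i] the next shuffle, and [miss i] the vertex of that shuffle whose
   opposite face is missing. *)
Let filled i l := if e then l < i else k < i + l.
Let D i m (t : mono m k) (s : mono m 1) :=
  in_boundary (t : Delta k m) \/ s = Dend e m \/
  exists l, [/\ l <= k, filled i l & below_shuffle t s l].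

Let cur i := if e then i else k - i.
Let miss i := if e then i.+1 else k - i.

Lemma dendP (x : 'I_2) : x = ord0 \/ x = ord_max.
Proof. by case: x => [[|[|]]] // h; [left|right]; apply: val_inj. Qed.

(** A face of the shuffle which omits a vertex other than [j] and [j.+1] omits a
    value of the first component. Omitting one of these two vertices leads to a
    neighbouring shuffle, or to an end of the prism: for one of the two vertices
    this part is already filled or given, for the other one, [miss i], it is not. *)
Lemma shuffle_dom i (ik : i <= k) (ck : cur i <= k) m (r : mono m k.+1) :
  D i (mono_comp (shuffle_fst ck) r) (mono_comp (shuffle_snd (cur i)) r) <->
  exists v : 'I_k.+2, v != miss i :> nat /\ forall x, r x != v.
Proof.
split.
  apply: contraPP => nr.
  have hit v : v < k.+2 -> v != miss i -> exists x, r x = v :> nat.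
    move=> vk vm; apply: contrapT => nx; apply: nr; exists (Ordinal vk); split=> //.
    move=> x; apply/eqP => xE; apply: nx; exists x; by rewrite xE.
  case=> [[c hc]|[se|[l [lk dl bl]]]].
  - have [cc|cc] := ltnP c (cur i + e).
      have [x xE] : exists x, r x = c :> nat.
        apply: hit; first by apply: leq_trans (ltn_ord c) _.
        by move: cc; rewrite /miss /cur; case: e => /=; lia.
      have := hc x; rewrite -val_eqE /= xE.
      have -> : c <= cur i by lia.
      by rewrite eqxx.
    have [x xE] : exists x, r x = c.+1 :> nat.
      apply: hit; first by rewrite ltnS ltn_ord.
      by move: cc; rewrite /miss /cur; case: e => /=; lia.
    have := hc x; rewrite -val_eqE /= xE.
    have -> : (c.+1 <= cur i) = false by lia.
    by rewrite /= eqxx.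
  - have [x xE] : exists x, r x = (if e then i else (k - i).+1) :> nat.
      by apply: hit; rewrite /miss; case: e => //; lia.
    have := congr1 (fun s : mono m 1 => s x) se.
    by rewrite /= xE /cur; case: e; rewrite ?ltnn ?ltnSn.
  - have [x xE] : exists x, r x = (if e then i else (k - i).+1) :> nat.
      by apply: hit; rewrite /miss; case: e => //; lia.
    move: dl (bl x); rewrite /filled /= xE /cur; case: e; rewrite ?ltnn ?ltnSn => dl [].
      by move=> /(_ erefl); rewrite leqnn; lia.
    by move=> _ /(_ erefl) /=; lia.
case=> v [vm rv].
have rv' x : (r x != v :> nat) by exact: rv.
have [vj|vj] := ltnP v (cur i).
  left; have vk : v < k.+1 by apply: leq_trans vj _; apply: leqW.
  exists (Ordinal vk) => x; rewrite -val_eqE /=.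
  by move: (rv' x); case: leqP; lia.
have [vj'|vj'] := ltnP (cur i).+1 v.
  left; have vk : v.-1 < k.+1 by have := ltn_ord v; lia.
  exists (Ordinal vk) => x; rewrite -val_eqE /=.
  by move: (rv' x); case: leqP; lia.
right; move: vm vj vj' ck; rewrite /miss /cur /D /filled; case: (e) => vm vj vj' ck.
  have vi : v = i :> nat by lia.
  have [i0|i0] := posnP i.
    left; apply: mono_ext => x /=.
    have -> // : i < r x by move: (rv' x); rewrite vi i0 lt0n.
  right; exists i.-1; split; [lia|lia|] => x /=.
  move: (rv' x); rewrite vi; case: (leqP (r x) i) => h h'; split=> //= _; lia.
have vi : v = (k - i).+1 :> nat by lia.
have [i0|i0] := posnP i.
  left; apply: mono_ext => x /=.
  have -> // : (k - i < r x) = false.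
  by move: (rv' x) (ltn_ord (r x)); rewrite vi i0; lia.
right; exists (k - i).+1; split; [lia|lia|] => x /=.
move: (rv' x); rewrite vi; case: (leqP (r x) (k - i)) => h h'; split=> //= _; lia.
Qed.

Lemma shuffle_inj j (jk : j <= k) m (r r' : mono m k.+1) :
  mono_comp (shuffle_fst jk) r = mono_comp (shuffle_fst jk) r' ->
  mono_comp (shuffle_snd j) r = mono_comp (shuffle_snd j) r' -> r = r'.
Proof.
move=> e1 e2; apply: mono_ext => x; apply: val_inj => /=.
have := congr1 (fun s : mono m k => val (s x)) e1.
have := congr1 (fun s : mono m 1 => val (s x)) e2.
rewrite /= /dend; case: (leqP (r x) j); case: (leqP (r' x) j) => //=; lia.
Qed.

Lemma below_shuffle_factor j (jk : j <= k) m (t : mono m k) (s : mono m 1) :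
  below_shuffle t s j -> exists r : mono m k.+1,
    t = mono_comp (shuffle_fst jk) r /\ s = mono_comp (shuffle_snd j) r.
Proof.
move=> bl.
have rlt (x : 'I_m.+1) : t x + s x < k.+2.
  by have := ltn_ord (t x); have := ltn_ord (s x); lia.
have rm (x y : 'I_m.+1) : x <= y -> Ordinal (rlt x) <= Ordinal (rlt y).
  by move=> xy /=; apply: leq_add; apply: monoP.
exists (Mono rm); split; apply: mono_ext => x; apply: val_inj => /=.
  have [sx|sx] := dendP (s x); have [b0 b1] := bl x; rewrite sx /=.
    by have := b0 sx; rewrite addn0 => ->.
  have := b1 sx; case: (leqP (t x + 1) j) => /=; lia.
have [sx|sx] := dendP (s x); have [b0 b1] := bl x; rewrite sx /=.
  by have := b0 sx; rewrite addn0 ltnNge => ->.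
by have := b1 sx; case: (ltnP j (t x + 1)) => /=; lia.
Qed.

Lemma below_shuffle_ex m (t : mono m k) (s : mono m 1) :
  exists l, l <= k /\ below_shuffle t s l.
Proof.
exists (\max_(x | s x == ord0) t x); split.
  by apply/bigmax_leqP => x _; rewrite -ltnS ltn_ord.
move=> x; split=> [sx|sx]; first by apply: leq_bigmax_cond; rewrite sx.
apply/bigmax_leqP => y /eqP sy; case: (leqP (t y) (t x)) => // xy.
have yx : x <= y by case: (leqP x y) => // /ltnW /(monoP t); lia.
by have := monoP s yx; rewrite sx sy.
Qed.

Lemma prism_steps i : i <= k.+1 -> exists g : PG,
  (forall m (t : bd k m) s, g tt m (sval t, s) (path_at (a m t) s)) /\
  (forall m (t : mono m k), g tt m (t, Dend e m) (pull t b)) /\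
  (forall m t s, gdom g (U := tt) (m := m) (t, s) <-> D i t s).
Proof.
elim: i => [|i IH] ik.
  have [g [ga [gb gd]]] := prism_graph; exists g; split=> //; split=> // m t s.
  split=> [/gd [h|h]|[h|[h|[l [lk dl _]]]]]; [by left|by right; left|by apply/gd; left|by apply/gd; right|].
  by move: dl; rewrite /filled; case: (e); lia.
have {}ik : i <= k by [].
have [g [ga [gb gd]]] := IH (leqW ik).
have ck : cur i <= k by rewrite /cur; case: (e); lia.
pose x0 : B k.+1 := (shuffle_fst ck : Delta k k.+1, shuffle_snd (cur i) : Delta 1 k.+1).
have mk : miss i < k.+2 by rewrite /miss; case: (e); lia.
pose v0 := Ordinal mk.
have hornP m (r : mono m k.+1) : in_horn v0 (r : Delta k.+1 m) <->
    gdom g (U := tt) (pull r x0).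
  split=> [[v vm rv]|/gd /shuffle_dom -/(_ ik) [v [vm rv]]].
    by apply/gd/shuffle_dom => //; exists v.
  by exists v.
pose h m (r : horn v0 m) : X m := sval (cid ((hornP m (sval r)).1 (svalP r))).
have hP m (r : horn v0 m) : g tt m (pull (sval r) x0) (h m r).
  by rewrite /h; case: cid.
have hn m n (u : @hom simplex_cat m n) (r : horn v0 n) : h m (res u r) = res u (h n r).
  apply: (gr_fun (hP _ _)); have := gr_res (u : mono m n) (hP n r).
  by rewrite res_comp.
have [b' hb] := kX (Pmap hn).
have hb' m (r : horn v0 m) :
    pull (sval r) (b' k.+1 (mono_id k.+1)) = h m r.
  have := congr1 (fun F : pmap (horn v0) X => F m r) hb => /= <-.
  by rewrite -pnat; congr (b' m _); apply: mono_ext.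
have [_ [] w m r dr|_ _ [] w w' m r r' _ E|g' [gg' g'x0 g'P]] :=
  @pgraph_attach _ _ _ g tt k.+1 unit (fun _ => x0) (fun _ => b' k.+1 (mono_id k.+1)).
- by rewrite (hb' m (exist _ (r : Delta k.+1 m) ((hornP m r).2 dr))); exact: (hP m (exist _ _ _)).
- by rewrite (@shuffle_inj _ ck _ r r' (congr1 fst E) (congr1 snd E)).
exists g'; split; last split.
- by move=> m t s; apply: gg'.
- by move=> m t; apply: gg'.
move=> m t s; split.
  case=> p /g'P [gp|[_ [_ [r [/= [-> ->] _]]]]].
    have /gd [h1|[h1|[l [lk dl bl]]]] : gdom g (U := tt) (m := m) (t, s) by exists p.
    - by left.
    - by right; left.
    - right; right; exists l; split=> //; move: dl; rewrite /filled; case: (e); lia.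
  right; right; exists (cur i); split=> //.
    by rewrite /filled /cur; case: (e); lia.
  move=> x /=; rewrite /dend; case: (leqP (r x) (cur i)) => //= h1; split=> //= _; lia.
case=> [h1|[h1|[l [lk dl bl]]]].
- by apply: (gsub_dom gg'); apply/gd; left.
- by apply: (gsub_dom gg'); apply/gd; right; left.
have [dl'|dl'] := boolP (filled i l).
  by apply: (gsub_dom gg'); apply/gd; right; right; exists l.
have lc : l = cur i by move: dl dl'; rewrite /filled /cur; case: (e); lia.
subst l; have [r [-> ->]] := below_shuffle_factor ck bl.
by exists (pull r (b' k.+1 (mono_id k.+1)));
  apply: (gr_res r (g'x0 tt)).
Qed.

(** The evaluation of paths at an end lifts against the boundary inclusions: a map
    given on the sides and on one end of a prism extends to the prism, by filling
    one horn for each shuffle. *)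
Theorem prism_filling : exists p : path X k,
  path_ev X e k p = b /\
  forall m (t : bd k m), pull (sval t) p = a m t.
Proof.
have [g [ga [gb gd]]] := prism_steps (leqnn k.+1).
have [|h hP] := pgraph_total (g := g).
  case=> m [t s]; apply/gd; right; right.
  have [l [lk bl]] := below_shuffle_ex t s; exists l; split=> //.
  by rewrite /filled; case: (e); lia.
exists (h tt : pmap B X); split.
  rewrite /path_ev /= /path_at; apply: (gr_fun (hP tt _ _)).
  have := gb k (mono_id k); rewrite res_id //.
move=> m t; apply: path_ext => l u s.
rewrite -path_app /=; apply: (gr_fun (hP tt _ _)).
by have := ga l (pull u t) s; rewrite pnat.
Qed.

End Prism.

(** * The homotopy extension property *)

Definition pathS (C : category) (X : spsh C) : spsh C.
Proof.
unshelve refine (@Spsh C (fun U => path (X U))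
  (fun U V u => @Pmap _ (path (X V)) (path (X U)) (fun n p => pcomp (sres X u) p) _) _ _).
- by move=> a b w p; apply: pmap_ext.
- by move=> U n p; apply: pmap_ext => m x; rewrite /= sres1.
- by move=> U V W v u n p; apply: pmap_ext => m x; rewrite /= sresM.
Defined.

Definition pathS_ev (C : category) (X : spsh C) (e : bool) : spmap (pathS X) X.
Proof. by exists (fun U => path_ev (X U) e : pmap (pathS X U) (X U)). Defined.

Definition path_uncurry (C : category) (B X : spsh C) (h : spmap B (pathS X)) :
  spmap (sprod B (Delta 1)) X.
Proof.
unshelve refine (@Spmap C (sprod B (Delta 1)) X (fun U =>
  @Pmap _ (prod_psh (B U) (Delta 1)) (X U)
    (fun m x => path_at (h U m x.1 : path (X U) m) x.2) _) _).
- by move=> a b u [x s] /=; rewrite pnat path_at_res.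
- by move=> U V u m [x s] /=; rewrite snat.
Defined.

(** A homotopy on [B] is a map from [B] to the path object, so that extending a
    homotopy means lifting against the evaluation of paths at the end [e], which is
    possible cell by cell by [prism_filling]. The domain of [g] is a cylinder on
    the part of [B] where the homotopy is prescribed. *)
Theorem homotopy_extension (C : category) (B X : spsh C) (V0 : C)
  (gen : forall k, B V0 k -> Prop) (e : bool)
  (g : pgraph (sprod B (Delta 1)) X) (ge : spmap B X) :
  generated gen -> presheaf_of_kan X ->
  (forall U m (z : B U m) (s s' : mono m 1),
     gdom g (U := U) (m := m) (z, s) -> gdom g (U := U) (m := m) (z, s')) ->
  gsat g ->
  (forall U m (z : B U m) p, g U m (z, Dend e m) p -> p = ge U m z) ->
  exists h : spmap (sprod B (Delta 1)) X,
    (forall U m x p, g U m x p -> h U m x = p) /\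
    (forall U m (z : B U m), h U m (z, Dend e m) = ge U m z).
Proof.
move=> fB hX cyl sat compat.
pose r U m (z : B U m) (p : path (X U) m) := forall l (t : mono l m) (s : mono l 1),
  g U l (pull t z, s) (path_at (pull t p) s).
have r1 U V (u : hom U V) m (x : B V m) p : r V m x p ->
    r U m (sres B u m x) (sres (pathS X) u m p).
  by move=> h l t s; rewrite -sres_res; apply: (gr_sres u (h l t s)).
have r2 U l m (w : mono l m) (x : B U m) p : r U m x p ->
    r U l (pull w x) (pull w p).
  by move=> h k t s; rewrite !res_comp; apply: h.
have r3 U m (x : B U m) p p' : r U m x p -> r U m x p' -> p = p'.
  by move=> h h'; apply: path_ext => l t s; apply: gr_fun (h l t s) (h' l t s).
pose g0 := PGraph (B := B) (P := pathS X) r1 r2 r3.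
have dom1 U m (z : B U m) s : gdom g (U := U) (m := m) (z, s) -> gdom g0 z.
  move=> d.
  have dd l (t : mono l m) (s' : mono l 1) :
      gdom g (U := U) (m := l) (pull t z, s').
    by apply: cyl (gdom_res t d).
  pose f l (x : prod_psh (Delta m) (Delta 1) l) := sval (cid (dd l x.1 x.2)).
  have fP l (x : prod_psh (Delta m) (Delta 1) l) :
      g U l (pull (x.1) z, x.2) (f l x).
    by rewrite /f; case: cid.
  have fn k l (u : @hom simplex_cat k l) x : f k (res u x) = res u (f l x).
    apply: (gr_fun (fP _ _)); have := gr_res u (fP l x).
    by rewrite /= res_comp.
  exists (Pmap fn) => l t s'.
  by rewrite -path_app; apply: (fP l (t, s')).
have dom2 U m (z : B U m) s : gdom g0 z -> gdom g (U := U) (m := m) (z, s).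
  move=> [p /(_ m (mono_id m) s)]; rewrite !res_id // => gp.
  by exists (path_at p s).
have o0 : gover (pathS_ev X e) ge g0.
  move=> U m x p /(_ m (mono_id m) (Dend e m)); rewrite !res_id // => gp.
  exact: compat gp.
have s0 : gsat g0.
  move=> U V u m x /(@dom2 U m _ (Dend e m)) d; apply: (@dom1 _ _ _ (Dend e m)).
  exact: (sat _ _ u).
have [//|k x0 a _ ha|h [hg hq]] := cell_lifting fB (N := 0) o0 s0.
  exact: prism_filling.
exists (path_uncurry h); split=> // U m [z s] p gp.
have [p' r'] := dom1 U m z s (ex_intro _ p gp).
rewrite /= (hg _ _ _ _ r').
by move: (r' m (mono_id m) s); rewrite !res_id // => /gr_fun; apply.
Qed.

Lemma cst_generated (K : sset) : generated (B := cst_spsh K) (V0 := tt) (fun _ _ => True).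
Proof.
split=> //.
- by move=> [] k x; exists tt, x.
- by move=> k x0 x1 _ _ W [] [].
Qed.

(** For simplicial sets, the prescribed homotopy is given in three ways: by a
    relation, by total maps each of which matters on one piece of a subobject
    only, and by a map on a subobject. *)
Lemma hep_graph (K X : sset) (e : bool)
  (r : forall m, prod_psh K (Delta 1) m -> X m -> Prop) (ge : pmap K X) :
  kan X ->
  (forall m n (w : mono m n) x p, r n x p ->
     r m (pull w x) (pull w p)) ->
  (forall m x p p', r m x p -> r m x p' -> p = p') ->
  (forall m (z : K m) (s s' : mono m 1) p, r m (z, s) p -> exists p', r m (z, s') p') ->
  (forall m (z : K m) p, r m (z, Dend e m) p -> p = ge m z) ->
  exists h : pmap (prod_psh K (Delta 1)) X,
    (forall m x p, r m x p -> h m x = p) /\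
    (forall m (z : K m), h m (z, Dend e m) = ge m z).
Proof.
move=> kX r2 r3 cyl compat.
pose g := PGraph (B := sprod (cst_spsh K) (Delta 1)) (P := cst_spsh X) (gr := fun U => r)
  (fun _ _ _ m x p h => match x return r m x p -> r m (x.1, x.2) p with (a, b) => id end h)
  (fun _ => r2) (fun _ => r3).
pose gs : spmap (cst_spsh K) (cst_spsh X) :=
  @Spmap _ (cst_spsh K) (cst_spsh X) (fun _ => ge) (fun _ _ _ _ _ => erefl).
have [U|U m z s s' [p]|U V u m [z s]|U|h [hg he]] :=
  @homotopy_extension _ _ _ _ _ e g gs (cst_generated K).
- exact: kX.
- exact: cyl.
- by case=> p h; exists p.
- exact: compat.
exists (h tt); split=> m.
  by move=> x p; apply: hg.
exact: he.
Qed.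

Lemma hep_glue (K X : sset) (e : bool) (J : Type) (L : J -> forall m, K m -> Prop)
  (f : J -> pmap (prod_psh K (Delta 1)) X) (ge : pmap K X) :
  kan X ->
  (forall j m n (w : mono m n) x, L j n x -> L j m (pull w x)) ->
  (forall j j' m z s, L j m z -> L j' m z -> f j m (z, s) = f j' m (z, s)) ->
  (forall j m z, L j m z -> f j m (z, Dend e m) = ge m z) ->
  exists h : pmap (prod_psh K (Delta 1)) X,
    (forall j m z s, L j m z -> h m (z, s) = f j m (z, s)) /\
    (forall m z, h m (z, Dend e m) = ge m z).
Proof.
move=> kX Lres agree compat.
have [||m z s s' p [j [Lz _]]|m z p [j [Lz ->]]|h [hg he]] :=
  @hep_graph K X e (fun m x p => exists j, L j m x.1 /\ p = f j m x) ge kX.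
- move=> m n w x p [j [Lx ->]]; exists j; split; first exact: Lres.
  by rewrite -pnat.
- by move=> m [z s] p p' [j [Lz ->]] [j' [Lz' ->]]; apply: agree.
- by exists (f j m (z, s')), j.
- exact: compat.
exists h; split=> // j m z s Lz; apply: hg; by exists j.
Qed.

Lemma hep_sub (K X : sset) (e : bool) (P : forall m, K m -> Prop)
  (hP : forall a b (u : @hom simplex_cat a b) (x : K b), P b x -> P a (res u x))
  (f : pmap (prod_psh (sub_psh hP) (Delta 1)) X) (ge : pmap K X) :
  kan X ->
  (forall m (z : sub_psh hP m), f m (z, Dend e m) = ge m (sval z)) ->
  exists h : pmap (prod_psh K (Delta 1)) X,
    (forall m (z : sub_psh hP m) s, h m (sval z, s) = f m (z, s)) /\
    (forall m z, h m (z, Dend e m) = ge m z).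
Proof.
move=> kX compat.
have [||m z s s' p [pf _]|m z p [pf ->]|h [hg he]] :=
  @hep_graph K X e
    (fun m x p => exists pf : P m x.1, p = f m (exist _ x.1 pf, x.2)) ge kX.
- move=> m n w x p [pf ->]; exists (hP _ _ w _ pf).
  by rewrite -[LHS]pnat; congr (f m (_, _)); apply: sval_inj.
- move=> m [z s] p p' [pf ->] [pf' ->]; congr (f m (_, _)); exact: sval_inj.
- by exists (f m (exist _ z pf, s')), pf.
- exact: (compat m (exist _ z pf)).
exists h; split=> // m [z pf] s; apply: hg; by exists pf.
Qed.

(** * Function complexes into presheaves of Kan complexes *)

Lemma generated_prod (C : category) (Z : spsh C) (V0 : C) (gen : forall k, Z V0 k -> Prop)
  (K : sset) : generated gen ->
  generated (B := sprod Z K) (fun k (x : sprod Z K V0 k) => gen k x.1).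
Proof.
move=> fZ; split.
- move=> U k [z t]; have [v [z0 [gz ->]]] := gen_ex fZ z.
  by exists v, (z0, t).
- move=> k [z0 t0] [z1 t1] g0 g1 W w w' [e ->].
  by have [-> /= ->] := gen_inj fZ g0 g1 e.
- by move=> m n t [z s] tb gz; apply: (gen_deg fZ tb gz).
Qed.

(** The retraction of the prism to its end [~~ e] which moves the end [e] to the
    vertices on one side of [j]. For a suitable [e] it exhibits the horn inclusion
    as a retract of the inclusion of a prism which is open at the end [~~ e]. *)
Definition horn_retract n (j : 'I_n.+1) (e : bool) m (t : mono m n) (s : mono m 1) : mono m n.
Proof.
pose f (a : 'I_m.+1) : 'I_n.+1 :=
  if s a == dend e then (if e then (if t a <= j then j else t a)
                         else (if t a <= j then t a else j)) else t a.
exists f => a b ab; rewrite /f.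
have := monoP t ab; have := monoP s ab.
have [-> | ->] := dendP (s a); have [-> | ->] := dendP (s b); case: (e) => //= _;
  case: (leqP (t a) j); case: (leqP (t b) j) => //=; lia.
Defined.

Lemma horn_retractE n (j : 'I_n.+1) e m (t : mono m n) : 
  horn_retract j e t (Dend (~~ e) m) = t.
Proof. by apply: mono_ext => a /=; case: e. Qed.

Lemma horn_retract_res n (j : 'I_n.+1) e m l (w : mono l m) (t : mono m n) s :
  mono_comp (horn_retract j e t s) w = horn_retract j e (mono_comp t w) (mono_comp s w).
Proof. exact: mono_ext. Qed.

Lemma horn_retract_end n (j : 'I_n.+2) m (t : mono m n.+1) :
  let e := j == ord_max in in_horn j (horn_retract j e t (Dend e m) : Delta n.+1 m).
Proof.
case: eqP => [->|jn] /=.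
  by exists ord0 => // a /=; case: leqP => // h; rewrite -val_eqE /=; lia.
exists ord_max; first by apply/eqP => e; apply: jn.
move=> a /=.
have jm : j < n.+1.
  by rewrite ltn_neqAle -ltnS ltn_ord andbT; apply/eqP => e; apply: jn; apply: val_inj.
by case: leqP => h; rewrite -val_eqE /=; lia.
Qed.

Lemma horn_retract_horn n (j : 'I_n.+1) e m (t : mono m n) s :
  in_horn j (t : Delta n m) -> in_horn j (horn_retract j e t s : Delta n m).
Proof.
move=> [v vj tv]; exists v => // a /=; have := tv a.
by case: ifP => // _; case: (e); case: ifP => // _ _; rewrite eq_sym.
Qed.

(** The composite of [g] with the retraction [horn_retract] is a homotopy on the
    domain of [g], one end of which is defined everywhere because the retraction
    sends that end into the horn. The other end of an extension of this homotopy
    fills the horn. The second condition on [g] says that, outside the horn, [g] is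
    defined on a product with a subobject of [Z]. *)
Theorem parametrized_horn_filling (C : category) (Z X : spsh C) (V0 : C)
  (gen : forall k, Z V0 k -> Prop) n (j : 'I_n.+2)
  (g : pgraph (sprod Z (Delta n.+1)) X) :
  generated gen -> presheaf_of_kan X -> gsat g ->
  (forall U m (z : Z U m) (t : mono m n.+1), in_horn j (t : Delta n.+1 m) ->
     gdom g (U := U) (m := m) (z, t)) ->
  (forall U m (z : Z U m) (t : mono m n.+1), gdom g (U := U) (m := m) (z, t) ->
     in_horn j (t : Delta n.+1 m) \/
     forall l (u : mono l m) (t' : mono l n.+1),
       gdom g (U := U) (m := l) (pull u z, t')) ->
  exists h : spmap (sprod Z (Delta n.+1)) X, forall U m x p, g U m x p -> h U m x = p.
Proof.
move=> fZ hX sat hh hd.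
pose e := j == ord_max.
pose L U m (z : Z U m) (t : mono m n.+1) := in_horn j (t : Delta n.+1 m) \/
  forall l (u : mono l m) (t' : mono l n.+1),
       gdom g (U := U) (m := l) (pull u z, t').
have Lres U m l (w : mono l m) (z : Z U m) (t : mono m n.+1) :
    L U m z t -> L U l (pull w z) (mono_comp t w).
  case=> [h|h]; first by left; apply: (in_horn_res (w : @hom simplex_cat l m) h).
  by right=> k u t'; rewrite res_comp.
pose r U m (x : sprod (sprod Z (Delta n.+1)) (Delta 1) U m) p :=
  L U m x.1.1 x.1.2 /\ g U m (x.1.1, horn_retract j e x.1.2 x.2) p.
have r1 U V (u : hom U V) m x p : r V m x p ->
    r U m (sres (sprod (sprod Z (Delta n.+1)) (Delta 1)) u m x) (sres X u m p).
  case: x => [[z t] s] [h gp]; split; last exact: (gr_sres u gp).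
  case: h => /= h; first by left.
  by right=> l w t'; rewrite -sres_res; apply: (gdom_sres u (h l w t')).
have r2 U l m (w : mono l m) x p : r U m x p ->
    r U l (pull w x) (pull w p).
  case: x => [[z t] s] [h gp]; split; first exact: Lres.
  by have := gr_res w gp; rewrite /= horn_retract_res.
have r3 U m x p p' : r U m x p -> r U m x p' -> p = p'.
  by move=> [_ gp] [_ gp']; apply: gr_fun gp gp'.
have rdom U m z t s : L U m z t -> exists p, r U m ((z, t), s) p.
  move=> [h|h].
    by have [p gp] := hh U m z _ (horn_retract_horn e s h); exists p; split=> //; left.
  have := h m (mono_id m) (horn_retract j e t s); rewrite res_id // => -[p gp].
  by exists p; split=> //; right.
pose rt U m (x : sprod Z (Delta n.+1) U m) p :=
  g U m (x.1, horn_retract j e x.2 (Dend e m)) p.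
have rt1 U V (u : hom U V) m x p : rt V m x p ->
    rt U m (sres (sprod Z (Delta n.+1)) u m x) (sres X u m p).
  by move=> gp; apply: (gr_sres u gp).
have rt2 U l m (w : mono l m) x p : rt U m x p ->
    rt U l (pull w x) (pull w p).
  by move=> gp; have := gr_res w gp; rewrite /rt /= horn_retract_res Dend_res.
have rt3 U m x p p' : rt U m x p -> rt U m x p' -> p = p' by apply: gr_fun.
have [|ge geP] := @pgraph_total _ _ _ (PGraph rt1 rt2 rt3).
  by move=> U m [z t]; apply: hh; apply: horn_retract_end.
have [U m [z t] s s' [p [h _]]|U V u m [[z t] s] [p [h gp]]|U m [z t] p [h gp]|h [hg he]] :=
  homotopy_extension (e := e) (g := PGraph r1 r2 r3) (ge := ge)
    (generated_prod (Delta n.+1) fZ) hX.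
- exact: rdom h.
- apply: rdom; case: h => h; first by left.
  right=> l w t'; apply: (sat _ _ u).
  by have := h l w t'; rewrite /= -sres_res.
- by apply: gr_fun gp (geP _ _ _).
unshelve eexists (@Spmap _ (sprod Z (Delta n.+1)) X (fun U => @Pmap _ (prod_psh (Z U) (Delta n.+1)) (X U)
  (fun m x => h U m (x, Dend (~~ e) m)) _) _).
- by move=> a b u x /=; rewrite -pnat /= Dend_res.
- by move=> U V u m x; apply: (snat h u (x, Dend (~~ e) m)).
move=> U m [z t] p gp; apply: hg; split=> /=; last by rewrite horn_retractE.
by apply: hd; exists p.
Qed.

Theorem function_complex_kan (C : category) (Z X : spsh C) (V0 : C)
  (gen : forall k, Z V0 k -> Prop) :
  generated gen -> presheaf_of_kan X -> kan (function_complex Z X).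
Proof.
move=> fZ hX n j a.
pose r U m (x : sprod Z (Delta n.+1) U m) p := exists pf : in_horn j (x.2 : Delta n.+1 m),
  p = (a m (exist _ (x.2 : Delta n.+1 m) pf) : spmap (sprod Z (Delta m)) X) U m
        (x.1, mono_id m).
have aE U m l (w : mono l m) (t : horn j m) (z : Z U l) :
  (a l (pull w t) : spmap (sprod Z (Delta l)) X) U l (z, mono_id l)
  = (a m t : spmap (sprod Z (Delta m)) X) U l (z, w).
  by rewrite pnat /=; congr ((a m t : spmap _ _) U l (_, _)); apply: mono_ext.
have r1 U V (u : hom U V) m x p : r V m x p ->
    r U m (sres (sprod Z (Delta n.+1)) u m x) (sres X u m p).
  by case: x => z t [pf ->]; exists pf; rewrite -snat.
have r2 U l m (w : mono l m) x p : r U m x p ->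
    r U l (pull w x) (pull w p).
  case: x => z t [pf ->]; exists (in_horn_res (w : @hom simplex_cat l m) pf).
  pose t0 : horn j m := exist _ (t : Delta n.+1 m) pf.
  transitivity ((a l (pull w t0) :
    spmap (sprod Z (Delta l)) X) U l (pull w z, mono_id l)).
    by rewrite aE -[LHS]pnat /=; congr ((a m t0 : spmap (sprod Z (Delta m)) X) U l (_, _));
      apply: mono_ext.
  congr ((a l _ : spmap (sprod Z (Delta l)) X) U l _); exact: sval_inj.
have r3 U m x p p' : r U m x p -> r U m x p' -> p = p'.
  move=> [pf ->] [pf' ->]; congr ((a m _ : spmap (sprod Z (Delta m)) X) U m _).
  exact: sval_inj.
have [U V u m [z t] [p [pf _]]|U m z t pf|U m z t [p [pf _]]|h hg] :=
  parametrized_horn_filling (j := j) (g := PGraph r1 r2 r3) fZ hX.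
- by eexists; exists pf.
- by eexists; exists pf.
- by left.
exists (yon (h : function_complex Z X n.+1)); apply: pmap_ext => m t.
apply: spmap_ext => U l [z w] /=.
rewrite -aE; apply: hg.
by exists (in_horn_res (w : @hom simplex_cat l m) (svalP t)).
Qed.

(** * Filtered colimits and finite simplicial sets *)

Definition finitary (T : Type) := exists (F : finType) (f : T -> F), injective f.

Section Filtered.
Variables (I : category) (fI : left_filtered I).

Lemma filtered_span (i j j' : I) (u : hom j i) (u' : hom j' i) :
  exists k (v : hom k j) (v' : hom k j'), cmp u v = cmp u' v'.
Proof.
have [k [[v] [v']]] := lf_bound fI j j'.
have [l [w e]] := lf_equalizer fI (cmp u v) (cmp u' v').
by exists l, (cmp v w), (cmp v' w); rewrite !cmpA.
Qed.

(** Finitely many conditions, each of which persists once it holds, reduce by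
    induction to two of them, where a span of stages is enough. *)
Lemma common_stage (T : Type) (i : I) (Q : T -> forall j, hom j i -> Prop) :
  finitary T ->
  (forall t j k (u : hom j i) (v : hom k j), Q t j u -> Q t k (cmp u v)) ->
  (forall t, exists j u, Q t j u) -> exists j u, forall t, Q t j u.
Proof.
move=> [F [f fI']] stab ex.
suff [j [u h]] : exists j (u : hom j i), forall x, x \in enum F -> forall t, f t = x -> Q t j u.
  by exists j, u => t; apply: (h (f t)); rewrite ?mem_enum.
elim: (enum F) => [|x s [j [u h]]]; first by exists i, (idm i).
have [[t ft]|nt] := pselect (exists t, f t = x); last first.
  exists j, u => y; rewrite inE => /orP[/eqP -> t ft|/h//].
  by case: nt; exists t.
have [j' [u' h']] := ex t.
have [k [v [v' e]]] := filtered_span u u'.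
exists k, (cmp u v) => y; rewrite inE => /orP[/eqP -> t'|ys t' ft'].
  by rewrite -ft => /fI' ->; rewrite e; apply: stab.
by apply: stab; apply: (h y).
Qed.

Variable D : spsh I.

Lemma colim_ex n (c : colim D n) : exists i (x : D i n), c = colim_in D i n x.
Proof.
by have := reprK c; case: (repr c) => i x <-; exists i, x.
Qed.

Lemma colim_in_sres i j (u : hom j i) n (x : D i n) :
  colim_in D j n (sres D u n x) = colim_in D i n x.
Proof. by apply/cls_eqP/rst_step; exists u. Qed.

Lemma colim_eq n i j (x : D i n) (y : D j n) :
  colim_in D i n x = colim_in D j n y ->
  exists k (u : hom k i) (v : hom k j), sres D u n x = sres D v n y.
Proof.
move/cls_eqP.
suff h (a b : {i : I & D i n}) : clos_refl_sym_trans _ (@colim_step I D n) a b ->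
    exists k (u : hom k (tag a)) (v : hom k (tag b)),
      sres D u n (tagged a) = sres D v n (tagged b).
  by move/h.
elim=> {a b} [a b [u e]|a|a b _ [k [u [v e]]]|a b c _ [k [u [v e]]] _ [k' [u' [v' e']]]].
- by exists (tag a), (idm _), u; rewrite sres1.
- by exists (tag a), (idm _), (idm _).
- by exists k, v, u.
have [l [w [w' ww]]] := filtered_span v u'.
exists l, (cmp u w), (cmp v' w').
by rewrite !sresM e -sresM ww sresM e'.
Qed.

Lemma colim_eq1 n i (x y : D i n) : colim_in D i n x = colim_in D i n y ->
  exists k (u : hom k i), sres D u n x = sres D u n y.
Proof.
move/colim_eq => [k [u [v e]]].
have [l [w ww]] := lf_equalizer fI u v.
by exists l, (cmp u w); rewrite {2}ww !sresM e.
Qed.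

(** A pseudo-inverse of [t : m -> n]: the composite [t r] is an idempotent with
    the image of [t]. *)
Lemma mono_pinv m n (t : mono m n) : exists r : mono n m, forall a, t (r (t a)) = t a.
Proof.
pose f (b : 'I_n.+1) : 'I_m.+1 := inord (\max_(a | t a <= b) a).
have fE (b : 'I_n.+1) : f b = \max_(a | t a <= b) a :> nat.
  by rewrite inordK // ltnS; apply/bigmax_leqP => a _; rewrite -ltnS.
have fm (b c : 'I_n.+1) : b <= c -> f b <= f c.
  move=> bc; rewrite !fE; apply/bigmax_leqP => a ab.
  by apply: (@leq_bigmax_cond _ (fun a => t a <= c) (fun a => a : nat)); apply: leq_trans bc.
exists (Mono fm) => a /=.
have le : a <= f (t a).
  by rewrite fE; apply: (@leq_bigmax_cond _ (fun a' => t a' <= t a) (fun a => a : nat)).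
have [|b tb fb] := @eq_bigmax_cond _ (fun a' => t a' <= t a) (fun a' => a' : nat).
  by apply/card_gt0P; exists a; rewrite unfold_in.
have {}tb : t b <= t a by [].
have {}fb : f (t a) = b :> nat by rewrite fE -fb; apply: eq_bigl.
have -> : f (t a) = b by apply: val_inj.
apply: val_inj; apply/eqP; rewrite eqn_leq tb /=.
by apply: monoP; rewrite -fb.
Qed.

(** A simplicial set embedded in [Delta N] is presented by its [N]-simplices
    and the action of the endomorphisms of the ordinal [N]: any simplex [x] is
    the restriction along its own image in [Delta N] of the [N]-simplex
    obtained from [x] by a pseudo-inverse of that image. *)
Section FiniteSset.
Variables (K : sset) (N : nat) (phi : pmap K (Delta N)).
Hypothesis phi_inj : forall m, injective (phi m).

Lemma embedded_expand m (x : K m) : exists r : mono N m,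
  x = pull (phi m x) (pull r x).
Proof.
have [r rP] := mono_pinv (phi m x).
exists r; apply: phi_inj; rewrite !pnat.
by apply: mono_ext => a /=; rewrite rP.
Qed.

Lemma embedded_finitary m : finitary (K m).
Proof.
exists {ffun 'I_m.+1 -> 'I_N.+1}, (fun x => [ffun a => (phi m x : mono m N) a]).
move=> x y /ffunP e; apply: phi_inj; apply: mono_ext => a.
by have := e a; rewrite !ffunE.
Qed.

Lemma colim_map_eq i (a a' : pmap K (D i)) :
  pcomp (colim_in D i) a = pcomp (colim_in D i) a' ->
  exists k (u : hom k i), pcomp (sres D u) a = pcomp (sres D u) a'.
Proof.
move=> e.
have [|y|k [u h]] := @common_stage (K N) i
  (fun y k u => sres D u N (a N y) = sres D u N (a' N y)) (embedded_finitary N).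
- by move=> y j k u v h; rewrite !sresM h.
- apply: colim_eq1.
  exact: (congr1 (fun F : pmap K (colim D) => F N y) e).
exists k, u; apply: pmap_ext => m x /=.
by have [r ->] := embedded_expand x; rewrite [a m _]pnat [a' m _]pnat !sres_res h.
Qed.

Lemma colim_map_lift (a : pmap K (colim D)) :
  exists i (a' : pmap K (D i)), pcomp (colim_in D i) a' = a.
Proof.
have [i0] := lf_inhabited fI.
have [|y|i [_ h]] := @common_stage (K N) i0
  (fun y k _ => exists x : D k N, colim_in D k N x = a N y) (embedded_finitary N).
- by move=> y j k _ v [x <-]; exists (sres D v N x); apply: colim_in_sres.
- have [j [x e]] := colim_ex (a N y); have [k [[u] [v]]] := lf_bound fI i0 j.
  by exists k, u, (sres D v N x); rewrite colim_in_sres.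
pose x y := sval (cid (h y)).
have xP y : colim_in D i N (x y) = a N y by rewrite /x; case: cid.
have [|||j [u hj]] := @common_stage (K N * mono N N)%type i (fun yw k u =>
  pull (yw.2) (sres D u N (x yw.1)) =
  sres D u N (x (pull (yw.2) yw.1))).
- have [F [f fi]] := embedded_finitary N.
  exists (F * {ffun 'I_N.+1 -> 'I_N.+1})%type, (fun yw : K N * mono N N =>
    (f yw.1, [ffun b => yw.2 b])).
  move=> [y w] [y' w'] [/fi -> /ffunP e]; congr pair; apply: mono_ext => b.
  by have := e b; rewrite !ffunE.
- by move=> [y w] j k u v /= h'; rewrite !sresM -sres_res h'.
- move=> [y w] /=.
  have [|k [u e]] := @colim_eq1 N i (pull w (x y))
    (x (pull w y)).
    by rewrite pnat !xP pnat.
  by exists k, u; rewrite -sres_res.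
pose rr m (z : K m) := sval (cid (mono_pinv (phi m z : mono m N))).
have rrP m (z : K m) b : (phi m z : mono m N) (rr m z ((phi m z : mono m N) b)) =
    (phi m z : mono m N) b by rewrite /rr; case: cid.
pose f m (z : K m) : D j m := pull (phi m z)
  (sres D u N (x (pull (rr m z) z))).
have expand m (z : K m) : z =
    pull (phi m z) (pull (rr m z) z).
  by apply: phi_inj; rewrite !pnat; apply: mono_ext => b /=; rewrite rrP.
have fn l m (w : @hom simplex_cat l m) (z : K m) : f l (res w z) = res w (f m z).
  rewrite /f; set p := rr l (res w z).
  have e : pull p (res w z) =
      pull (mono_comp (phi m z : mono m N) (mono_comp (w : mono l m) p))
        (pull (rr m z) z).
    by rewrite {1}[z]expand !res_comp; congr (res _ _); apply: mono_ext.
  rewrite {}e -(hj (_, _)) /= !res_comp; congr (res _ _); apply: mono_ext => b.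
  have := rrP l (res w z) b; rewrite -/p pnat /=.
  exact.
exists j, (Pmap fn); apply: pmap_ext => m z.
rewrite [in RHS](expand m z) pnat -xP.
rewrite [LHS](pnat (colim_in D j)); congr (res _ _).
exact: colim_in_sres.
Qed.

End FiniteSset.

Lemma colim_kan : (forall i, kan (D i)) -> kan (colim D).
Proof.
move=> kD n k a.
have [|i [a' e]] := @colim_map_lift (horn k) n.+1 (horn_incl k) _ a.
  by move=> m x y; apply: sval_inj.
have [b be] := kD i n k a'.
exists (pcomp (colim_in D i) b); rewrite -e -be.
exact: pmap_ext.
Qed.

End Filtered.

(** * Homotopies relative to the boundary *)

Definition pr1 (C : category) (X Y : psh C) : pmap (prod_psh X Y) X.
Proof. by exists (fun a (x : prod_psh X Y a) => x.1). Defined.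

Definition pr2 (C : category) (X Y : psh C) : pmap (prod_psh X Y) Y.
Proof. by exists (fun a (x : prod_psh X Y a) => x.2). Defined.

Definition ppair (C : category) (Z X Y : psh C) (f : pmap Z X) (g : pmap Z Y) :
  pmap Z (prod_psh X Y).
Proof. by exists (fun a x => (f a x, g a x) : prod_psh X Y a) => a b u x; rewrite !pnat. Defined.

Definition rhtp (X : sset) n (g g' : pmap (Delta n) X) :=
  exists h : pmap (prod_psh (Delta n) (Delta 1)) X,
  [/\ forall m (t : Delta n m), h m (t, Dend false m) = g m t,
      forall m (t : Delta n m), h m (t, Dend true m) = g' m t
    & forall m (t : Delta n m) (s : Delta 1 m), in_boundary t -> h m (t, s) = g m t].

Lemma rhtp_refl (X : sset) n (g : pmap (Delta n) X) : rhtp g g.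
Proof. by exists (pcomp g (pr1 _ _)). Qed.

Lemma rhtp_map (X Y : sset) (f : pmap X Y) n (g g' : pmap (Delta n) X) :
  rhtp g g' -> rhtp (pcomp f g) (pcomp f g').
Proof.
move=> [h [h0 h1 hb]]; exists (pcomp f h); split=> m t /=; rewrite ?h0 ?h1 //.
by move=> s tb; rewrite hb.
Qed.

Lemma Dend_inj m (e e' : bool) : Dend e m = Dend e' m -> e = e'.
Proof.
by move=> /(congr1 (fun s : mono m 1 => s ord0)); case: e; case: e'.
Qed.

(** The two homotopies, together with the constant one on the boundary, form a
    homotopy on the boundary of the prism [Delta n x Delta 1]. It starts at a map
    which extends to the prism as a constant homotopy; when it is extended, its
    other end joins [g1] to [g2]. *)
Lemma rhtp_euclid (X : sset) n (g g1 g2 : pmap (Delta n) X) : kan X ->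
  rhtp g g1 -> rhtp g g2 -> rhtp g1 g2.
Proof.
move=> kX [h [h0 h1 hb]] [k [k0 k1 kb]].
pose K := prod_psh (Delta n) (Delta 1).
pose L (j : option bool) m (z : K m) :=
  if j is Some b then z.2 = Dend b m else in_boundary z.1.
pose f (j : option bool) : pmap (prod_psh K (Delta 1)) X :=
  match j with
  | Some b => pcomp (if b then k else h) (ppair (pcomp (pr1 _ _) (pr1 _ _)) (pr2 _ _))
  | None => pcomp g (pcomp (pr1 _ _) (pr1 _ _))
  end.
have [|||H [HL He]] := @hep_glue K X false (option bool) L f (pcomp g (pr1 _ _)) kX.
- move=> [b|] m l w [t s] /=; first by move=> ->; apply: Dend_res.
  exact: in_boundary_res.
- move=> [b|] [b'|] m [t s] u //=.
  + by move=> -> /Dend_inj ->.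
  + by move=> _ tb; case: b; rewrite ?hb ?kb.
  + by move=> tb _; case: b'; rewrite ?hb ?kb.
- by move=> [[]|] m [t s] //= _; rewrite ?h0 ?k0.
unshelve eexists (@Pmap _ K X (fun m x => H m (x, Dend true m)) _).
  by move=> a b u x; rewrite -pnat /= Dend_res.
split=> m t /=.
- by rewrite (HL (Some false)) //= h1.
- by rewrite (HL (Some true)) //= k1.
- by move=> s tb; rewrite (HL None) //= -h1 hb.
Qed.

Lemma rhtp_sym (X : sset) n (g g' : pmap (Delta n) X) : kan X -> rhtp g g' -> rhtp g' g.
Proof. by move=> kX h; apply: rhtp_euclid h (rhtp_refl g). Qed.

Lemma rhtp_trans (X : sset) n (g g' g'' : pmap (Delta n) X) : kan X ->
  rhtp g g' -> rhtp g' g'' -> rhtp g g''.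
Proof. by move=> kX /(rhtp_sym kX); apply: rhtp_euclid. Qed.

Definition vc (X : sset) (x : X 0) n : pmap (Delta n) X.
Proof.
exists (fun m _ => vcst x m) => a b u t.
by rewrite /vcst res_comp; congr (res _ _); apply: mono_ext.
Defined.

Definition is_sphere (X : sset) (x : X 0) n (g : pmap (Delta n) X) :=
  forall m (t : Delta n m), in_boundary t -> g m t = vcst x m.

Lemma sphere_ext (X : sset) (x : X 0) n (a b : sphere x n) : sph a = sph b -> a = b.
Proof.
case: a b => [a aP] [b bP] /= e; subst b.
by congr Sphere; apply: Prop_irrelevance.
Qed.

Lemma sphere_homotopicP (X : sset) (x : X 0) n (a b : sphere x n) : kan X ->
  cls (@sphere_homotopic X x n) a = cls _ b <-> rhtp (a : pmap _ _) b.
Proof.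
move=> kX; rewrite cls_eqP.
have E (c d : sphere x n) : sphere_homotopic c d <-> rhtp (c : pmap _ _) d.
  split=> -[h [h0 h1 hb]]; exists h; split=> // m t s tb; rewrite hb //.
    by rewrite (sphP c tb).
  exact: (sphP c tb).
split=> [|/E h]; last exact: rst_step.
elim=> {a b} [a b /E//|a|a b _|a b c _ ab _].
- exact: rhtp_refl.
- exact: rhtp_sym.
- exact: rhtp_trans.
Qed.

Lemma edge_relatedP (X : sset) (x y : X 0) : kan X ->
  cls (@edge_related X) x = cls _ y <-> rhtp (yon x) (yon y).
Proof.
move=> kX; rewrite cls_eqP.
have E (c d : X 0) : edge_related c d <-> rhtp (yon c) (yon d).
  split=> [[e [<- <-]]|[h [h0 h1 _]]].
    exists (pcomp (yon e) (pr2 _ _)); split=> m t.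
    - by rewrite /= res_comp; congr (res _ _); apply: mono_ext.
    - by rewrite /= res_comp; congr (res _ _); apply: mono_ext.
    - by move=> s [j tj]; have := tj ord0; rewrite [t _]ord1 [j]ord1.
  exists (h 1 (mono_cst 1 ord0 : Delta 0 1, mono_id 1 : Delta 1 1)); split.
  - have := h0 0 (mono_id 0); rewrite yon_id => <-; rewrite -pnat /=.
    by congr (h 0 (_, _)); apply: mono_ext => a //=; rewrite [RHS]ord1.
  - have := h1 0 (mono_id 0); rewrite yon_id => <-; rewrite -pnat /=.
    by congr (h 0 (_, _)); apply: mono_ext => a //=; rewrite [RHS]ord1.
split=> [|/E h]; last exact: rst_step.
elim=> {x y} [a b /E//|a|a b _|a b c _ ab _].
- exact: rhtp_refl.
- exact: rhtp_sym.
- exact: rhtp_trans.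
Qed.

(** Only the class of the constant sphere is tested for injectivity: this is what
    is needed to extend over a simplex a map given on its boundary. *)
Definition inj_at (X Y : sset) (f : pmap X Y) n :=
  forall (x : X 0) (a : pmap (Delta n) X), is_sphere x a ->
    rhtp (vc (f 0 x) n) (pcomp f a) -> rhtp (vc x n) a.

Definition surj_at (X Y : sset) (f : pmap X Y) n :=
  forall (x : X 0) (b : pmap (Delta n) Y), is_sphere (f 0 x) b ->
    exists a : pmap (Delta n) X, is_sphere x a /\ rhtp (pcomp f a) b.

(** For [n = 0] the base point is no constraint, and there might be none. *)
Definition surj0 (X Y : sset) (f : pmap X Y) :=
  forall b : pmap (Delta 0) Y, exists a : pmap (Delta 0) X, rhtp (pcomp f a) b.

Lemma vc_sphere (X : sset) (x : X 0) n : is_sphere x (vc x n).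
Proof. by []. Qed.

Lemma yon0 (X : sset) (x : X 0) : yon x = vc x 0.
Proof. by apply: pmap_ext => m t; congr (res _ _); apply: mono_ext => a; rewrite ord1. Qed.

Lemma yon_map (X Y : sset) (f : pmap X Y) n (x : X n) : pcomp f (yon x) = yon (f n x).
Proof. by apply: pmap_ext => m t /=; rewrite pnat. Qed.

Lemma vc_map (X Y : sset) (f : pmap X Y) (x : X 0) n : pcomp f (vc x n) = vc (f 0 x) n.
Proof. by apply: pmap_ext => m t /=; rewrite /vcst pnat. Qed.

Section PiIso.
Variables (X Y : sset) (f : pmap X Y).
Hypotheses (kX : kan X) (kY : kan Y).

Lemma pi_iso_surj0 : pi_iso f -> surj0 f.
Proof.
move=> [[g fg gf] _] b; rewrite [b]yon_eta; set y := b 0 _.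
exists (yon (repr (g (cls _ y)))); rewrite yon_map; apply/edge_relatedP => //.
by rewrite -pi0_mapE reprK gf.
Qed.

Lemma pi_iso_inj_at n : pi_iso f -> inj_at f n.
Proof.
case: n => [|n] [hf0 hf] x a sa.
  rewrite [a]yon_eta -!yon0 yon_map => /(edge_relatedP _ _ kY) h.
  apply/edge_relatedP => //; apply: (bij_inj hf0).
  by rewrite !pi0_mapE.
move=> h.
have /(@sphere_homotopicP _ _ _ (Sphere (@vc_sphere Y (f 0 x) n.+1))
   (sphere_map f (Sphere sa)) kY) : rhtp (vc (f 0 x) n.+1) (pcomp f a) by [].
have -> : Sphere (@vc_sphere Y (f 0 x) n.+1) = sphere_map f (Sphere (@vc_sphere X x n.+1)).
  by apply: sphere_ext; rewrite -[LHS]vc_map.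
rewrite -!pi_mapE => /(bij_inj (hf x n.+1 erefl)).
by move/(sphere_homotopicP _ _ kX).
Qed.

Lemma pi_iso_surj_at n : 0 < n -> pi_iso f -> surj_at f n.
Proof.
move=> n0 [_ /(_ _ _ n0) hf] x b sb.
have [g fg gf] := hf x.
have [a aE] : exists a : sphere x n, cls _ a = g (cls _ (Sphere sb)).
  by exists (repr (g (cls _ (Sphere sb)))); rewrite reprK.
exists a; split; first exact: sphP.
have := gf (cls _ (Sphere sb)); rewrite -aE pi_mapE.
by move/(sphere_homotopicP _ _ kY).
Qed.

End PiIso.

(** * Anodyne extensions of Kan complexes *)

Definition pt_sset : sset.
Proof. by exists (fun _ => unit) (fun _ _ _ _ => tt) => // a []. Defined.

Definition to_pt (X : sset) : pmap X pt_sset.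
Proof. by exists (fun m (_ : X m) => tt : pt_sset m). Defined.

Lemma anodyne_retract (X Y : sset) (i : pmap X Y) : kan X -> anodyne i ->
  exists r : pmap Y X, pcomp r i = pid X.
Proof.
move=> kX an.
have [||r [ri _]] := an X pt_sset (to_pt X) _ (pid X) (to_pt Y).
- move=> n k a b _; have [c ca] := kX n k a; exists c; split=> //.
  by apply: pmap_ext => m t; case: (b m t).
- exact: pmap_ext.
by exists r.
Qed.

Definition path_ends (X : sset) : pmap (path X) (prod_psh X X) :=
  ppair (path_ev X false) (path_ev X true).

(** A horn of paths whose ends are extended to the simplex is a horn parametrised
    by the interval, with a filler given over the two ends of the interval. *)
Lemma path_ends_fibration (X : sset) : kan X -> kan_fibration (path_ends X).
Proof.
move=> kX n k a b ab.
have ab' m (t : horn k m) : path_at (a m t) (Dend false m) = (b m (sval t)).1 /\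
    path_at (a m t) (Dend true m) = (b m (sval t)).2.
  have := congr1 (fun F : pmap (horn k) (prod_psh X X) => F m t) ab => /=.
  by case: (b m (sval t)) => b1 b2 [-> ->].
pose be (e : bool) m (t : Delta n.+1 m) := if e then (b m t).2 else (b m t).1.
have ben e m l (w : @hom simplex_cat l m) (t : Delta n.+1 m) : be e l (res w t) = res w (be e m t).
  by rewrite /be pnat; case: e.
have abe m (t : horn k m) e : path_at (a m t) (Dend e m) = be e m (sval t).
  by have [h0 h1] := ab' m t; case: e.
pose K := sprod (cst_spsh (Delta 1)) (Delta n.+1).
pose r (U : unit_cat) m (x : K U m) (p : X m) :=
  (exists pf : in_horn k (x.2 : Delta n.+1 m),
     p = path_at (a m (exist _ (x.2 : Delta n.+1 m) pf)) (x.1 : Delta 1 m)) \/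
  exists e, (x.1 : Delta 1 m) = Dend e m /\ p = be e m x.2.
have r1 U V (u : hom U V) m (x : K V m) p : r V m x p -> r U m (sres K u m x) p.
  by case: x.
have r2 U l m (w : mono l m) (x : K U m) p : r U m x p ->
    r U l (pull w x) (pull w p).
  case=> [[pf ->]|[e [xe ->]]].
    left; exists (in_horn_res (w : @hom simplex_cat l m) pf).
    rewrite path_at_res; congr path_at; rewrite -[LHS]pnat.
    by congr (a l _); apply: sval_inj.
  right; exists e; rewrite -ben; split=> //.
  by rewrite /= xe; apply: Dend_res.
have r3 U m (x : K U m) p p' : r U m x p -> r U m x p' -> p = p'.
  case=> [[pf ->]|[e [xe ->]]] [[pf' ->]|[e' [xe' ->]]].
  - by congr (path_at (a m _) _); apply: sval_inj.
  - by rewrite xe' abe.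
  - by rewrite xe abe.
  - by move: xe'; rewrite xe => /Dend_inj ->.
have [|U V u m [s t]|U m s t pf|U m s t|h hg] :=
  @parametrized_horn_filling _ _ (cst_spsh X) tt _ n k (PGraph (P := cst_spsh X) r1 r2 r3)
    (cst_generated (Delta 1)).
- by move=> U.
- by move=> [p rp]; exists p.
- by eexists; left; exists pf.
- case=> p [[pf _]|[e [se _]]]; [by left|right=> l u t'].
  exists (be e l t'); right; exists e; split=> //.
  by move: se => /= ->; apply: Dend_res.
pose c : path X n.+1 := @Pmap _ (prod_psh (Delta n.+1) (Delta 1)) X
  (fun m x => h tt m (x.2, x.1))
  (fun m l w x => pnat (h tt) w (x.2, x.1)).
have cE m (t : mono m n.+1) s : path_at (pull t c) s = h tt m (s, t).
  by rewrite -path_app.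
exists (yon c); split.
  apply: pmap_ext => m t; apply: path_ext => l u s.
  rewrite -[pcomp (yon c) _ m t]/(pull (sval t) c) res_comp cE; apply: hg; left.
  by exists (in_horn_res (u : @hom simplex_cat l m) (svalP t)); rewrite -pnat; congr (path_at (a l _) _);
    apply: sval_inj.
apply: pmap_ext => m t.
rewrite -[LHS]/(path_at (pull t c) (Dend false m),
                path_at (pull t c) (Dend true m)) !cE.
rewrite [b m t]surjective_pairing; congr pair.
  by apply: hg; right; exists false.
by apply: hg; right; exists true.
Qed.

(** A lift of the constant paths on [X] against the fibration [path_ends Y]. *)
Lemma anodyne_deformation (X Y : sset) (i : pmap X Y) (r : pmap Y X) :
  kan Y -> anodyne i -> pcomp r i = pid X ->
  exists H : pmap (prod_psh Y (Delta 1)) Y,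
    [/\ forall m y, H m (y, Dend false m) = i m (r m y),
        forall m y, H m (y, Dend true m) = y
      & forall m x s, H m (i m x, s) = i m x].
Proof.
move=> kY an ri.
have riE m x : r m (i m x) = x by apply: (congr1 (fun F : pmap X X => F m x) ri).
have @cst : pmap X (path Y).
  unshelve refine (@Pmap _ X (path Y) (fun m x => pcomp (yon (i m x)) (pr1 _ _)) _).
  by move=> a b u x; apply: pmap_ext => m [t s] /=; rewrite pnat res_comp.
have cstE m x s : path_at (cst m x) s = i m x by apply: res_id.
have [|c [ci cp]] := an _ _ (path_ends Y) (path_ends_fibration kY) cst
  (ppair (pcomp i r) (pid Y)).
  apply: pmap_ext => m x.
  rewrite -[LHS]/(path_at (cst m x) (Dend false m), path_at (cst m x) (Dend true m)).
  by rewrite !cstE /= riE.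
have cpE m y := congr1 (fun F : pmap Y (prod_psh Y Y) => F m y) cp.
unshelve eexists (@Pmap _ (prod_psh Y (Delta 1)) Y (fun m x => path_at (c m x.1) x.2) _).
  by move=> a b u [x s] /=; rewrite pnat path_at_res.
split=> m.
- by move=> y; case: (cpE m y).
- by move=> y; case: (cpE m y).
move=> x s /=.
by have /= -> := congr1 (fun F : pmap X (path Y) => F m x) ci; apply: cstE.
Qed.

Section WeakEquivalence.
Variables (X Y : sset) (f : pmap X Y).
Hypotheses (kX : kan X) (kY : kan Y) (wf : weak_equivalence f).

Lemma weak_equivalence_inj_at n : inj_at f n.
Proof.
have [X' [Y' [i [j [f' [[kX' kY'] [ai aj] e pf]]]]]] := wf.
have [r ri] := anodyne_retract kX ai.
move=> x a sa h.
have E : pcomp f' (pcomp i a) = pcomp j (pcomp f a).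
  apply: pmap_ext => m t; exact: (congr1 (fun F : pmap X Y' => F m (a m t)) e).
have E0 : j 0 (f 0 x) = f' 0 (i 0 x) by rewrite -[LHS]/(pcomp j f 0 x) -e.
have := @pi_iso_inj_at _ _ f' kX' kY' n pf (i 0 x) (pcomp i a).
rewrite E -E0 -!vc_map => H.
have /(rhtp_map r) : rhtp (pcomp i (vc x n)) (pcomp i a).
  apply: H; last by rewrite vc_map; apply: rhtp_map.
  by move=> m t tb /=; rewrite sa // /vcst pnat.
have rE (b : pmap (Delta n) X) : pcomp r (pcomp i b) = b.
  apply: pmap_ext => m t; exact: (congr1 (fun F : pmap X X => F m (b m t)) ri).
by rewrite !rE.
Qed.

(** Let [s] be a retraction of [j]. The maps [f r] and [s f'] agree on [X] only, but
    [j f r = f' i r] is homotopic to [f'] relatively to [X] since [i r] is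
    homotopic to the identity, and [s] can be applied to this homotopy. *)
Lemma weak_equivalence_lift : exists (X' Y' : sset) (i : pmap X X') (j : pmap Y Y')
    (f' : pmap X' Y') (r : pmap X' X),
  [/\ kan Y', pi_iso f', pcomp r i = pid X,
      pcomp f' i = pcomp j f &
      forall n (c : pmap (Delta n) X') (b : pmap (Delta n) Y),
        (forall m (t : Delta n m), in_boundary t -> exists x0, c m t = i m x0) ->
        rhtp (pcomp f' c) (pcomp j b) -> rhtp (pcomp f (pcomp r c)) b].
Proof.
have [X' [Y' [i [j [f' [[kX' kY'] [ai aj] e pf]]]]]] := wf.
have [r ri] := anodyne_retract kX ai.
have [s sj] := anodyne_retract kY aj.
have [H [H0 H1 Hi]] := anodyne_deformation kX' ai ri.
exists X', Y', i, j, f', r; split=> // n c b cb h.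
have h1 : rhtp (pcomp i (pcomp r c)) c.
  exists (pcomp H (ppair (pcomp c (pr1 _ _)) (pr2 _ _))); split=> m t /=; rewrite ?H0 ?H1 //.
  move=> u /cb [x0 ->]; rewrite Hi.
  by have /= -> := congr1 (fun F : pmap X X => F m x0) ri.
have {}h1 := rhtp_euclid kY' (rhtp_sym kY' (rhtp_map f' h1)) h.
have E : pcomp f' (pcomp i (pcomp r c)) = pcomp j (pcomp f (pcomp r c)).
  apply: pmap_ext => m t; exact: (congr1 (fun F : pmap X Y' => F m (r m (c m t))) e).
move: h1; rewrite E => /(rhtp_map s).
have sE (d : pmap (Delta n) Y) : pcomp s (pcomp j d) = d.
  apply: pmap_ext => m t; exact: (congr1 (fun F : pmap Y Y => F m (d m t)) sj).
by rewrite !sE.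
Qed.

Lemma weak_equivalence_surj_at n : 0 < n -> surj_at f n.
Proof.
move=> n0 x b sb.
have [X' [Y' [i [j [f' [r [kY' pf ri e h]]]]]]] := weak_equivalence_lift.
have E0 : f' 0 (i 0 x) = j 0 (f 0 x) by rewrite -[RHS]/(pcomp j f 0 x) -e.
have [|c [sc hc]] := @pi_iso_surj_at _ _ f' kY' n n0 pf (i 0 x) (pcomp j b).
  by move=> m t tb; rewrite E0 /= sb // /vcst pnat.
exists (pcomp r c); split.
  move=> m t tb /=; rewrite sc // /vcst pnat.
  by have /= -> := congr1 (fun F : pmap X X => F 0 x) ri.
apply: h => // m t tb; exists (vcst x m).
by rewrite sc // /vcst pnat.
Qed.

Lemma weak_equivalence_surj0 : surj0 f.
Proof.
move=> b.
have [X' [Y' [i [j [f' [r [kY' pf ri e h]]]]]]] := weak_equivalence_lift.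
have [c hc] := pi_iso_surj0 kY' pf (pcomp j b).
exists (pcomp r c); apply: h => // m t [v tv].
by have := tv ord0; rewrite [t _]ord1 [v]ord1.
Qed.

End WeakEquivalence.

(** * From homotopy groups to lifting of strict squares *)

Lemma glue_total (K X : sset) (J : Type) (L : J -> forall m, K m -> Prop)
  (f : J -> pmap K X) :
  (forall j m n (w : mono m n) x, L j n x -> L j m (pull w x)) ->
  (forall j j' m x, L j m x -> L j' m x -> f j m x = f j' m x) ->
  (forall m (x : K m), exists j, L j m x) ->
  exists h : pmap K X, forall j m x, L j m x -> h m x = f j m x.
Proof.
move=> Lres agree cov.
pose h m (x : K m) := f (sval (cid (cov m x))) m x.
have hE j m x : L j m x -> h m x = f j m x.
  by move=> Lx; rewrite /h; case: cid => j' Lx' /=; apply: agree.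
have hn a b (u : @hom simplex_cat a b) x : h a (res u x) = res u (h b x).
  have [j Lx] := cov b x.
  by rewrite (hE j) ?(hE _ _ _ Lx) ?pnat //; apply: Lres.
by exists (Pmap hn).
Qed.

Definition endp (K X : sset) (e : bool) (h : pmap (prod_psh K (Delta 1)) X) : pmap K X.
Proof.
exists (fun m x => h m (x, Dend e m)) => a b u x.
by rewrite -pnat /= Dend_res.
Defined.

Section Strict.
Variables (X Y : sset) (f : pmap X Y).

Definition good n (a : pmap (bd n) X) (b : pmap (Delta n) Y) :=
  exists c : pmap (Delta n) X, (forall m (t : bd n m), c m (sval t) = a m t) /\
    rhtp (pcomp f c) b.

Definition strict_lifting n := forall (a : pmap (bd n) X) (b : pmap (Delta n) Y),
  (forall m (t : bd n m), f m (a m t) = b m (sval t)) -> good a b.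

Hypotheses (kX : kan X) (kY : kan Y).

(** The lift at the end [e] extends to a homotopy [C] with boundary [A]. Over the
    other end, [f C] and [B] are still homotopic relatively to the boundary: extend
    the homotopy between them at the end [e] along the prism, by [B] on the
    boundary and by [f C] and [B] on the two ends. *)
Lemma good_homotopy n (e : bool) (A : pmap (prod_psh (bd n) (Delta 1)) X)
  (B : pmap (prod_psh (Delta n) (Delta 1)) Y) :
  (forall m (t : bd n m) s, f m (A m (t, s)) = B m (sval t, s)) ->
  good (endp e A) (endp e B) -> good (endp (~~ e) A) (endp (~~ e) B).
Proof.
move=> AB [c [ca [h [h0 h1 hb]]]].
have [|C [CA Cc]] := @hep_sub (Delta n) X e _ (@in_boundary_res n) A c kX.
  by move=> m z; rewrite ca.
pose K := prod_psh (Delta n) (Delta 1).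
pose L (j : option bool) m (z : K m) :=
  if j is Some b then z.2 = Dend b m else in_boundary z.1.
pose ts : pmap (prod_psh K (Delta 1)) K := ppair (pcomp (pr1 _ _) (pr1 _ _)) (pr2 _ _).
pose g (j : option bool) : pmap (prod_psh K (Delta 1)) Y :=
  if j is Some false then pcomp f (pcomp C ts) else pcomp B ts.
have [|||H [HL He]] := @hep_glue K Y e (option bool) L g h kY.
- move=> [b|] m l w [t s] /=; first by move=> ->; apply: Dend_res.
  exact: in_boundary_res.
- have bdE m t (tb : in_boundary (t : Delta n m)) s : B m (t, s) = f m (C m (t, s)).
    by have := CA m (exist _ t tb) s => /= ->; rewrite AB.
  move=> [[]|] [[]|] m [t s] u //=.
  + by move=> -> /Dend_inj.
  + by move=> -> /Dend_inj.
  + by move=> _ tb; rewrite bdE.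
  + by move=> tb _; rewrite bdE.
- move=> [[]|] m [t s] /=.
  + by move=> ->; rewrite h1.
  + by move=> ->; rewrite h0 /= Cc.
  + move=> tb; rewrite hb //= -Cc.
    by have := CA m (exist _ t tb) (Dend e m) => /= ->; rewrite AB.
exists (endp (~~ e) C); split=> [m t|]; first exact: CA.
exists (endp (~~ e) H); split=> m t /=.
- by rewrite (HL (Some false)).
- by rewrite (HL (Some true)).
- move=> s tb; rewrite (HL None) //=.
  by have := CA m (exist _ t tb) (Dend (~~ e) m) => /= ->; rewrite AB.
Qed.

Definition face0 n : mono n n.+1.
Proof. by exists (lift ord0) => a b ab /=; rewrite leq_bump2. Defined.

Lemma degen0_subproof n (a : 'I_n.+2) : a.-1 < n.+1.
Proof. by have := ltn_ord a; lia. Qed.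

Definition degen0 n : mono n.+1 n.
Proof. by exists (fun a => Ordinal (degen0_subproof a)) => a b /=; lia. Defined.

Lemma face0K n m (t : mono m n.+1) : (forall a, t a != ord0) ->
  mono_comp (face0 n) (mono_comp (degen0 n) t) = t.
Proof.
move=> ht; apply: mono_ext => a; apply: val_inj; rewrite /= /bump leq0n.
by have := ht a; rewrite -val_eqE /=; lia.
Qed.

(** The contraction of [Delta n] to its vertex 0, which is reached at the end 0
    of the interval; it preserves all faces which contain that vertex. *)
Definition contract m n (t : mono m n) (s : mono m 1) : mono m n.
Proof.
exists (fun a => if s a == ord0 then ord0 else t a) => a b ab.
have := monoP s ab; have := monoP t ab.
by have [-> | ->] := dendP (s a); have [-> | ->] := dendP (s b).
Defined.

Lemma contract1 m n (t : mono m n) : contract t (Dend true m) = t.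
Proof. exact: mono_ext. Qed.

Lemma contract0 m n (t : mono m n) : contract t (Dend false m) = mono_cst m ord0.
Proof. exact: mono_ext. Qed.

Lemma contract_horn m n (t : mono m n) (s : mono m 1) (j : 'I_n.+1) : j != ord0 ->
  (forall a, t a != j) -> in_horn ord0 (contract t s : Delta n m).
Proof.
move=> j0 tj; exists j => // a /=; case: ifP => // _; by rewrite eq_sym.
Qed.

Lemma horn_boundary n k m (t : Delta n m) : in_horn k t -> in_boundary t.
Proof. by move=> [j _ tj]; exists j. Qed.

Lemma cst_horn n m : in_horn (ord0 : 'I_n.+2) (mono_cst m ord0 : Delta n.+1 m).
Proof. by exists ord_max. Qed.

(** If [a] is constant except on the face opposite to the vertex 0, that face is a
    sphere [sg], and [b] is a null-homotopy of [f sg]. By injectivity [sg] is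
    null-homotopic, so that the square can be deformed to one where [a] is
    constant. The deformed [b] is a sphere, and surjectivity gives the lift. *)
Lemma strict_lifting_based n (x : X 0) (a : pmap (bd n.+1) X) (b : pmap (Delta n.+1) Y) :
  inj_at f n -> surj_at f n.+1 ->
  (forall m (t : bd n.+1 m), f m (a m t) = b m (sval t)) ->
  (forall m (t : bd n.+1 m), in_horn ord0 (sval t) -> a m t = vcst x m) -> good a b.
Proof.
move=> injf surjf ab ax.
have abx m (t : Delta n.+1 m) : in_horn ord0 t -> b m t = vcst (f 0 x) m.
  move=> th; have tb := horn_boundary th.
  by have /= <- := ab m (exist _ t tb); rewrite ax // /vcst pnat.
have f0b m (t : Delta n m) : in_boundary (mono_comp (face0 n) t : Delta n.+1 m).
  by exists ord0 => v.
have f0h m (t : Delta n m) : in_boundary t ->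
    in_horn ord0 (mono_comp (face0 n) t : Delta n.+1 m).
  move=> [j tj]; exists (lift ord0 j); first by rewrite eq_sym neq_lift.
  move=> v /=.
  by have := tj v; apply: contra => /eqP /lift_inj ->.
have @sg : pmap (Delta n) X.
  exists (fun m t => a m (exist _ (mono_comp (face0 n) t : Delta n.+1 m) (f0b m t))).
  by move=> l m u t; rewrite -pnat; congr (a l _); apply: sval_inj; apply: mono_ext.
have sgx : is_sphere x sg by move=> m t /f0h h; apply: ax.
have h1 : rhtp (vc (f 0 x) n) (pcomp f sg).
  unshelve eexists (@Pmap _ (prod_psh (Delta n) (Delta 1)) Y
    (fun m x => b m (contract (mono_comp (face0 n) x.1) x.2 : Delta n.+1 m)) _).
    by move=> l m u [t s]; rewrite -pnat; congr (b l _); apply: mono_ext.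
  split=> m t /=.
  - by rewrite contract0 abx //; apply: cst_horn.
  - by rewrite contract1 ab.
  - move=> s [j tj]; apply: abx; apply: (@contract_horn _ _ _ _ (lift ord0 j)).
      by rewrite eq_sym neq_lift.
    move=> v /=; by have := tj v; apply: contra => /eqP /lift_inj ->.
have [g [g0 g1 gb]] := injf x sg sgx h1.
have @dg : pmap (prod_psh (bd n.+1) (Delta 1)) (prod_psh (Delta n) (Delta 1)).
  exists (fun m x => (mono_comp (degen0 n) (sval x.1), x.2)
    : prod_psh (Delta n) (Delta 1) m).
  by move=> l m u [t s] /=; congr (_, _); apply: mono_ext.
pose L (j : bool) m (x : prod_psh (bd n.+1) (Delta 1) m) :=
  if j then in_horn ord0 (sval x.1) else forall v, (sval x.1 : mono m n.+1) v != ord0.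
have [|||A AL] := @glue_total (prod_psh (bd n.+1) (Delta 1)) X bool L
  (fun j => if j then pcomp (vc x 0) (@Pmap _ _ (Delta 0) (fun m _ => mono_cst m ord0)
      (fun _ _ _ _ => mono_ext (fun _ => erefl))) else pcomp g dg).
- move=> [] l m w [[t tb] s] /=; first exact: in_horn_res.
  by move=> h v; apply: h.
- have key m (t : mono m n.+1) s : in_horn ord0 (t : Delta n.+1 m) ->
      (forall v, t v != ord0) -> g m (mono_comp (degen0 n) t, s) = vcst x m.
    move=> [j j0 tj] t0; rewrite gb //.
    have jl : j.-1 < n.+1 by have := ltn_ord j; lia.
    exists (Ordinal jl) => v; have := tj v; have := t0 v; move: j0.
    by rewrite -!val_eqE /=; lia.
  by move=> [] [] m [[t tb] s] //= h h'; [rewrite key|rewrite key].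
- move=> m [[t [j tj]] s]; have [j0|j0] := eqVneq j ord0; last first.
    by exists true; exists j.
  by exists false => v /=; rewrite -j0.
have A1 m (t : bd n.+1 m) : A m (t, Dend true m) = a m t.
  have [th|nth] := pselect (in_horn ord0 (sval t)).
    by rewrite (AL true) //= ax.
  have t0 v : (sval t : mono m n.+1) v != ord0.
    have [j tj] := svalP t; have [<-//|j0] := eqVneq j ord0.
    by case: nth; exists j.
  rewrite (AL false) //= g1 /=; congr (a m _); apply: sval_inj; exact: face0K.
have A0 m (t : bd n.+1 m) : A m (t, Dend false m) = vcst x m.
  have [th|nth] := pselect (in_horn ord0 (sval t)).
    by rewrite (AL true) //= ax.
  have t0 v : (sval t : mono m n.+1) v != ord0.
    have [j tj] := svalP t; have [<-//|j0] := eqVneq j ord0.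
    by case: nth; exists j.
  by rewrite (AL false) //= g0.
have [|B [BA Bb]] := @hep_sub (Delta n.+1) Y true _ (@in_boundary_res n.+1) (pcomp f A) b kY.
  by move=> m z; rewrite /= A1 ab.
have -> : a = endp true A by apply: pmap_ext => m t; rewrite /= A1.
have -> : b = endp true B by apply: pmap_ext => m t; rewrite /= Bb.
apply: (@good_homotopy _ false) => [m t s|]; first by rewrite BA.
have [|c [cx hc]] := surjf x (endp false B).
  move=> m t tb; have := BA m (exist _ t tb) (Dend false m) => /= ->.
  by rewrite A0 /vcst pnat.
by exists c; split=> // m t; rewrite /= A0; apply/cx/(svalP t).
Qed.

(** The contraction of the horn at the vertex 0 extends to a deformation of the
    square; at its end the boundary map is constant on that horn. *)
Theorem strict_lifting_succ n : inj_at f n -> surj_at f n.+1 -> strict_lifting n.+1.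
Proof.
move=> injf surjf a b ab.
have cb m : in_boundary (mono_cst m (ord0 : 'I_n.+2) : Delta n.+1 m).
  exact: horn_boundary (cst_horn n m).
pose x := a 0 (exist _ (mono_cst 0 (ord0 : 'I_n.+2) : Delta n.+1 0) (cb 0)).
pose r m (y : prod_psh (bd n.+1) (Delta 1) m) p := in_horn ord0 (sval y.1) /\
  exists pf : in_boundary (contract (sval y.1) y.2 : Delta n.+1 m), p = a m (exist _ _ pf).
have ch m (t : mono m n.+1) s : in_horn ord0 (t : Delta n.+1 m) ->
    in_boundary (contract t s : Delta n.+1 m).
  by move=> [j j0 tj]; apply: (@horn_boundary _ ord0); apply: contract_horn tj.
have [||m t s s' p [th _]|m t p [th [pf ->]]|A [Ar A1]] := @hep_graph (bd n.+1) X true r a kX.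
- move=> l m w [t s] p [th [pf ->]]; split; first exact: (in_horn_res (w : @hom simplex_cat l m) th).
  exists (ch _ _ _ (in_horn_res (w : @hom simplex_cat l m) th)).
  by rewrite -pnat; congr (a l _); apply: sval_inj; apply: mono_ext.
- by move=> m y p p' [_ [pf ->]] [_ [pf' ->]]; congr (a m _); apply: sval_inj.
- by exists (a m (exist _ _ (ch _ _ s' th))); split=> //; exists (ch _ _ s' th).
- by congr (a m _); apply: sval_inj; apply: contract1.
have [|B [BA Bb]] := @hep_sub (Delta n.+1) Y true _ (@in_boundary_res n.+1) (pcomp f A) b kY.
  by move=> m z; rewrite /= A1 ab.
have -> : a = endp true A by apply: pmap_ext => m t; rewrite /= A1.
have -> : b = endp true B by apply: pmap_ext => m t; rewrite /= Bb.
apply: (@good_homotopy _ false) => [m t s|]; first by rewrite BA.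
apply: (strict_lifting_based (x := x)) => //= m t th.
have -> : vcst x m = a m (exist _ (mono_cst m (ord0 : 'I_n.+2) : Delta n.+1 m) (cb m)).
  by rewrite /vcst -pnat; congr (a m _); apply: sval_inj; apply: mono_ext.
apply: Ar; split=> //=; rewrite contract0; exists (cb m); congr (a m _).
Qed.

Lemma strict_lifting0 : surj0 f -> strict_lifting 0.
Proof.
move=> sf a b _; have [c hc] := sf b; exists c; split=> // m t.
by have [j tj] := svalP t; have := tj ord0; rewrite [_ ord0]ord1 [j]ord1.
Qed.

End Strict.

(** * The mapping path object *)

Definition is_path_from (X Y : sset) (f : pmap X Y) m (x : prod_psh X (path Y) m) :=
  path_at x.2 (Dend false m) = f m x.1.

Lemma is_path_from_res (X Y : sset) (f : pmap X Y) a b (u : @hom simplex_cat a b)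
  (x : prod_psh X (path Y) b) : is_path_from f x -> is_path_from f (res u x).
Proof. by rewrite /is_path_from /= pnat => <-; rewrite path_at_res Dend_res. Qed.

(** The mapping path object, a replacement of [X]: to lift against [mpath_end] is
    to lift against [f] up to homotopy. *)
Definition mpath (X Y : sset) (f : pmap X Y) : sset := sub_psh (@is_path_from_res X Y f).

Definition mpath_end (X Y : sset) (f : pmap X Y) : pmap (mpath f) Y :=
  pcomp (path_ev Y true) (pcomp (pr2 _ _) (sub_incl _)).

Lemma mpath_map_subproof (X Y X' Y' : sset) (f : pmap X Y) (f' : pmap X' Y')
  (u : pmap X X') (v : pmap Y Y') (e : forall m x, v m (f m x) = f' m (u m x))
  m (c : mpath f m) :
  is_path_from f' ((u m (sval c).1, pcomp v (sval c).2) : prod_psh X' (path Y') m).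
Proof.
case: c => -[x p] /= h; rewrite /is_path_from /= -e -h.
by rewrite /path_at.
Qed.

Definition mpath_map (X Y X' Y' : sset) (f : pmap X Y) (f' : pmap X' Y')
  (u : pmap X X') (v : pmap Y Y') (e : forall m x, v m (f m x) = f' m (u m x)) :
  pmap (mpath f) (mpath f').
Proof.
exists (fun m (c : mpath f m) => exist _ _ (mpath_map_subproof e c) : mpath f' m).
move=> a b w [[x p] h]; apply: sval_inj => /=; congr (_, _); first exact: pnat.
exact: pmap_ext.
Defined.

Definition mpathS (C : category) (X Y : spsh C) (f : spmap X Y) : spsh C.
Proof.
unshelve refine (@Spsh C (fun U => mpath (f U))
  (fun U V u => @mpath_map _ _ _ _ (f V) (f U) (sres X u) (sres Y u) _) _ _).
- by move=> m x; rewrite snat.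
- move=> U n [[x p] h]; apply: sval_inj => /=; rewrite sres1; congr (_, _).
  by apply: pmap_ext => m y /=; rewrite sres1.
- move=> U V W v u n [[x p] h]; apply: sval_inj => /=; rewrite sresM; congr (_, _).
  by apply: pmap_ext => m y /=; rewrite sresM.
Defined.

Definition mpathS_end (C : category) (X Y : spsh C) (f : spmap X Y) : spmap (mpathS f) Y.
Proof. by exists (fun U => mpath_end (f U) : pmap (mpathS f U) (Y U)). Defined.

Definition path_lifting (X Y : sset) (f : pmap X Y) n :=
  forall (a : pmap (bd n) (mpath f)) (b : Y n),
    (forall m (t : bd n m), mpath_end f m (a m t) = pull (sval t) b) ->
    exists c : mpath f n, mpath_end f n c = b /\
      forall m (t : bd n m), pull (sval t) c = a m t.

Definition meet_mono m (u s : mono m 1) : mono m 1.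
Proof.
exists (fun v => if u v <= s v then u v else s v) => a b ab.
by have := monoP u ab; have := monoP s ab; case: (leqP (u a) (s a));
  case: (leqP (u b) (s b)) => //=; lia.
Defined.

Lemma meet_mono1l m (s : mono m 1) : meet_mono (Dend true m) s = s.
Proof.
by apply: mono_ext => a /=; have [->|->] := dendP (s a).
Qed.

Lemma meet_mono1r m (s : mono m 1) : meet_mono s (Dend true m) = s.
Proof.
by apply: mono_ext => a /=; have [->|->] := dendP (s a).
Qed.

Lemma meet_mono0l m (s : mono m 1) : meet_mono (Dend false m) s = Dend false m.
Proof. exact: mono_ext. Qed.

Lemma meet_mono0r m (s : mono m 1) : meet_mono s (Dend false m) = Dend false m.
Proof.
by apply: mono_ext => a /=; have [->|->] := dendP (s a).
Qed.

(** A square with values in the mapping path object is a square which commutes up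
    to a homotopy on the boundary. This homotopy is extended to the simplex to make
    the square strict. The homotopy which comes with the lift of the strict square
    is then composed with the extended one; the meet of two variables in the
    interval keeps the result equal to the given homotopy on the boundary. *)
Theorem path_lifting_strict (X Y : sset) (f : pmap X Y) n : kan Y ->
  strict_lifting f n -> path_lifting f n.
Proof.
move=> kY sl a b ab.
pose a1 : pmap (bd n) X := pcomp (pr1 _ _) (pcomp (sub_incl _) a).
have @a2 : pmap (prod_psh (bd n) (Delta 1)) Y.
  exists (fun m x => path_at (sval (a m x.1)).2 x.2).
  by move=> l m u [t s] /=; rewrite path_at_res pnat.
have a20 m (t : bd n m) : a2 m (t, Dend false m) = f m (a1 m t) by apply: (svalP (a m t)).
have a21 m (t : bd n m) : a2 m (t, Dend true m) = yon b m (sval t) by apply: ab.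
have [|h [ha hb]] := @hep_sub (Delta n) Y true _ (@in_boundary_res n) a2 (yon b) kY.
  exact: a21.
have [|c [ca [g [g0 g1 gb]]]] := sl a1 (endp false h).
  by move=> m t; rewrite -a20 -ha.
pose K := prod_psh (Delta n) (Delta 1).
pose L (j : option bool) m (z : K m) :=
  if j is Some b then z.2 = Dend b m else in_boundary z.1.
have @tm : pmap (prod_psh K (Delta 1)) K.
  exists (fun m x => (x.1.1, meet_mono x.1.2 x.2) : K m).
  by move=> l m u [[t s] s'] /=; congr (_, _); apply: mono_ext.
pose k (j : option bool) : pmap (prod_psh K (Delta 1)) Y :=
  match j with
  | Some false => pcomp f (pcomp c (pcomp (pr1 _ _) (pr1 _ _)))
  | Some true => pcomp h (ppair (pcomp (pr1 _ _) (pr1 _ _)) (pr2 _ _))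
  | None => pcomp h tm
  end.
have hbd m t (tb : in_boundary (t : Delta n m)) : h m (t, Dend false m) = f m (c m t).
  have -> : h m (t, Dend false m) = a2 m (exist _ t tb, Dend false m).
    exact: (ha m (exist _ t tb)).
  rewrite a20; congr (f m _); exact/esym/(ca m (exist _ t tb)).
have [|||H [HL H0]] := @hep_glue K Y false (option bool) L k g kY.
- move=> [e|] m l w [t s] /=; first by move=> ->; apply: Dend_res.
  exact: in_boundary_res.
- move=> [[]|] [[]|] m [t s] u //=.
  + by move=> -> /Dend_inj.
  + by move=> -> _; rewrite meet_mono1l.
  + by move=> -> /Dend_inj.
  + by move=> -> tb; rewrite meet_mono0l hbd.
  + by move=> _ ->; rewrite meet_mono1l.
  + by move=> tb ->; rewrite meet_mono0l hbd.
- move=> [[]|] m [t s] /=.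
  + by move=> ->; rewrite g1.
  + by move=> ->; rewrite g0.
  + by move=> tb; rewrite meet_mono0r gb // hbd.
pose p : path Y n := endp true H.
have pP : is_path_from f ((c n (mono_id n), p) : prod_psh X (path Y) n).
  rewrite /is_path_from /= /path_at.
  by rewrite /= (HL (Some false)).
have pE m (t : mono m n) s : path_at (pull t p) s = H m ((t, s), Dend true m).
  by rewrite -path_app.
exists (exist _ _ pP); split=> [|m t].
  rewrite /= /path_at /= (HL (Some true)) //= hb /=; exact: res_id.
apply: sval_inj.
have -> : sval (a m t) = (a1 m t, (sval (a m t)).2) by rewrite /= -surjective_pairing.
rewrite -[LHS]/(pull (sval t) (c n (mono_id n)),
   pull (sval t) p); congr pair.
  by rewrite -pnat -ca; congr (c m _); apply: mono_ext.
apply: path_ext => l u s; rewrite res_comp pE (HL None) /=; last first.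
  exact: (in_boundary_res (u : @hom simplex_cat l m) (svalP t)).
rewrite meet_mono1r.
transitivity (a2 l (pull u t, s)); first exact: (ha l (pull u t) s).
by rewrite /= pnat.
Qed.

(** * Lifting at a late stage *)

Lemma prism_code_subproof n m (x : prod_psh (Delta n) (Delta 1) m) (a : 'I_m.+1) :
  (x.1 : mono m n) a * 2 + (x.2 : mono m 1) a < n.*2.+2.
Proof. by have := ltn_ord ((x.1 : mono m n) a); have := ltn_ord ((x.2 : mono m 1) a); lia. Qed.

(** The prism embeds in a simplex because the product order is contained in the
    lexicographic order. *)
Definition prism_code n : pmap (prod_psh (Delta n) (Delta 1)) (Delta n.*2.+1).
Proof.
unshelve eexists (fun m x => @Mono m n.*2.+1 (fun a => Ordinal (prism_code_subproof x a)) _).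
- by move=> a b ab /=; apply: leq_add; [apply: leq_mul => //|]; apply: monoP.
- by move=> a b u x; apply: mono_ext => v; apply: val_inj.
Defined.

Lemma prism_code_inj n m : injective (prism_code n m).
Proof.
move=> [t s] [t' s'] e.
have h a : t a = t' a /\ s a = s' a.
  have := congr1 (fun r : mono m n.*2.+1 => val (r a)) e => /=.
  have := ltn_ord (s a); have := ltn_ord (s' a) => h1 h2 h3.
  by split; apply: val_inj => /=; lia.
by congr (_, _); apply: mono_ext => a; case: (h a).
Qed.

Definition bd_prism n : pmap (prod_psh (bd n) (Delta 1)) (prod_psh (Delta n) (Delta 1)) :=
  prod_pmap (bd_incl n) (pid (Delta 1)).

Lemma bd_prism_inj n m : injective (bd_prism n m).
Proof. by move=> [t s] [t' s'] [/sval_inj -> ->]. Qed.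

Lemma finitary_bool2 : finitary (bool * bool).
Proof. by exists (bool * bool)%type, id. Qed.

Section Local.
Variables (I : category) (fI : left_filtered I) (D E : spsh I) (f : spmap D E).

Lemma mpath_ext (X Y : sset) (g : pmap X Y) m (c c' : mpath g m) :
  (sval c).1 = (sval c').1 -> (sval c).2 = (sval c').2 -> c = c'.
Proof. by move: c c' => [[x p] h] [[x' p'] h'] /= ? ?; apply: sval_inj; congr pair. Qed.

(** The lift in the colimit consists of a simplex and of a map on a prism, which
    come from some stage. The equations they satisfy are equalities of maps on
    finite simplicial sets in the colimit, so they hold at a later stage. *)
Theorem local_path_lifting n : path_lifting (colim_map f) n ->
  forall i (a : pmap (bd n) (mpathS f i)) (b : E i n),
  (forall m (t : bd n m), mpathS_end f i m (a m t) =
     pull (sval t) b) ->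
  exists j (u : hom j i) (c : mpathS f j n),
    mpathS_end f j n c = sres E u n b /\
    forall m (t : bd n m), pull (sval t) c = sres (mpathS f) u m (a m t).
Proof.
move=> pl i a b ab.
have ce m x : colim_in E i m (f i m x) = colim_map f m (colim_in D i m x).
  by rewrite colim_mapE.
have [|[[x0 p0] h0] /= [e0 ec]] := pl (pcomp (mpath_map ce) a) (colim_in E i n b).
  by move=> m t; rewrite -pnat -ab.
have [j1 [x1 xE]] := colim_ex x0.
have [j2 [p1 pE]] := colim_map_lift fI (@prism_code_inj n)
  (p0 : pmap (prod_psh (Delta n) (Delta 1)) (colim E)).
have [j3 [[v1] [v2]]] := lf_bound fI j1 j2.
have [j [[v3] [u0]]] := lf_bound fI j3 i.
pose x := sres D (cmp v1 v3) n x1.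
pose p : path (E j) n := pcomp (sres E (cmp v2 v3)) p1.
have xE' : colim_in D j n x = x0 by rewrite colim_in_sres.
have pE' m y : colim_in E j m ((p : pmap (prod_psh (Delta n) (Delta 1)) (E j)) m y) =
    (p0 : pmap (prod_psh (Delta n) (Delta 1)) (colim E)) m y.
  by rewrite colim_in_sres -pE.
pose a1 : pmap (bd n) (D i) := pcomp (pr1 _ _) (pcomp (sub_incl _) a).
have @a2 : pmap (prod_psh (bd n) (Delta 1)) (E i).
  exists (fun m x => path_at (sval (a m x.1)).2 x.2).
  by move=> l m w [t s] /=; rewrite path_at_res pnat.
pose Q (q : bool * bool) k (u : hom k j) : Prop := match q with
  | (false, false) => sres E u n (path_at p (Dend false n)) = sres E u n (f j n x)
  | (false, true) => sres E u n (path_at p (Dend true n)) = sres E u n (sres E u0 n b)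
  | (true, false) => pcomp (sres D u) (pcomp (yon x) (bd_incl n)) =
                     pcomp (sres D u) (pcomp (sres D u0) a1)
  | (true, true) => pcomp (sres E u) (pcomp p (bd_prism n)) =
                    pcomp (sres E u) (pcomp (sres E u0) a2)
  end.
have [|[[] []]|k [u h]] := @common_stage I fI _ j Q finitary_bool2.
- move=> [[] []] k l u w; rewrite /Q => h; try by rewrite [LHS]sresM [RHS]sresM h.
    apply: pmap_ext => m y; rewrite -[LHS]/(sres E (cmp u w) m (pcomp p (bd_prism n) m y)) sresM.
    rewrite -[RHS]/(sres E (cmp u w) m (pcomp (sres E u0) a2 m y)) sresM; congr (sres E w m _).
    exact: (congr1 (fun F : pmap (prod_psh (bd n) (Delta 1)) (E k) => F m y) h).
  apply: pmap_ext => m y; rewrite -[LHS]/(sres D (cmp u w) m (pcomp (yon x) (bd_incl n) m y)) sresM.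
  rewrite -[RHS]/(sres D (cmp u w) m (pcomp (sres D u0) a1 m y)) sresM; congr (sres D w m _).
  exact: (congr1 (fun F : pmap (bd n) (D k) => F m y) h).
- rewrite /Q; apply: (colim_map_eq fI (phi := pcomp (prism_code n) (bd_prism n))).
    by move=> m; apply: inj_comp (@prism_code_inj n m) (@bd_prism_inj n m).
  apply: pmap_ext => m [t s].
  transitivity ((p0 : pmap (prod_psh (Delta n) (Delta 1)) (colim E)) m (sval t, s)).
    exact: pE'.
  rewrite path_app.
  have := congr1 (fun c : mpath (colim_map f) m => path_at (sval c).2 s) (ec m t).
  rewrite /= => ->.
  by rewrite [RHS](colim_in_sres u0).
- rewrite /Q; apply: (colim_map_eq fI (phi := bd_incl n)).
    by move=> m y y' /sval_inj.
  apply: pmap_ext => m t.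
  transitivity (pull (sval t) x0); first by rewrite -xE' -pnat.
  have := congr1 (fun c : mpath (colim_map f) m => (sval c).1) (ec m t).
  rewrite /= => ->.
  by rewrite [RHS](colim_in_sres u0).
- rewrite /Q; apply: (colim_eq1 fI); rewrite [RHS]colim_in_sres -[RHS]e0; exact: pE'.
- rewrite /Q; apply: (colim_eq1 fI); rewrite -[RHS]colim_mapE xE' -[RHS]h0; exact: pE'.
have [h00 [h01 [h10 h11]]] := (h (false, false), (h (false, true), (h (true, false), h (true, true)))).
have cP : is_path_from (f k) ((sres D u n x, pcomp (sres E u) p) : prod_psh (D k) (path (E k)) n).
  rewrite /is_path_from /= snat -h00; exact: erefl.
exists k, (cmp u0 u), (exist _ _ cP); split.
  by rewrite sresM -h01.
move=> m t; apply: mpath_ext.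
  rewrite -[RHS]/(sres D (cmp u0 u) m (a1 m t)) sresM.
  have := congr1 (fun F : pmap (bd n) (D k) => F m t) h10 => /= <-.
  by rewrite pnat.
apply: path_ext => l w s.
rewrite -[LHS]/(sres E u l (path_at (pull w
   (pull (sval t) p)) s)) res_comp -path_app.
rewrite -[RHS]/(sres E (cmp u0 u) l (path_at (pull w (sval (a m t)).2) s)) sresM.
have := congr1 (fun F : pmap (prod_psh (bd n) (Delta 1)) (E k) =>
  F l (pull w (t : bd n m), s)) h11 => /= ->.
by rewrite pnat.
Qed.

End Local.

(** * Sectionwise types *)

(** In high dimensions all the homotopy groups which obstruct lifting vanish. *)
Lemma sectionwise_path_lifting (C : category) (X Y : spsh C) (f : spmap X Y) :
  presheaf_of_kan X -> presheaf_of_kan Y ->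
  (exists n, sectionwise_type n X) -> (exists n, sectionwise_type n Y) ->
  exists N, forall U k, N <= k -> path_lifting (f U) k.
Proof.
move=> hX hY [n tX] [n' tY].
(* lifting in dimension k.+1 involves pi_k of X and pi_(k.+1) of Y *)
exists (n + n').+2 => U [|k] // kN.
apply: path_lifting_strict => //; apply: strict_lifting_succ => //.
  move=> x a sa _.
  apply/(@sphere_homotopicP _ _ _ (Sphere (@vc_sphere _ x k)) (Sphere sa)) => //.
  by apply: tX; lia.
move=> x b sb; exists (vc x k.+1); split=> //; rewrite vc_map.
apply/(@sphere_homotopicP _ _ _ (Sphere (@vc_sphere _ _ k.+1)) (Sphere sb)) => //.
by apply: tY; lia.
Qed.

Lemma weak_equivalence_path_lifting (X Y : sset) (f : pmap X Y) k :
  kan X -> kan Y -> weak_equivalence f -> path_lifting f k.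
Proof.
move=> kX kY wf; apply: path_lifting_strict => //; case: k => [|k].
  exact/strict_lifting0/weak_equivalence_surj0.
apply: strict_lifting_succ => //; first exact: weak_equivalence_inj_at.
exact: weak_equivalence_surj_at.
Qed.

(** * Generators of the Borel constructions *)

Local Open Scope group_scope.

Section Borel.
Variables (I : category) (G : profinite I) (i : I).

Definition borel_obj U k (F : borel G i U k) (a : 'I_k.+1) : hom U (gset_grp G i) :=
  (F : functor (ord_cat k) (tgrpd (rtrans_action U i))) a.

Definition borel_arr U k (F : borel G i U k) (a b : 'I_k.+1) (ab : a <= b) : G i :=
  sval (fmor (F : functor (ord_cat k) (tgrpd (rtrans_action U i))) ab).

Lemma borel_arrP U k (F : borel G i U k) (a b : 'I_k.+1) (ab : a <= b) :
  rtrans_action U i (borel_arr F ab) (borel_obj F a) = borel_obj F b.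
Proof.
exact: (svalP (fmor (F : functor (ord_cat k) (tgrpd (rtrans_action U i)))
  (ab : @hom (ord_cat k) a b))).
Qed.

Lemma borel_arrM U k (F : borel G i U k) (a b c : 'I_k.+1) (ab : a <= b) (bc : b <= c) (ac : a <= c) :
  borel_arr F ac = borel_arr F bc * borel_arr F ab.
Proof.
rewrite /borel_arr (_ : ac = leq_trans ab bc); last exact: bool_irrelevance.
have := fmorM (F : functor (ord_cat k) (tgrpd (rtrans_action U i)))
  (bc : @hom (ord_cat k) b c) (ab : @hom (ord_cat k) a b).
by move/(congr1 sval).
Qed.

Lemma borel_arr1 U k (F : borel G i U k) (a : 'I_k.+1) (aa : a <= a) : borel_arr F aa = 1.
Proof.
rewrite /borel_arr (_ : aa = leqnn a); last exact: bool_irrelevance.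
have := fmor1 (F : functor (ord_cat k) (tgrpd (rtrans_action U i))) a.
by move/(congr1 sval).
Qed.

Definition borel_coord U k (F : borel G i U k) (a : 'I_k.+1) : G i :=
  @borel_arr U k F ord0 a (leq0n a).

(** The group elements along the arrows out of the first vertex determine the
    others, by division. *)
Lemma borel_ext U k (F F' : borel G i U k) : borel_obj F ord0 = borel_obj F' ord0 ->
  (forall a, borel_coord F a = borel_coord F' a) -> F = F'.
Proof.
move=> e0 ea; apply: tgrpd_functor_ext => [a|a b ab].
  rewrite -[LHS]/(borel_obj F a) -[RHS]/(borel_obj F' a).
  have := @borel_arrP U k F ord0 a (leq0n a).
  have := @borel_arrP U k F' ord0 a (leq0n a).
  by rewrite -!/(borel_coord _ a) ea e0 => -> ->.
rewrite -[LHS]/(@borel_arr U k F a b ab) -[RHS]/(@borel_arr U k F' a b ab).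
have := @borel_arrM U k F ord0 a b (leq0n a) ab (leq0n b).
have := @borel_arrM U k F' ord0 a b (leq0n a) ab (leq0n b).
rewrite -!/(borel_coord _ _) !ea => ->.
by move/mulIg.
Qed.

(** Any simplex is the restriction, along its first vertex, of a unique simplex
    which starts at the identity of [G_i]; this is the decomposition of the
    Borel construction into copies of the presheaf represented by [G_i]. *)
Definition borel_gen k (F : borel G i (gset_grp G i) k) : Prop :=
  borel_obj F ord0 = idm _.

Lemma borel_gen_ex U k (F : borel G i U k) : exists F0 : borel G i (gset_grp G i) k,
  borel_gen F0 /\ F = sres (borel G i) (borel_obj F ord0) k F0.
Proof.
pose g := borel_coord F.
pose o (a : ord_cat k) : tgrpd (rtrans_action (gset_grp G i) i) :=
  rtrans_action (gset_grp G i) i (g a) (idm (gset_grp G i)).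
have mP (a b : 'I_k.+1) (ab : a <= b) :
    rtrans_action (gset_grp G i) i (borel_arr F ab) (o a) = o b.
  have := @borel_arrM U k F ord0 a b (leq0n a) ab (leq0n b).
  by rewrite /o -lactM -!/(borel_coord _ _) /g => ->.
pose m (a b : ord_cat k) (ab : hom a b) : hom (o a) (o b) :=
  exist (fun h => rtrans_action (gset_grp G i) i h (o a) = o b) (borel_arr F ab) (mP a b ab).
have m1 a : m a a (idm a) = idm (o a) by apply: sval_inj; apply: borel_arr1.
have mM a b c (v : hom b c) (u : hom a b) : m a c (cmp v u) = cmp (m b c v) (m a b u).
  by apply: sval_inj; apply: borel_arrM.
pose F0 : borel G i (gset_grp G i) k :=
  @Functor (ord_cat k) (tgrpd (rtrans_action (gset_grp G i) i)) o m m1 mM.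
have gF0 : borel_gen F0.
  rewrite /borel_gen -[LHS]/(o ord0) /o /g /borel_coord borel_arr1; exact: lact1.
exists F0; split=> //.
apply: borel_ext => //.
rewrite -[RHS]/(cmp (borel_obj F0 ord0) (borel_obj F ord0)) gF0.
by rewrite cmp1m.
Qed.

Lemma borel_generated : generated (B := borel G i) borel_gen.
Proof.
split.
- move=> U k F; exists (borel_obj F ord0).
  by have [F0 [g0 e]] := borel_gen_ex F; exists F0.
- move=> k F0 F1 g0 g1 W w w' e.
  have ew : w = w'.
    rewrite -[w]cmp1m -[w']cmp1m -{1}g0 -g1.
    exact: (congr1 (fun F : borel G i W k => borel_obj F ord0) e).
  split=> //; apply: borel_ext; first by rewrite g0 g1.
  by move=> a; apply: (congr1 (fun F : borel G i W k => borel_coord F a) e).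
- move=> m n t F nt gF.
  have t0 : t ord0 = ord0.
    have [a ta] := (mono_surjP t).1 nt ord0.
    by apply: val_inj; apply/eqP; rewrite -leqn0 -[0]/(val (ord0 : 'I_n.+1)) -ta; apply: monoP.
  by rewrite /borel_gen -[LHS]/(borel_obj F (t ord0)) t0.
Qed.

Lemma borel_gen_finitary k : finitary {F : borel G i (gset_grp G i) k | borel_gen F}.
Proof.
exists {ffun 'I_k.+1 -> G i}, (fun F => [ffun a => borel_coord (sval F) a]).
move=> [F gF] [F' gF'] /ffunP /= e; apply: sval_inj; apply: borel_ext => /=.
  by rewrite gF gF'.
by move=> a; have := e a; rewrite !ffunE.
Qed.

End Borel.

Lemma borel_tr_gen (I : category) (G : profinite I) i j (u : hom j i) k
  (F : borel G j (gset_grp G j) k) : borel_gen F ->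
  exists F0 : borel G i (gset_grp G i) k, borel_gen F0 /\
    borel_tr G u (gset_grp G j) k F = sres (borel G i) (gset_tr G u) k F0.
Proof.
move=> gF; have [F0 [g0 e]] := borel_gen_ex (borel_tr G u (gset_grp G j) k F).
exists F0; split=> //; rewrite {1}e; congr (sres _ _ k F0).
rewrite -[LHS]/(cmp (gset_tr G u) (borel_obj F ord0)) gF.
exact: cmpm1.
Qed.

Local Close Scope group_scope.

(** * Lifting out of the Borel constructions *)

Definition cpath (X Y : sset) (f : pmap X Y) m (v : X m) : mpath f m.
Proof.
exists ((v, pcomp (yon (f m v)) (pr1 _ _)) : prod_psh X (path Y) m).
by rewrite /is_path_from /path_at /= res_id.
Defined.

Lemma cpath_at (X Y : sset) (f : pmap X Y) m (v : X m) s : path_at (sval (cpath f v)).2 s = f m v.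
Proof. by rewrite /path_at /= res_id. Qed.

Lemma cpath_res (X Y : sset) (f : pmap X Y) l m (w : mono l m) (v : X m) :
  cpath f (pull w v) = pull w (cpath f v).
Proof.
apply: mpath_ext => //; apply: path_ext => k t s.
by rewrite -path_app /= pnat /path_at /= res_comp; congr (res _ _); apply: mono_ext.
Qed.

Lemma cpath_sres (C : category) (X Y : spsh C) (f : spmap X Y) U V (u : hom U V) m (v : X V m) :
  cpath (f U) (sres X u m v) = sres (mpathS f) u m (cpath (f V) v).
Proof.
apply: mpath_ext => //; apply: pmap_ext => l t /=.
by rewrite snat pnat.
Qed.

(** The generators need not be mapped to generators by the transition maps [btr],
    but to their restrictions along [vtr]. *)
Record free_diagram (I C : category) (B : I -> spsh C)
  (btr : forall i j, hom j i -> spmap (B j) (B i)) (V : I -> C)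
  (vtr : forall i j, hom j i -> hom (V j) (V i))
  (gen : forall i k, B i (V i) k -> Prop) : Prop := FreeDiagram {
  fd_btr1 : forall i U m (x : B i U m), btr i i (idm i) U m x = x;
  fd_btrM : forall i j k (u : hom j i) (v : hom k j) U m (x : B k U m),
    btr i k (cmp u v) U m x = btr i j u U m (btr j k v U m x);
  fd_vtrM : forall i j k (u : hom j i) (v : hom k j),
    vtr i k (cmp u v) = cmp (vtr i j u) (vtr j k v);
  fd_gen : forall i, generated (gen i);
  fd_finitary : forall i k, finitary {x : B i (V i) k | gen i k x};
  fd_tr : forall i j (u : hom j i) k (x : B j (V j) k), gen j k x ->
    exists x1, gen i k x1 /\ btr i j u (V j) k x = sres (B i) (vtr i j u) k x1
}.

Section Stages.
Variables (I C : category) (fI : left_filtered I) (P Y : spsh C) (q : spmap P Y).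
Variables (B : I -> spsh C) (btr : forall i j, hom j i -> spmap (B j) (B i)).
Variables (V : I -> C) (vtr : forall i j, hom j i -> hom (V j) (V i)).
Variable gen : forall i k, B i (V i) k -> Prop.
Hypothesis fd : free_diagram btr vtr gen.

Hypothesis local_lift : forall k i (a : pmap (bd k) (P (V i))) (b : Y (V i) k),
  (forall m (t : bd k m), q (V i) m (a m t) =
     pull (sval t) b) ->
  exists j (u : hom j i) (c : P (V j) k),
    q (V j) k c = sres Y (vtr u) k b /\
    forall m (t : bd k m), pull (sval t) c =
      sres P (vtr u) m (a m t).

(** The lifting problem of each generator of dimension [k] at stage [i] is solved at
    some later stage, and there are finitely many of them, so that one stage [j]
    serves for all. There are more generators at stage [j], but each of them lies
    over the restriction of a generator at stage [i], the solution for which can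
    be used. *)
Lemma stage_step i (b : spmap (B i) Y) (g : pgraph (B i) P) k :
  gover q b g -> gsat g -> gcov g k ->
  exists j (u : hom j i) (g' : pgraph (B j) P),
    [/\ gover q (spcomp b (btr u)) g', gsat g', gcov g' k.+1 &
        forall U m x p, g U m (btr u U m x) p -> g' U m x p].
Proof.
move=> og satg cov.
pose T := {x : B i (V i) k | gen x}.
have [|x|j [u h]] := @common_stage I fI T i (fun x j u => exists c : P (V j) k,
  q (V j) k c = sres Y (vtr u) k (b _ k (sval x)) /\
  forall m (t : mono m k), in_boundary (t : Delta k m) -> forall p,
    g _ m (pull t (sval x)) p ->
    pull t c = sres P (vtr u) m p) (fd_finitary fd i k).
- move=> x j l u v [c [qc cb]]; exists (sres P (vtr v) k c); split.
    by rewrite snat qc -sresM (fd_vtrM fd).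
  by move=> m t tb p gp; rewrite -sres_res (cb _ _ tb _ gp) -sresM (fd_vtrM fd).
- have [a aP] := boundary_map (@cov_boundary _ _ _ g k cov _ (sval x)).
  have [|j [u [c [qc cb]]]] := @local_lift k i a (b _ k (sval x)).
    by move=> m t; rewrite (og _ _ _ _ (aP m t)) pnat.
  exists j, u, c; split=> // m t tb p gp.
  rewrite (cb m (exist _ (t : Delta k m) tb)); congr (sres P _ m _).
  exact: gr_fun (aP m (exist _ (t : Delta k m) tb)) gp.
pose r U m (x : B j U m) p := g U m (btr u U m x) p.
have r1 U W (w : hom U W) m (x : B j W m) p : r W m x p ->
    r U m (sres (B j) w m x) (sres P w m p).
  by rewrite /r snat; apply: gr_sres.
have r2 U l m (w : mono l m) (x : B j U m) p : r U m x p ->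
    r U l (pull w x) (pull w p).
  by rewrite /r pnat; apply: gr_res.
have r3 U m (x : B j U m) p p' : r U m x p -> r U m x p' -> p = p' by apply: gr_fun.
pose g0 := PGraph r1 r2 r3.
have o0 : gover q (spcomp b (btr u)) g0 by move=> U m x p; apply: og.
have s0 : gsat g0.
  by move=> U W w m x [p rp]; apply: (satg _ _ w); exists p; rewrite -snat.
have c0 : gcov g0 k by move=> U m x mk; apply: cov.
have [x0 gx0 _|g' [g0g' og' satg' cov']] := cell_step (fd_gen fd j) o0 s0 c0.
  have [x1 [gx1 e]] := fd_tr fd u gx0.
  have [c [qc cb]] := h (exist _ x1 gx1).
  exists c; split; first by rewrite qc -[RHS]/(b _ k (btr u _ k x0)) e snat.
  move=> m t tb.
  have [p gp] := cov_boundary cov x1 tb.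
  rewrite (cb _ _ tb _ gp).
  have := gr_sres (vtr u) gp.
  by rewrite sres_res -e -pnat.
exists j, u, g'; split=> // U m x p gp; exact: g0g'.
Qed.

Lemma late_lift_below i (b : spmap (B i) Y) (g : pgraph (B i) P) k :
  gover q b g -> gsat g ->
  exists j (u : hom j i) (g' : pgraph (B j) P),
    [/\ gover q (spcomp b (btr u)) g', gsat g', gcov g' k &
        forall U m x p, g U m (btr u U m x) p -> g' U m x p].
Proof.
move=> og satg; elim: k => [|k [j [u [g' [og' satg' cov' gg']]]]].
  exists i, (idm i), g; split=> // U m x p; last by rewrite (fd_btr1 fd).
  by move=> /og ->; rewrite -[RHS]/(b U m (btr (idm i) U m x)) (fd_btr1 fd).
have [l [v [g2 [og2 satg2 cov2 g'g2]]]] := stage_step og' satg' cov'.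
exists l, (cmp u v), g2; split=> // U m x p.
  by move=> /og2 ->; rewrite -[RHS]/(b U m (btr (cmp u v) U m x)) (fd_btrM fd).
by rewrite (fd_btrM fd) => /gg'/g'g2.
Qed.

Variable N : nat.
Hypothesis section_lift : forall U k, N <= k -> forall (x : Y U k) (a : pmap (bd k) (P U)),
  (forall m (t : bd k m), q U m (a m t) = pull (sval t) x) ->
  exists c : P U k, q U k c = x /\
    forall m (t : bd k m), pull (sval t) c = a m t.

(** Local liftings may require a new stage for each dimension, which is possible
    finitely many times. From dimension [N] on, the problems are solved in each
    section, and the stage stays fixed. *)
Theorem late_lift i (b : spmap (B i) Y) (g : pgraph (B i) P) :
  gover q b g -> gsat g ->
  exists j (u : hom j i) (h : spmap (B j) P),
    (forall U m x p, g U m (btr u U m x) p -> h U m x = p) /\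
    (forall U m x, q U m (h U m x) = b U m (btr u U m x)).
Proof.
move=> og satg.
have [j [u [g' [og' satg' cov' gg']]]] := late_lift_below N og satg.
have [k x0 a Nk ab|h [hg hq]] := cell_lifting (fd_gen fd j) og' satg' cov'.
  exact: section_lift.
exists j, u, h; split=> // U m x p gp.
by apply: hg; apply: gg'.
Qed.

End Stages.

(** * Lifting for the colimit of function complexes *)

Section HomDiagram.
Variables (I C : category) (fI : left_filtered I) (X Y : spsh C) (f : spmap X Y).
Variables (Z : I -> spsh C) (ztr : forall i j, hom j i -> spmap (Z j) (Z i)).
Variables (V : I -> C) (vtr : forall i j, hom j i -> hom (V j) (V i)).
Variable gen : forall i k, Z i (V i) k -> Prop.
Hypothesis fd : free_diagram ztr vtr gen.
Variable n : nat.

Let B i := sprod (Z i) (Delta n).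
Let btr i j (u : hom j i) : spmap (B j) (B i) := sprod_map (ztr u) (pid (Delta n)).

Lemma free_diagram_prod :
  free_diagram btr vtr (fun i k (x : B i (V i) k) => gen x.1).
Proof.
split.
- by move=> i U m [z t]; rewrite /= (fd_btr1 fd).
- by move=> i j k u v U m [z t]; rewrite /= (fd_btrM fd).
- exact: fd_vtrM fd.
- by move=> i; apply: generated_prod (fd_gen fd i).
- move=> i k; have [F [phi inj]] := fd_finitary fd i k.
  exists (F * {ffun 'I_k.+1 -> 'I_n.+1})%type, (fun x : {x : B i (V i) k | gen x.1} =>
    (phi (exist _ (sval x).1 (svalP x)), [ffun a => ((sval x).2 : mono k n) a])).
  move=> [[x t] gx] [[y s] gy] [/inj e /ffunP e']; apply: sval_inj => /=.
  congr (_, _); first exact: (congr1 sval e).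
  by apply: mono_ext => a; have := e' a; rewrite !ffunE.
- move=> i j u k [z t] gz; have [z1 [g1 e]] := fd_tr fd u gz.
  by exists (z1, t); split=> //=; rewrite e.
Qed.

Hypothesis local_lift : forall k i (a : pmap (bd k) (mpathS f (V i))) (b : Y (V i) k),
  (forall m (t : bd k m), mpathS_end f (V i) m (a m t) =
     pull (sval t) b) ->
  exists j (u : hom j i) (c : mpathS f (V j) k),
    mpathS_end f (V j) k c = sres Y (vtr u) k b /\
    forall m (t : bd k m), pull (sval t) c =
      sres (mpathS f) (vtr u) m (a m t).

Variable N : nat.
Hypothesis section_lift : forall U k, N <= k -> path_lifting (f U) k.

Let lift := late_lift fI free_diagram_prod local_lift
  (fun U k Nk x a => @section_lift U k Nk a x).

Lemma adjoint_boundary (W X' : spsh C) (a : pmap (bd n) (function_complex W X')) U m l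
  (w : mono l m) (t : bd n m) (z : W U l) :
  (a l (pull w t) : spmap (sprod W (Delta l)) X') U l (z, mono_id l) =
  (a m t : spmap (sprod W (Delta m)) X') U l (z, w).
Proof.
rewrite pnat /=; apply: (congr1 (fun v : mono l m =>
  (a m t : spmap (sprod W (Delta m)) X') U l (z, v))); exact: mono_ext.
Qed.

(** By adjunction [a] is a map on the product of [Z i] with the boundary of the
    simplex; with constant paths it gives a partial lift of [b] to the mapping path
    object, to which [late_lift] applies. *)
Lemma hom_lift i (a : pmap (bd n) (function_complex (Z i) X)) (b : spmap (B i) Y) :
  (forall m (t : bd n m), spcomp f (a m t : spmap _ _) =
     pull (sval t) (b : function_complex (Z i) Y n)
     :> function_complex (Z i) Y m) ->
  exists j (u : hom j i) (h : spmap (B j) (mpathS f)),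
    (forall U m (z : Z j U m) (t : bd n m), h U m (z, sval t) =
       cpath (f U) ((a m t : spmap (sprod (Z i) (Delta m)) X) U m
         (ztr u U m z, mono_id m))) /\
    (forall U m x, mpathS_end f U m (h U m x) = b U m (btr u U m x)).
Proof.
move=> e.
pose av m (t : bd n m) U l (x : sprod (Z i) (Delta m) U l) : X U l :=
  (a m t : spmap (sprod (Z i) (Delta m)) X) U l x.
have avn U m l (w : mono l m) (t : bd n m) y :
    av m t U l (pull w y) = pull w (av m t U m y).
  exact: pnat.
have avE U m l (w : mono l m) (t : bd n m) (z : Z i U l) :
    av l (pull w t) U l (z, mono_id l) = av m t U l (z, w).
  exact: adjoint_boundary.
pose r U m (x : B i U m) (p : mpathS f U m) := exists pf : in_boundary (x.2 : Delta n m),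
  p = cpath (f U) (av m (exist _ (x.2 : Delta n m) pf) U m (x.1, mono_id m)).
have r1 U W (u : hom U W) m (x : B i W m) p : r W m x p ->
    r U m (sres (B i) u m x) (sres (mpathS f) u m p).
  by case: x => z t [pf ->]; exists pf; rewrite -cpath_sres /av -snat.
have r2 U l m (w : mono l m) (x : B i U m) p : r U m x p ->
    r U l (pull w x) (pull w p).
  case: x => z t [pf ->]; exists (in_boundary_res (w : @hom simplex_cat l m) pf).
  rewrite -cpath_res; congr cpath.
  pose t0 : bd n m := exist _ (t : Delta n m) pf.
  transitivity (av l (pull w t0) U l
    (pull w z, mono_id l)).
    rewrite avE -[LHS]avn.
    by apply: (congr1 (fun v => av m t0 U l (_, v))); apply: mono_ext.
  by apply: (congr1 (fun t1 => av l t1 U l _)); apply: sval_inj.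
have r3 U m (x : B i U m) p p' : r U m x p -> r U m x p' -> p = p'.
  move=> [pf ->] [pf' ->]; congr cpath.
  by apply: (congr1 (fun t1 => av m t1 U m _)); apply: sval_inj.
have o0 : gover (mpathS_end f) b (PGraph r1 r2 r3).
  move=> U m [z t] p [pf ->].
  rewrite -[LHS]/(path_at (sval (cpath (f U) (av m (exist _ (t : Delta n m) pf) U m
    (z, mono_id m)))).2 (Dend true m)) cpath_at.
  have := congr1 (fun h : spmap (sprod (Z i) (Delta m)) Y => h U m (z, mono_id m))
    (e m (exist _ (t : Delta n m) pf)).
  rewrite -[X in X = _ -> _]/(f U m (av m (exist _ (t : Delta n m) pf) U m (z, mono_id m))) => ->.
  by apply: (congr1 (fun v => b U m (z, v))); apply: mono_ext.
have s0 : gsat (PGraph r1 r2 r3).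
  by move=> U W u m [z t] [p [pf _]]; eexists; exists pf.
have [j [u [h [hg hq]]]] := lift o0 s0.
exists j, u, h; split=> // U m z t.
apply: hg; exists (svalP t); congr cpath.
by apply: (congr1 (fun t1 => av m t1 U m _)); apply: sval_inj.
Qed.

(* The diagrams of function complexes, for arbitrary proofs of the functor laws. *)
Variables (px1 : forall i m (x : function_complex (Z i) X m),
             function_complex_pre X (ztr (idm i)) m x = x)
  (pxM : forall i j k (v : hom j k) (u : hom i j) m (x : function_complex (Z k) X m),
     function_complex_pre X (ztr (cmp v u)) m x =
     function_complex_pre X (ztr u) m (function_complex_pre X (ztr v) m x)).
Variables (py1 : forall i m (x : function_complex (Z i) Y m),
             function_complex_pre Y (ztr (idm i)) m x = x)
  (pyM : forall i j k (v : hom j k) (u : hom i j) m (x : function_complex (Z k) Y m),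
     function_complex_pre Y (ztr (cmp v u)) m x =
     function_complex_pre Y (ztr u) m (function_complex_pre Y (ztr v) m x)).

Let HX : spsh I := @Spsh I (fun i => function_complex (Z i) X)
  (fun j i (u : hom j i) => function_complex_pre X (ztr u)) px1 pxM.
Let HY : spsh I := @Spsh I (fun i => function_complex (Z i) Y)
  (fun j i (u : hom j i) => function_complex_pre Y (ztr u)) py1 pyM.

Variable pf1 : forall i j (u : hom i j) m (x : HX j m),
  function_complex_post (Z i) f m (sres HX u m x) =
  sres HY u m (function_complex_post (Z j) f m x).

Let Hf : spmap HX HY := @Spmap I HX HY (fun i => function_complex_post (Z i) f) pf1.

(** The simplex and its boundary are finite, so that the square comes from a
    stage. There [hom_lift] gives a map to the mapping path object; its first
    component is the lift and its second component the homotopy. *)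
Theorem hom_diagram_strict_lifting : strict_lifting (colim_map Hf) n.
Proof.
move=> a0 b0 ab.
have [i1 [a1 aE]] : exists i (a' : pmap (bd n) (HX i)), pcomp (colim_in HX i) a' = a0.
  by apply: (colim_map_lift fI (phi := bd_incl n)) => m x y; apply: sval_inj.
have [i2 [b2 bE]] := colim_ex (b0 n (mono_id n)).
have [i3 [[v1] [v2]]] := lf_bound fI i1 i2.
have [i [v3 e]] : exists i (v3 : hom i i3),
    pcomp (sres HY v3) (pcomp (Hf i3) (pcomp (sres HX v1) a1)) =
    pcomp (sres HY v3) (pcomp (yon (sres HY v2 n b2)) (bd_incl n)).
  apply: (colim_map_eq fI (phi := bd_incl n)) => [m x y|]; first exact: sval_inj.
  apply: pmap_ext => m t.
  rewrite -[LHS]/(colim_in HY i3 m (Hf i3 m (sres HX v1 m (a1 m t)))) -colim_mapE colim_in_sres.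
  rewrite -[colim_in HX i1 m (a1 m t)]/(pcomp (colim_in HX i1) a1 m t) aE ab.
  rewrite -[RHS]/(colim_in HY i3 m (pull (sval t) (sres HY v2 n b2))).
  by rewrite pnat colim_in_sres -bE -pnat; congr (b0 m _); apply: mono_ext.
pose a : pmap (bd n) (HX i) := pcomp (sres HX v3) (pcomp (sres HX v1) a1).
pose b : HY i n := sres HY v3 n (sres HY v2 n b2).
have {}aE m t : colim_in HX i m (a m t) = a0 m t by rewrite !colim_in_sres -aE.
have {}bE : b0 = yon (colim_in HY i n b).
  by rewrite [b0]yon_eta bE !colim_in_sres.
have {ab}e m (t : bd n m) : Hf i m (a m t) = pull (sval t) b.
  have := congr1 (fun F : pmap (bd n) (HY i) => F m t) e.
  rewrite -[X in X = _ -> _]/(sres HY v3 m (Hf i3 m (sres HX v1 m (a1 m t)))) -snat => ->.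
  by rewrite /b -sres_res.
have [j [u [h [hbd hq]]]] := @hom_lift i a b e.
have @c : spmap (B j) X.
  exists (fun U => pcomp (pr1 _ _) (pcomp (sub_incl _) (h U)) : pmap (B j U) (X U)).
  by move=> U W w m x; rewrite -[LHS]/(sval (h U m _)).1 snat.
have @p : spmap (B j) (pathS Y).
  exists (fun U => pcomp (pr2 _ _) (pcomp (sub_incl _) (h U)) : pmap (B j U) (path (Y U))).
  by move=> U W w m x; rewrite -[LHS]/(sval (h U m _)).2 snat.
have p0 U m x : path_at (p U m x) (Dend false m) = f U m (c U m x) by apply: (svalP (h U m x)).
have p1 U m x : path_at (p U m x) (Dend true m) = b U m (btr u U m x) by apply: hq.
exists (yon (colim_in HX j n c)); split.
  move=> m t; rewrite -[LHS]/(pull (sval t) (colim_in HX j n c)) -pnat.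
  rewrite -aE -(colim_in_sres u); congr (colim_in HX j m _).
  apply: spmap_ext => U l [z w].
  rewrite -[LHS]/(c U l (z, sval (pull w t))).
  rewrite -[LHS]/((sval (h U l (z, sval (pull w t)))).1) hbd.
  exact: adjoint_boundary.
have @H : pmap (prod_psh (Delta n) (Delta 1)) (HY j).
  unshelve eexists (fun m (x : prod_psh (Delta n) (Delta 1) m) =>
    @Spmap _ (sprod (Z j) (Delta m)) Y (fun U =>
      @Pmap _ (prod_psh (Z j U) (Delta m)) (Y U) (fun l y =>
        path_uncurry p U l ((y.1, mono_comp x.1 y.2), mono_comp x.2 y.2)) _) _ : HY j m).
  - move=> l k w [z v]; rewrite -[RHS]pnat; apply: (congr1 (path_uncurry p U l)).
    by congr (_, _, _); apply: mono_ext.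
  - by move=> U W w l [z v]; rewrite -[RHS]snat.
  - move=> l m w [t s]; apply: spmap_ext => U k [z v].
    by apply: (congr1 (path_uncurry p U k)); congr (_, _, _); apply: mono_ext.
exists (pcomp (colim_in HY j) H); split=> m t.
- rewrite -[RHS]/(colim_map Hf m (pull t (colim_in HX j n c))) -pnat colim_mapE.
  rewrite -[LHS]/(colim_in HY j m (H m (t, Dend false m))); congr (colim_in HY j m _).
  apply: spmap_ext => U l [z w].
  rewrite -[LHS]/(path_at (p U l (z, mono_comp t w)) (mono_comp (Dend false m) w)).
  by rewrite Dend_res p0.
- rewrite bE -[RHS]/(pull t (colim_in HY i n b)) -(colim_in_sres u) -pnat.
  rewrite -[LHS]/(colim_in HY j m (H m (t, Dend true m))); congr (colim_in HY j m _).
  apply: spmap_ext => U l [z w].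
  rewrite -[LHS]/(path_at (p U l (z, mono_comp t w)) (mono_comp (Dend true m) w)).
  by rewrite Dend_res p1.
move=> s tb.
rewrite -[RHS]/(colim_map Hf m (pull t (colim_in HX j n c))) -pnat colim_mapE.
rewrite -[LHS]/(colim_in HY j m (H m (t, s))); congr (colim_in HY j m _).
apply: spmap_ext => U l [z w].
rewrite -[LHS]/(path_at (p U l (z, mono_comp t w)) (mono_comp s w)).
rewrite -[RHS]/(f U l (c U l (z, mono_comp t w))) -p0.
have := hbd U l z (pull w (exist _ (t : Delta n m) tb : bd n m)).
rewrite -[sval _]/(mono_comp t w) => hE.
rewrite -!/(sval (h U l (z, mono_comp t w))).2.
by rewrite -[p U l _]/(sval (h U l (z, mono_comp t w))).2 hE !cpath_at.
Qed.

End HomDiagram.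

(** * From lifting of strict squares to homotopy groups *)

Lemma inj_surj_bijective (S T : Type) (h : S -> T) :
  injective h -> (forall y, exists x, h x = y) -> bijective h.
Proof.
move=> inj surj; exists (fun y => sval (cid (surj y))) => [x|y]; last by case: cid.
by apply: inj; case: cid.
Qed.

Section LiftingPiIso.
Variables (X Y : sset) (f : pmap X Y).
Hypotheses (kX : kan X) (kY : kan Y) (sl : forall n, strict_lifting f n).

(** The homotopy from [f a] to [f a'] is lifted to the mapping path object of [f],
    relatively to the boundary of the prism, where constant paths are
    prescribed. *)
Lemma strict_lifting_rhtp n (a a' : pmap (Delta n) X) :
  (forall m (t : Delta n m), in_boundary t -> a m t = a' m t) ->
  rhtp (pcomp f a) (pcomp f a') -> rhtp a a'.
Proof.
move=> aa' [h [h0 h1 hb]].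
pose K := prod_psh (Delta n) (Delta 1).
pose fS : spmap (cst_spsh X) (cst_spsh Y) :=
  @Spmap _ (cst_spsh X) (cst_spsh Y) (fun _ => f) (fun _ _ _ _ _ => erefl).
pose hS : spmap (cst_spsh K) (cst_spsh Y) :=
  @Spmap _ (cst_spsh K) (cst_spsh Y) (fun _ => h) (fun _ _ _ _ _ => erefl).
pose ea (e : bool) := if e then a' else a.
pose r (U : unit_cat) m (x : K m) (p : mpath f m) := exists e : bool,
  (in_boundary x.1 \/ x.2 = Dend e m) /\ p = cpath f (ea e m x.1).
have r1 U V (u : hom U V) m (x : cst_spsh K V m) (p : mpathS fS V m) : r V m x p ->
    r U m (sres (cst_spsh K) u m x) (sres (mpathS fS) u m p).
  by move=> [e [xe ->]]; exists e; split=> //; rewrite -cpath_sres.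
have r2 U l m (w : mono l m) (x : K m) p : r U m x p ->
    r U l (pull w x) (pull w p).
  move=> [e [xe ->]]; exists e; split; last by rewrite -cpath_res -pnat.
  case: xe => [tb|/= ->]; first by left; apply: in_boundary_res.
  by right; apply: Dend_res.
have r3 U m (x : K m) p p' : r U m x p -> r U m x p' -> p = p'.
  move=> [e [xe ->]] [e' [xe' ->]].
  have [tb|ntb] := pselect (in_boundary x.1).
    by congr cpath; case: e {xe}; case: e' {xe'} => //=; rewrite aa'.
  by case: xe xe' => // -> [//|/Dend_inj ->].
have o0 : gover (mpathS_end fS) hS (@PGraph _ (cst_spsh K) (mpathS fS) r r1 r2 r3).
  move=> U m [t s] p [e [xe ->]].
  rewrite -[LHS]/(path_at (sval (cpath f (ea e m t))).2 (Dend true m)) cpath_at.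
  rewrite -[RHS]/(h m (t, s)); move: xe => /= [tb|->]; last by case: e; rewrite ?h0 ?h1.
  by rewrite hb //; case: e => //=; rewrite aa'.
have s0 : gsat (@PGraph _ (cst_spsh K) (mpathS fS) r r1 r2 r3).
  by move=> U V u m x [p rp]; exists p.
have [//|k x0 b _ ab|H [Hg Hq]] := cell_lifting (cst_generated K) (N := 0) o0 s0.
  exact: (@path_lifting_strict X Y f k kY (@sl k) b (h k x0) ab).
exists (pcomp (pr1 _ _) (pcomp (sub_incl _) (H tt))).
have HE m (x : K m) (e : bool) : in_boundary x.1 \/ x.2 = Dend e m ->
    (sval (H tt m x)).1 = ea e m x.1.
  by move=> xe; rewrite (Hg tt m x (cpath f (ea e m x.1))) //; exists e.
split=> m t.
- by apply: (HE m (t, Dend false m) false); right.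
- by apply: (HE m (t, Dend true m) true); right.
- by move=> s tb; apply: (HE m (t, s) false); left.
Qed.

Theorem strict_lifting_pi_iso : pi_iso f.
Proof.
split=> [|x n n0]; apply: inj_surj_bijective.
- move=> c c'; rewrite -[c]reprK -[c']reprK !pi0_mapE => /(edge_relatedP _ _ kY) h.
  apply/edge_relatedP => //; apply: strict_lifting_rhtp; last by rewrite !yon_map.
  by move=> m t [j tj]; have := tj ord0; rewrite [t _]ord1 [j]ord1.
- move=> c; pose y := repr c.
  have bd0 m (t : bd 0 m) : False.
    by have [j tj] := svalP t; have := tj ord0; rewrite [_ ord0]ord1 [j]ord1.
  have [m t|a [_ ha]] := @sl 0 (@Pmap _ (bd 0) X (fun m t => False_rect _ (bd0 m t))
    (fun m l u t => False_ind _ (bd0 l t))) (yon y); first by case: (bd0 m t).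
  exists (cls _ (a 0 (mono_id 0))); rewrite pi0_mapE -[c]reprK.
  by apply/edge_relatedP => //; rewrite -yon_map -yon_eta.
- move=> c c'; rewrite -[c]reprK -[c']reprK !pi_mapE => /(sphere_homotopicP _ _ kY) h.
  apply/sphere_homotopicP => //; apply: strict_lifting_rhtp => //.
  by move=> m t tb; rewrite !sphP.
move=> c; rewrite -[c]reprK; set b := repr c.
have [|a [ax ha]] := sl (a := pcomp (vc x n) (bd_incl n)) (b := b : pmap _ _).
  by move=> m t /=; rewrite sphP ?/vcst ?pnat //; apply: (svalP t).
have sa : is_sphere x a by move=> m t tb; apply: (ax m (exist _ t tb)).
exists (cls _ (Sphere sa)); rewrite pi_mapE.
by apply/sphere_homotopicP.
Qed.

End LiftingPiIso.

(** * The colimit over a profinite group *)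

Section Main.
Variables (I : category) (G : profinite I).

Lemma borel_free_diagram : free_diagram (fun i j (u : hom j i) => borel_tr G u)
  (fun i j (u : hom j i) => gset_tr G u) (fun i => @borel_gen I G i).
Proof.
split.
- move=> i U m x.
  by apply: tgrpd_functor_ext => [a|a b ab] /=; [apply: gmap_ext => y|]; apply: ptr1.
- move=> i j k u v U m x.
  by apply: tgrpd_functor_ext => [a|a b ab] /=; [apply: gmap_ext => y|]; apply: ptrM.
- by move=> i j k u v; apply: gmap_ext => y; apply: ptrM.
- exact: borel_generated.
- exact: borel_gen_finitary.
- by move=> i j u k x; apply: borel_tr_gen.
Qed.

Variables (X Y : spsh (gset_cat G)) (f : spmap X Y).
Hypotheses (hX : presheaf_of_kan X) (hY : presheaf_of_kan Y).

Lemma stalk_kan (Z : spsh (gset_cat G)) : presheaf_of_kan Z -> kan (colim (stalk_diagram Z)).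
Proof. by move=> hZ; apply: (colim_kan (pfiltered G)) => i; apply: hZ. Qed.

Lemma stalk_local_lift : local_weak_equivalence f ->
  forall k i (a : pmap (bd k) (mpathS f (gset_grp G i))) (b : Y (gset_grp G i) k),
  (forall m (t : bd k m), mpathS_end f (gset_grp G i) m (a m t) =
     pull (sval t) b) ->
  exists j (u : hom j i) (c : mpathS f (gset_grp G j) k),
    mpathS_end f (gset_grp G j) k c = sres Y (gset_tr G u) k b /\
    forall m (t : bd k m), pull (sval t) c =
      sres (mpathS f) (gset_tr G u) m (a m t).
Proof.
move=> hf k i a b ab.
have pl := @weak_equivalence_path_lifting _ _ _ k (stalk_kan hX) (stalk_kan hY) hf.
have [j [u [c [ce cb]]]] := @local_path_lifting I (pfiltered G) _ _ (stalk_diagram_map f) k pl i a b ab.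
exists j, u, c; split; first exact: ce.
move=> m t; apply: etrans (cb m t) _.
by apply: mpath_ext.
Qed.

Lemma borel_hom_kan (Z : spsh (gset_cat G)) : presheaf_of_kan Z -> kan (colim (borel_hom Z)).
Proof.
move=> hZ; apply: (colim_kan (pfiltered G)) => i.
exact: function_complex_kan (borel_generated G i) hZ.
Qed.

End Main.

Theorem theorem1 (I : category) (G : profinite I) (X Y : spsh (gset_cat G))
  (f : spmap X Y)
  (hX : presheaf_of_kan X) (hY : presheaf_of_kan Y)
  (hf : local_weak_equivalence f)
  (nX : exists n, sectionwise_type n X) (nY : exists n, sectionwise_type n Y) :
  weak_equivalence (colim_map (borel_hom_map f)).
Proof.
have [N sl] := sectionwise_path_lifting f hX hY nX nY.
exists (colim (borel_hom X)), (colim (borel_hom Y)), (pid _), (pid _),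
  (colim_map (borel_hom_map f)); split.
- by split; apply: borel_hom_kan.
- by split=> K L p _ a b e; exists a; split=> //; rewrite ?e; apply: pmap_ext.
- exact: pmap_ext.
apply: strict_lifting_pi_iso => [||n]; [exact: borel_hom_kan|exact: borel_hom_kan|].
exact: (hom_diagram_strict_lifting (pfiltered G) (borel_free_diagram G)
  (stalk_local_lift hX hY hf) sl).
Qed.
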